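(* Let $k,n\in\mathbb{N}$, let $(a,b)$ be an open interval, and assume that a real function $f$ on $(a,b)$ is matrix $k$-tone of order $n$. Then the following hold: (a) $f$ is $C^{2n+k-4}$ on $(a,b)$ if $k\ge2$ or $n\ge2$. (b) The following functions are convex on $(a,b)$: $f',f^{(3)},\dots,f^{(2n-3)}$ if $k=1$ and $n\ge2$; and $f^{(k-2)},f^{(k)},\dots,f^{(2n+k-4)}$ if $k\ge2$ and $n\ge1$ (in both lists the order of differentiation increases in steps of $2$). (c) If $n\ge2$, the $n\times n$ matrix $$\Bigl[f^{[k]}(x_i,x_j,\underbrace{x_1,\dots,x_1}_{k-1})\Bigr]_{i,j=1}^n$$ is positive semidefinite for any choice of $x_1,\dots,x_n$ from $(a,b)$. (d) The matrix $$\left[\frac{f^{(i+j+k)}(x)}{(i+j+k)!}\right]_{i,j=0}^{n-1}$$ exists and is positive semidefinite for almost every $x\in(a,b)$.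
   Context: Here $-\infty\le a<b\le\infty$ and $\mathbb{N}=\{1,2,\dots\}$. $\mathbb{M}_n^{sa}(a,b)$ is the set of $n\times n$ Hermitian matrices with all eigenvalues in $(a,b)$, and $f(A)$ is the usual functional calculus; $\le$ is the positive semidefinite order. Scalar divided differences: for distinct points, $f^{[1]}(x_0,x_1)=\frac{f(x_0)-f(x_1)}{x_0-x_1}$ and $f^{[k]}(x_0,\dots,x_k)=\frac{f^{[k-1]}(x_0,\dots,x_{k-1})-f^{[k-1]}(x_1,\dots,x_k)}{x_0-x_k}$; if $f$ is $C^k$ on $(a,b)$, then $f^{[k]}$ extends by continuity to a continuous function on $(a,b)^{k+1}$, and this extension is used when arguments coincide. Matrix-valued divided differences: for $A,B\in\mathbb{M}_n^{sa}(a,b)$ and distinct $t_0,t_1,\dots\in[0,1]$, put $X_l=(1-t_l)A+t_lB$, $f^{[1]}(A,B;t_0,t_1)=\frac{f(X_0)-f(X_1)}{t_0-t_1}$, and recursively $f^{[k]}(A,B;t_0,\dots,t_k)=\frac{f^{[k-1]}(A,B;t_0,\dots,t_{k-1})-f^{[k-1]}(A,B;t_1,\dots,t_k)}{t_0-t_k}$. A real (not necessarily continuous) function $f$ on $(a,b)$ is matrix $k$-tone of order $n$ if $f^{[k]}(A,B;t_0,\dots,t_k)\ge0$ for every $A,B\in\mathbb{M}_n^{sa}(a,b)$ with $A\le B$ and every $0=t_0<t_1<\dots<t_k=1$. *)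

(* Defs.v *)
From HB Require Import structures.
From mathcomp Require Import all_boot all_order all_algebra.
From mathcomp Require Import complex.
From mathcomp Require Import all_classical all_reals all_analysis.

Set Implicit Arguments.
Unset Strict Implicit.
Unset Printing Implicit Defensive.

Import Order.TTheory GRing.Theory Num.Theory.
Import numFieldNormedType.Exports.

Local Open Scope classical_set_scope.
Local Open Scope ring_scope.
Local Open Scope complex_scope.
Local Open Scope sesquilinear_scope.

Definition eitv (R : realType) (a b : \bar R) : set R :=
  [set x : R | (a < x%:E)%E /\ (x%:E < b)%E].

Section Matrices.
Context {R : realType} {n : nat}.
Implicit Types (a b : \bar R) (f : R -> R) (A B : 'M[R[i]]_n).

(* The order of [R[i]] is the partial one: [0 <= z] means that z is real and
   nonnegative. *)
Definition psdmx A : Prop :=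
  A \is hermsymmx /\
  forall v : 'cV[R[i]]_n, 0 <= (v ^t* *m A *m v) ord0 ord0.

(* On Hermitian matrices every eigenvalue is real, so [Re z] is z itself. *)
Definition hermitian_in a b A : Prop :=
  A \is hermsymmx /\
  forall z : R[i], eigenvalue A z -> eitv a b (complex.Re z).

(* Meant for A Hermitian, so that [spectral_diag A] is a row of reals and
   A = P^-1 *m diag_mx (spectral_diag A) *m P with P = spectralmx A unitary. *)
Definition funcalc f A : 'M[R[i]]_n :=
  invmx (spectralmx A)
  *m diag_mx (map_mx (fun z : R[i] => (f (complex.Re z))%:C) (spectral_diag A))
  *m spectralmx A.

End Matrices.

(* F^{[k]}(t_0, ..., t_k); only t 0, ..., t k are used. *)
Fixpoint divdiff {K : fieldType} {V : lmodType K} (F : K -> V) (k : nat)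
    (t : nat -> K) : V :=
  if k is k'.+1 then
    (t 0%N - t k)^-1 *:
      (divdiff F k' t - divdiff F k' (fun l => t l.+1))
  else F (t 0%N).

Definition mx_divdiff {R : realType} {n : nat} (f : R -> R)
    (A B : 'M[R[i]]_n) (k : nat) (t : nat -> R) : 'M[R[i]]_n :=
  divdiff (fun s : R[i] => funcalc f ((1 - s) *: A + s *: B)) k
    (fun l => (t l)%:C).

Definition matrix_tone {R : realType} (k n : nat) (a b : \bar R) (f : R -> R)
    : Prop :=
  forall A B : 'M[R[i]]_n,
    hermitian_in a b A -> hermitian_in a b B -> psdmx (B - A) ->
  forall t : nat -> R,
    t 0%N = 0 -> t k = 1 -> (forall l, (l < k)%N -> t l < t l.+1) ->
  psdmx (mx_divdiff f A B k t).

(* g is a continuous extension to (a, b)^{k+1} of the divided difference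
   f^{[k]}, the latter being given by the recursion at points with distinct
   coordinates. *)
Definition divdiff_extension {R : realType} (a b : \bar R) (f : R -> R)
    (k : nat) (g : 'rV[R]_k.+1 -> R) : Prop :=
  let D := [set y : 'rV[R]_k.+1 | forall l, eitv a b (y ord0 l)] in
  {within D, continuous g} /\
  forall y, D y -> injective (y ord0) ->
    g y = divdiff (f : R -> R^o) k (fun l => y ord0 (inord l)).

(* For D open. *)
Definition Cn_on {R : realType} (D : set R) (m : nat) (f : R -> R) : Prop :=
  (forall j x, (j < m)%N -> D x -> derivable (derive1n j f) x 1) /\
  (forall x, D x -> {for x, continuous (derive1n m f)}).

(* Iterated derivatives of f : D -> R as partial functions: a pair of a domain
   and of values, the latter meaningful on the domain only. The derivative of
   order m.+1 exists at x when the one of order m exists at x and its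
   difference quotients at x, taken along the points where it is defined,
   converge. The derivative of order m need not be defined on a whole
   neighborhood of x: for instance f' is undefined at the kinks of a convex
   function f, which may be dense, although f'' exists almost everywhere. *)
Fixpoint pderiv {R : realType} (D : set R) (f : R -> R) (m : nat)
    : set R * (R -> R) :=
  if m is m'.+1 then
    let E := (pderiv D f m').1 in
    let g := (pderiv D f m').2 in
    let q (x y : R) : R := (g y - g x) / (y - x) in
    ([set x | [/\ E x, limit_point E x & cvg (q x @ within E x^')]],
     fun x => lim (q x @ within E x^'))
  else (D, f).

(* Main.v *)
(* Restricting f^[k](A, B; .) to real pencils diag(x) + s c u u^T with c -> 0
   turns matrix k-tonicity into scalar inequalities: if p is a polynomial that
   approximates f well enough near the points x_i, then the Hankel form of the
   coefficients of p at one point, or its Loewner form at several points, is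
   nonnegative. When f is C^(2n+k-2), the Hankel form says that the derivatives
   f^(k), f^(k+2), ..., f^(2n+k-2) are nonnegative, hence that f is j-tone as a
   scalar function for j = k, k+2, ..., 2n+k-2; smoothness is obtained by
   replacing f with its Steklov averages, one order at a time. A scalar j-tone
   function with j >= 2 is C^(j-2) with convex derivative of order j-2, which
   gives (a) and (b), and (c) is the Loewner form. For (d), the derivative of
   order 2n+k-4 is convex, so its right derivative is monotone, hence
   differentiable almost everywhere by Lebesgue's theorem; at such points f has
   a Taylor expansion to order 2n+k-2 and the Hankel form applies. *)

(* Write X = diag(x). To leading order in c, the divided difference of order k in s of (X + s c u
   u^T)^m, taken against v, is c^k times the sum over a_0 + ... + a_k = m - k of (v^T X^(a_0) u)
   (u^T X^(a_1) u) ... (u^T X^(a_k) v). If the inner moments u^T X^a u tend to beta for a = 0 and to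
   0 for a > 0, only a_0 and a_k stay free, and beta^(k-1) times a convolution square of the moments
   mu_a = lim v^T X^a u remains. Two limits force this: nodes collapsing to 0 give the Hankel form,
   and u collapsing to a basis vector with eigenvalue 0 gives the Loewner form. In both, v may blow
   up, and the error between f and p has to be small against c^k / |v|^2; this dictates the order of
   contact required of p. As f need not have derivatives, it is never differentiated along the
   pencil but compared with p inside finite spectral sums. Averaging f shrinks the interval, so
   tonicity is restated for arbitrary sets and segments staying inside them. For k = 1, f may jump;
   its averages then converge to its right limits, whose continuity shows afterwards that f had no
   jumps. *)
Require Import Defs.
From HB Require Import structures.
From mathcomp Require Import all_boot all_order all_algebra.
From mathcomp Require Import perm complex.
From mathcomp Require Import all_classical all_reals all_analysis.
From mathcomp Require Import measurable_realfun.
From mathcomp Require Import ring lra zify.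

Set Implicit Arguments.
Unset Strict Implicit.
Unset Printing Implicit Defensive.

Import Order.TTheory GRing.Theory Num.Theory.
Import numFieldNormedType.Exports.

Local Open Scope classical_set_scope.
Local Open Scope ring_scope.


(** * Divided differences *)

Section DividedDifference.
Context {K : fieldType}.
Implicit Types (V W : lmodType K) (t : nat -> K).

Definition inj_upto (k : nat) (t : nat -> K) :=
  forall i j, (i <= k)%N -> (j <= k)%N -> t i = t j -> i = j.

(** The barycentric weight of Lagrange interpolation at the node [t i]; the factor j = i is replaced
    by 1. *)
Definition ddcoef (k : nat) (t : nat -> K) (i : nat) : K :=
  (\prod_(0 <= j < k.+1) (if j == i then 1 else t i - t j))^-1.

Lemma eq_divdiff V (F G : K -> V) k t t' :
  (forall i, (i <= k)%N -> t i = t' i) ->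
  (forall i, (i <= k)%N -> F (t i) = G (t i)) ->
  divdiff F k t = divdiff G k t'.
Proof.
elim: k t t' => [|k IH] t t' tt' FG /=; first by rewrite FG // tt'.
rewrite !tt' //; congr (_ *: (_ - _)).
  by apply: IH => i ik; [apply: tt'|apply: FG]; exact: leqW.
by apply: IH => i ik; [apply: tt'|apply: FG].
Qed.

Lemma divdiff_shift V (F : K -> V) c k t :
  divdiff (fun x => F (x + c)) k t = divdiff F k (fun i => t i + c).
Proof.
elim: k t => [//|k IH] t /=.
by rewrite !IH opprD addrACA subrr addr0.
Qed.

Lemma ddcoef_recl k t i :
  ddcoef k.+1 t i.+1 = (t i.+1 - t 0%N)^-1 * ddcoef k (fun l => t l.+1) i.
Proof.
by rewrite /ddcoef big_nat_recl // invfM.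
Qed.

Lemma ddcoef_recr k t i : (i <= k)%N ->
  ddcoef k.+1 t i = (t i - t k.+1)^-1 * ddcoef k t i.
Proof.
by move=> ik; rewrite /ddcoef big_nat_recr //= gtn_eqF // invfM mulrC.
Qed.

Lemma inj_upto_subr_neq0 k t i j : inj_upto k t ->
  (i <= k)%N -> (j <= k)%N -> i != j -> t i - t j != 0.
Proof.
by move=> tinj ik jk; rewrite subr_eq0; apply: contra_neq => /(tinj _ _ ik jk).
Qed.

Lemma inj_uptoW k t : inj_upto k.+1 t -> inj_upto k t.
Proof. by move=> tinj i j ik jk; apply: tinj; exact: leqW. Qed.

Lemma inj_uptoS k t : inj_upto k.+1 t -> inj_upto k (fun l => t l.+1).
Proof. by move=> tinj i j ik jk /(tinj i.+1 j.+1 ik jk)[]. Qed.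

Lemma divdiffE V (F : K -> V) k t : inj_upto k t ->
  divdiff F k t = \sum_(0 <= i < k.+1) ddcoef k t i *: F (t i).
Proof.
elim: k t => [|k IH] t tinj /=.
  by rewrite big_nat1 /ddcoef big_nat1 eqxx invr1 scale1r.
have tne i j := @inj_upto_subr_neq0 _ _ i j tinj.
have t0k : t 0%N - t k.+1 != 0 by apply: tne.
rewrite (IH _ (inj_uptoW tinj)) (IH _ (inj_uptoS tinj)).
apply: (scalerI t0k); rewrite scalerA divff // scale1r.
(* [H] and [G] pad the two sums to a common range by a term that vanishes, and their difference at i
   is (t_0 - t_(k+1)) times the weight of order k + 1. *)
pose G i := (t i - t 0%N) * ddcoef k.+1 t i.
pose H i := (t i - t k.+1) * ddcoef k.+1 t i.
have -> : \sum_(0 <= i < k.+1) ddcoef k t i *: F (t i) =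
    \sum_(0 <= i < k.+2) H i *: F (t i).
  rewrite [RHS]big_nat_recr //= /H subrr mul0r scale0r addr0.
  apply: eq_big_nat => i /andP[_ ik].
  by rewrite ddcoef_recr // mulrA divff ?mul1r // tne // ?ltn_eqF // leqW.
have -> : \sum_(0 <= i < k.+1) ddcoef k (fun l => t l.+1) i *: F (t i.+1) =
    \sum_(0 <= i < k.+2) G i *: F (t i).
  rewrite [RHS]big_nat_recl //= /G subrr mul0r scale0r add0r.
  apply: eq_big_nat => i /andP[_ ik].
  by rewrite ddcoef_recl // mulrA divff ?mul1r // tne.
rewrite -sumrB scaler_sumr; apply: eq_bigr => i _.
rewrite scalerA -scalerBl -mulrBl; congr (_ * _ *: _).
by rewrite opprD opprK addrACA subrr add0r addrC.
Qed.

(** The recursion is not visibly symmetric in the nodes, but the expanded sum is. *)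
Lemma divdiff_perm V (F : K -> V) k t t' (s : 'S_k.+1) : inj_upto k t ->
  (forall i : 'I_k.+1, t' i = t (s i)) ->
  divdiff F k t' = divdiff F k t.
Proof.
move=> tinj tt'.
have tinj' : inj_upto k t'.
  move=> i j ik jk; have := tt' (Ordinal (ik : (i < k.+1)%N)).
  have := tt' (Ordinal (jk : (j < k.+1)%N)) => /= -> ->.
  move=> /(@tinj (s _) (s _) (leq_ord _) (leq_ord _))/val_inj/perm_inj.
  by move=> /(congr1 val).
rewrite !divdiffE // !big_mkord [RHS](reindex_inj (@perm_inj _ s)) /=.
apply: eq_bigr => i _; rewrite tt' /ddcoef !big_mkord.
rewrite [in RHS](reindex_inj (@perm_inj _ s)) /=.
congr (_^-1 *: _); apply: eq_bigr => j _; rewrite !tt'.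
by rewrite !val_eqE (inj_eq perm_inj).
Qed.

(* A sequence sliding from the nodes of y to those of w. *)
Definition slide (k : nat) (y w : nat -> K) : nat -> K :=
  fun i => if (i <= k)%N then y i else w (i - k.+1)%N.

(** Moving the window of k + 1 nodes by one step drops [y j] and gains [w j], which is one instance
    of the recursion; the steps telescope. Variations of order k are thus controlled by order k +
    1. *)
Lemma divdiff_slide V (F : K -> V) k y w :
  (forall j, (j <= k)%N -> y j != w j) ->
  divdiff F k y - divdiff F k w =
  \sum_(0 <= j < k.+1)
     (y j - w j) *: divdiff F k.+1 (fun i => slide k y w (j + i)%N).
Proof.
move=> yw; pose T j := divdiff F k (fun i => slide k y w (j + i)%N).
have -> : divdiff F k y = T 0%N.
  by apply: eq_divdiff => // i ik; rewrite /slide add0n ik.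
have -> : divdiff F k w = T k.+1.
  by apply: eq_divdiff => // i ik; rewrite /slide leqNgt ltn_addr //= addKn.
rewrite -opprB -telescope_sumr // -sumrN; apply: eq_big_nat => j /andP[_ jk].
rewrite opprB /= {1 2}/slide addn0 -ltnS jk.
rewrite leqNgt addnS ltnS leq_addl /= subSS addnK.
rewrite scalerA divff ?scale1r ?subr_eq0 ?yw //.
by congr (_ - _); apply: eq_divdiff => // i _; rewrite addSnnS.
Qed.

Lemma inj_slide k y w j : inj_upto k y -> inj_upto k w ->
  (forall i l, (i <= k)%N -> (l <= k)%N -> y i != w l) -> (j <= k)%N ->
  inj_upto k.+1 (fun i => slide k y w (j + i)%N).
Proof.
move=> yinj winj yw jk i l ik lk; rewrite /slide.
case: leqP => ji; case: leqP => jl.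
- by move=> /(@yinj _ _ ji jl); lia.
- by move=> /eqP; rewrite (negbTE (yw _ _ _ _)) //; lia.
- by move=> /esym/eqP; rewrite (negbTE (yw _ _ _ _)) //; lia.
- move=> E; suff: (j + i - k.+1 = j + l - k.+1)%N by lia.
  by apply: winj E; lia.
Qed.

(* The Leibniz rule for a factor that is affine in the parameter. *)
Lemma divdiff_affineM (L : algType K) (A H : L) (F : K -> L) k t :
  inj_upto k.+1 t ->
  divdiff (fun x => (A + x *: H) * F x) k.+1 t =
  (A + t 0%N *: H) * divdiff F k.+1 t + H * divdiff F k (fun l => t l.+1).
Proof.
elim: k t => [|k IH] t tinj.
  rewrite /=.
  have t01 := inj_upto_subr_neq0 tinj (leq0n _) (leqnn _) isT.
  apply: (scalerI t01); rewrite [RHS]scalerDr scalerA divff // scale1r.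
  rewrite scalerAr scalerA divff // scale1r.
  rewrite mulrBr -addrA; congr (_ + _).
  by rewrite !mulrDl -!scalerAl scalerBl !opprD addrA subrK.
have t0k := inj_upto_subr_neq0 tinj (leq0n _) (leqnn _) isT.
have t1k := @inj_upto_subr_neq0 _ _ 1 k.+2 tinj isT (leqnn _) isT.
pose D G j u := divdiff (V := L) G j u.
rewrite -[LHS]/(_ *: (D _ k.+1 t - D _ k.+1 _)) /D.
rewrite (IH _ (inj_uptoW tinj)) (IH _ (inj_uptoS tinj)).
have : divdiff F k (fun l => t l.+1) - divdiff F k (fun l => t l.+2) =
   (t 1%N - t k.+2) *: divdiff F k.+1 (fun l => t l.+1).
  by rewrite /= scalerA divff // scale1r.
have -> : divdiff F k.+2 t = (t 0%N - t k.+2)^-1 *: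
    (divdiff F k.+1 t - divdiff F k.+1 (fun l => t l.+1)) by [].
move: (divdiff F k.+1 t) (divdiff F k.+1 (fun l => t l.+1)) => a b.
move: (divdiff F k _) (divdiff F k _) => c d /eqP; rewrite subr_eq => /eqP ->.
apply: (scalerI t0k).
rewrite [RHS]scalerDr scalerAr !scalerA divff // !scale1r.
rewrite mulrBr mulrDr !mulrDl -!scalerAl -!scalerAr !scalerBl !opprD !addrA.
rewrite subrK [LHS](ACl (1*2*6*4*(3*7)*(5*8)))/=.
by rewrite !subrr !addr0.
Qed.

End DividedDifference.

(** * Scalar k-tone functions *)

Section KTone.
Context {R : realType}.
Implicit Types (D : set R) (f g : R -> R) (t : nat -> R).

Definition dd (k : nat) f t : R := divdiff (f : R -> R^o) k t.

Definition ktone D (k : nat) f := forall t,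
  (forall i, (i <= k)%N -> D (t i)) ->
  (forall i, (i < k)%N -> t i < t i.+1) -> 0 <= dd k f t.

Lemma increasing_lt k t : (forall i, (i < k)%N -> t i < t i.+1) ->
  forall i j, (i < j)%N -> (j <= k)%N -> t i < t j.
Proof.
move=> tlt i; elim=> // j IH; rewrite ltnS leq_eqVlt => /orP[/eqP ->|ij] jk.
  exact: tlt.
by apply: lt_trans (tlt _ jk); apply: IH => //; exact: ltnW.
Qed.

Lemma increasing_inj k t : (forall i, (i < k)%N -> t i < t i.+1) ->
  inj_upto k t.
Proof.
move=> tlt i j ik jk tij; case: (ltngtP i j) => // ij.
  by have := increasing_lt tlt ij jk; rewrite tij ltxx.
by have := increasing_lt tlt ij ik; rewrite tij ltxx.
Qed.

Lemma ddE k f t : inj_upto k t ->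
  dd k f t = \sum_(0 <= i < k.+1) ddcoef k t i * f (t i).
Proof. exact: divdiffE. Qed.

Lemma ddS k f t : dd k.+1 f t =
  (t 0%N - t k.+1)^-1 * (dd k f t - dd k f (fun l => t l.+1)).
Proof. by []. Qed.

Lemma dd_sort k t : inj_upto k t -> exists s : {perm 'I_k.+1},
  forall i j : 'I_k.+1, (i < j)%N -> t (s i) < t (s j).
Proof.
move=> tinj; pose T := [tuple t i | i < k.+1].
have [s sE] := tuple_permP (permEl (perm_sort <=%R T)).
exists s => i j ij.
have tsE (l : 'I_k.+1) : t (s l) = nth 0 (sort <=%R T) l.
  by rewrite sE (nth_map l) ?size_enum_ord // nth_ord_enum tnth_mktuple.
rewrite !tsE; apply: (sorted_ltn_nth (leT := <%R)) ij.
- exact: lt_trans.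
- rewrite lt_sorted_uniq_le sort_le_sorted andbT sort_uniq map_inj_uniq.
    exact: enum_uniq.
  by move=> x y /(@tinj x y (leq_ord x) (leq_ord y)) /val_inj.
- by rewrite inE size_sort size_tuple.
- by rewrite inE size_sort size_tuple.
Qed.

(** Symmetry in the nodes allows them to be sorted first. *)
Lemma ktone_inj D k f t : ktone D k f -> inj_upto k t ->
  (forall i, (i <= k)%N -> D (t i)) -> 0 <= dd k f t.
Proof.
move=> ft tinj tD; have [s st] := dd_sort tinj.
pose t' i := t (s (inord i)).
rewrite -[dd _ _ _](@divdiff_perm _ _ _ _ _ t' s) //; last first.
  by move=> i; rewrite /t' inord_val.
apply: ft => [i ik|i ik]; first exact/tD/leq_ord.
by apply: st; rewrite !inordK // ltnS // ltnW.
Qed.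

Lemma dd_cst k t : inj_upto k.+1 t -> dd k.+1 (fun=> 1) t = 0.
Proof.
elim: k t => [|k IH] t tinj; first by rewrite ddS subrr mulr0.
by rewrite ddS !IH ?subrr ?mulr0 //; [exact: inj_uptoS|exact: inj_uptoW].
Qed.

Lemma prod_except k (s : R) i : (i <= k)%N ->
  \prod_(0 <= j < k.+1) (if j == i then 1 else s) = s ^+ k.
Proof.
move=> ik; rewrite (big_cat_nat (n := i)) // ?leqW //=.
rewrite (big_cat_nat (n := i.+1) (m := i)) //= big_nat1 eqxx mul1r.
rewrite [in X in X * _](eq_big_nat _ _ (F2 := fun=> s)); last first.
  by move=> j /andP[_ ji]; rewrite ltn_eqF.
rewrite [in X in _ * X](eq_big_nat _ _ (F2 := fun=> s)); last first.
  by move=> j /andP[ij _]; rewrite gtn_eqF.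
by rewrite !prodr_const_nat -exprD; congr (_ ^+ _); lia.
Qed.

Lemma ddcoef_affine k t (c s : R) i : (i <= k)%N ->
  ddcoef k (fun l => c + s * t l) i = s ^- k * ddcoef k t i.
Proof.
move=> ik; rewrite /ddcoef -invfM; congr (_^-1).
rewrite -(@prod_except k s i ik).
rewrite -big_split /=; apply: eq_bigr => j _.
case: eqP => _; first by rewrite mul1r.
by rewrite opprD addrACA subrr add0r mulrBr.
Qed.

Lemma is_derive_affine (c d x : R) :
  is_derive x 1 (fun s : R => c + s * d) d.
Proof.
have -> : (fun s : R => c + s * d) = cst c + d \*: id.
  by apply/funext => s; rewrite /= mulrC.
by apply: is_derive_eq; rewrite add0r -[RHS]mulr1.
Qed.

(* The derivative of
   s |-> s^(k+1) f^[k+1](t_0, t_0 + s (t_1 - t_0), ..., t_0 + s (t_(k+1) - t_0))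
   is s^k f'^[k](t_0 + s (t_1 - t_0), ..., t_0 + s (t_(k+1) - t_0)). *)
Lemma ktone_derive D k f : is_interval D ->
  (forall x, D x -> derivable f x 1) -> ktone D k (derive1 f) -> ktone D k.+1 f.
Proof.
move=> Ditv df f't t tD tlt.
have tinj := increasing_inj tlt.
pose p (s : R) l := t 0%N + s * (t l - t 0%N).
have pD (s : R) l : 0 <= s <= 1 -> (l <= k.+1)%N -> D (p s l).
  move=> /andP[s0 s1] lk; apply: (Ditv (t 0%N) (t l)); try exact: tD.
  have t0l : 0 <= t l - t 0%N.
    rewrite subr_ge0; case: l lk => // l lk.
    exact/ltW/(increasing_lt tlt).
  apply/andP; rewrite /p; split.
    by rewrite lerDl mulr_ge0.
  by rewrite -lerBrDl ler_piMl.
pose h (l : 'I_k.+2) (s : R) := ddcoef k.+1 t l *: (f (p s l) : R^o).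
pose G : R -> R := \sum_(l < k.+2) h l.
pose G' s := \sum_(l < k.+2) ddcoef k.+1 t l * (derive1 f (p s l) * (t l - t 0%N)).
have dG (s : R) : 0 <= s <= 1 -> is_derive s 1 G (G' s).
  move=> s01; apply: is_derive_sum => l.
  apply: is_deriveZ.
  apply: (@is_derive1_comp _ f (fun s => p s l)).
    rewrite derive1E; apply/derivableP/df/pD => //; exact: leq_ord.
  exact: is_derive_affine.
have G'ge0 (s : R) : 0 < s <= 1 -> 0 <= G' s.
  move=> /andP[s0 s1].
  (* The node t_0 does not move, so l = 0 drops out; in the other terms t_(i+1) - t_0 cancels one
     factor of the weight and leaves the weight of order k for t_1, ..., t_(k+1). *)
  rewrite /G' big_ord_recl /= subrr !mulr0 add0r.
  pose u l := t l.+1.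
  pose q l := (t 0%N - s * t 0%N) + s * u l.
  have qE l : q l = p s l.+1 by rewrite /q /p mulrBr -addrA [- _ + _]addrC.
  have qlt i : (i < k)%N -> q i < q i.+1.
    by move=> ik; rewrite /q ltrD2l ltr_pM2l // tlt.
  have := @f't q; rewrite ddE; last exact: increasing_inj.
  have qD i : (i <= k)%N -> D (q i).
    by move=> ik; rewrite qE; apply: pD => //; rewrite ltW.
  move=> /(_ qD qlt).
  rewrite -(pmulr_rge0 _ (exprn_gt0 k s0)) big_mkord mulr_sumr.
  congr (0 <= _); apply: eq_bigr => i _.
  rewrite (ddcoef_affine _ _ _ (leq_ord i)) qE.
  have sk0 : s ^+ k != 0 by rewrite expf_neq0 // gt_eqF.
  have ti0 : t i.+1 - t 0%N != 0.
    by apply: (inj_upto_subr_neq0 tinj); rewrite // leq_ord.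
  rewrite ddcoef_recl -[bump 0 i]/(i.+1).
  rewrite !mulrA divff // mul1r.
  by rewrite mulrAC [X in _ = X * _]mulrAC mulVf // mul1r.
have Gcont : {within `[0, 1], continuous G}.
  apply: derivable_within_continuous => x; rewrite in_itv /= => x01.
  exact: (@ex_derive _ _ _ _ _ _ _ (dG _ x01)).
(* At s = 0 all nodes coincide and G is f(t_0) times the sum of the weights, which is the divided
   difference of a constant, hence 0; at s = 1 it is the wanted value. *)
have [|c] := @MVT _ G G' 0 1 ltr01 _ Gcont.
  by move=> x; rewrite in_itv /= => /andP[x0 x1]; apply: dG; rewrite !ltW.
rewrite in_itv /= subr0 mulr1 => /andP[c0 c1].
have -> : G 0 = 0.
  rewrite /G fct_sumE /h /p.
  have := dd_cst tinj; rewrite ddE // big_mkord => sum0.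
  under eq_bigr do rewrite mul0r addr0.
  rewrite -scaler_suml (_ : \sum_(i < _) _ = 0) ?scale0r// -[RHS]sum0.
  by apply: eq_bigr => i _; rewrite mulr1.
have -> : G 1 = dd k.+1 f t.
  rewrite /G fct_sumE ddE // big_mkord /h /p; apply: eq_bigr => i _.
  by rewrite mul1r [t 0%N + _]addrC subrK.
rewrite subr0 => ->; apply: G'ge0; rewrite c0 ltW //.
Qed.
End KTone.

(** * Local boundedness of divided differences *)

Section Regularity.
Context {R : realType}.
Implicit Types (D : set R) (f g : R -> R) (t : nat -> R).

(** A substitute for local boundedness of the k-th derivative, meaningful for any function. *)
Definition ddbounded D (k : nat) f := forall c d, D c -> D d ->
  exists M : R, forall t, inj_upto k t ->
    (forall i, (i <= k)%N -> c <= t i <= d) -> `|dd k f t| <= M.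

(** Reference nodes beyond d share no value with nodes in [c, d], as sliding requires. *)
Lemma nodes_right D k (d : R) : open D -> is_interval D -> D d ->
  exists2 e, D e & exists2 w : nat -> R, inj_upto k w &
    forall i, (i <= k)%N -> d < w i <= e.
Proof.
move=> Do Di Dd; have /nbhs_ballP[/= e e0 De] := Do _ Dd.
have k0 : 0 < k.+1%:R :> R by rewrite ltr0n.
have q0 : e / 2 / k.+1%:R != 0 by rewrite gt_eqF // !divr_gt0.
exists (d + e / 2).
  by apply: De; rewrite /ball /= opprD addNKr normrN gtr0_norm; lra.
exists (fun i => d + e / 2 / k.+1%:R * i.+1%:R).
  by move=> i j _ _ /addrI/(mulfI q0)/eqP; rewrite eqr_nat => /eqP [].
have q1 : 0 < e / 2 / k.+1%:R by rewrite !divr_gt0.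
move=> i ik; rewrite ltrDl lerD2l mulr_gt0 ?ltr0n //=.
by rewrite mulrAC ler_pdivrMr // ler_wpM2l ?ler_nat // ltW // divr_gt0.
Qed.

Lemma nodes_left D k (c : R) : open D -> is_interval D -> D c ->
  exists2 e, D e & exists2 w : nat -> R, inj_upto k w &
    forall i, (i <= k)%N -> e <= w i < c.
Proof.
move=> Do Di Dd; have /nbhs_ballP[/= e e0 De] := Do _ Dd.
have k0 : 0 < k.+1%:R :> R by rewrite ltr0n.
have q0 : e / 2 / k.+1%:R != 0 by rewrite gt_eqF // !divr_gt0.
exists (c - e / 2).
  by apply: De; rewrite /ball /= opprB addrC subrK gtr0_norm; lra.
exists (fun i => c - e / 2 / k.+1%:R * i.+1%:R).
  by move=> i j _ _ /addrI/oppr_inj/(mulfI q0)/eqP; rewrite eqr_nat => /eqP [].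
have q1 : 0 < e / 2 / k.+1%:R by rewrite !divr_gt0.
move=> i ik; rewrite ltrBlDr ltrDl lerD2l lerN2 mulr_gt0 ?ltr0n //= andbT.
by rewrite mulrAC ler_pdivrMr // ler_wpM2l ?ler_nat // ltW // divr_gt0.
Qed.

Lemma dd_slide k f (y w : nat -> R) :
  (forall j, (j <= k)%N -> y j != w j) ->
  dd k f y - dd k f w =
  \sum_(0 <= j < k.+1) (y j - w j) * dd k.+1 f (fun i => slide k y w (j + i)%N).
Proof. exact: divdiff_slide. Qed.

Lemma slide_prop (P : R -> Prop) k (y w : nat -> R) j i :
  (forall i, (i <= k)%N -> P (y i)) -> (forall i, (i <= k)%N -> P (w i)) ->
  (j <= k)%N -> (i <= k.+1)%N -> P (slide k y w (j + i)%N).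
Proof.
move=> Py Pw jk ik; rewrite /slide; case: leqP => ji; first exact: Py.
by apply: Pw; lia.
Qed.

(** Each step of the slide from [t] to [w] is a nonnegative divided difference of order k + 1 times
    t_j - w_j <= 0. *)
Lemma ktone_le D k f t w : ktone D k.+1 f ->
  inj_upto k t -> inj_upto k w ->
  (forall i, (i <= k)%N -> D (t i)) -> (forall i, (i <= k)%N -> D (w i)) ->
  (forall i, (i <= k)%N -> t i <= w i) ->
  (forall i l, (i <= k)%N -> (l <= k)%N -> t i != w l) ->
  dd k f t <= dd k f w.
Proof.
move=> fD tinj winj tD wD tw tNw.
rewrite -subr_le0 dd_slide; last by move=> j jk; exact: tNw.
rewrite big_nat; apply: sumr_le0 => j /andP[_ jk].
rewrite mulr_le0_ge0 // ?subr_le0 ?tw //.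
apply: (ktone_inj fD); first exact: inj_slide.
by move=> i ik; apply: slide_prop.
Qed.

(** Nodes in [c, d] slide up to fixed nodes beyond d and down to fixed nodes before c, so
    monotonicity traps the divided difference between two constants. *)
Lemma ktone_bounded D k f : open D -> is_interval D ->
  ktone D k.+1 f -> ddbounded D k f.
Proof.
move=> Do Di fD c d Dc Dd.
have [e De [w winj dw]] := nodes_right k Do Di Dd.
have [e' De' [w' winj' cw']] := nodes_left k Do Di Dc.
exists (`|dd k f w| + `|dd k f w'|) => t tinj tcd.
have tD i : (i <= k)%N -> D (t i) by move=> ik; exact: (Di c d) (tcd _ ik).
have tw : dd k f t <= dd k f w.
  apply: (ktone_le fD) => //.
  - move=> i ik; have /andP[dwi wie] := dw i ik.
    by apply: (Di d e) => //; rewrite ltW.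
  - move=> i ik; have /andP[dwi _] := dw i ik; have /andP[_ td] := tcd i ik.
    exact: ltW (le_lt_trans td dwi).
  - move=> i l ik lk; have /andP[dwi _] := dw l lk; have /andP[_ td] := tcd i ik.
    by rewrite lt_eqF // (le_lt_trans td dwi).
have wt : dd k f w' <= dd k f t.
  apply: (ktone_le fD) => //.
  - move=> i ik; have /andP[dwi wie] := cw' i ik.
    by apply: (Di e' c) => //; rewrite dwi ltW.
  - move=> i ik; have /andP[_ dwi] := cw' i ik; have /andP[td _] := tcd i ik.
    exact: ltW (lt_le_trans dwi td).
  - move=> i l ik lk; have /andP[_ dwi] := cw' i ik; have /andP[td _] := tcd l lk.
    by rewrite lt_eqF // (lt_le_trans dwi td).
rewrite ler_norml; apply/andP; split.
  rewrite lerNl; apply: le_trans (_ : - dd k f w' <= _); first by rewrite lerN2.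
  by rewrite (le_trans (ler_norm _)) // normrN lerDr.
by rewrite (le_trans tw) // (le_trans (ler_norm _)) // lerDl.
Qed.

(** Sliding to fixed nodes beyond d changes the value by at most k + 1 terms, each bounded by (e -
    c) M. *)
Lemma ddboundedW D k f : open D -> is_interval D ->
  ddbounded D k.+1 f -> ddbounded D k f.
Proof.
move=> Do Di fD c d Dc Dd.
have [e De [w winj dw]] := nodes_right k Do Di Dd.
have [M fM] := fD _ _ Dc De.
exists (`|dd k f w| + \sum_(0 <= j < k.+1) (e - c) * M) => t tinj tcd.
have -> : dd k f t = dd k f w + (dd k f t - dd k f w) by rewrite addrC subrK.
have tltw i l : (i <= k)%N -> (l <= k)%N -> t i < w l.
  move=> ik lk; have /andP[dwi _] := dw l lk; have /andP[_ td] := tcd i ik.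
  exact: le_lt_trans td dwi.
rewrite (le_trans (ler_normD _ _)) // lerD2l dd_slide; last first.
  by move=> j jk; rewrite lt_eqF // tltw.
rewrite (le_trans (ler_norm_sum _ _ _)) // big_nat [leRHS]big_nat.
apply: ler_sum => j /andP[_ jk]; rewrite normrM ler_pM //.
  have /andP[ct td] := tcd _ jk; have /andP[dwj we] := dw _ jk.
  by rewrite ler_norml; lra.
apply: fM.
  by apply: inj_slide => // i l ik lk; rewrite lt_eqF // tltw.
move=> i ik; apply: (@slide_prop (fun x => c <= x <= e)) => // l lk.
  have /andP[ct td] := tcd _ lk; have /andP[dwj we] := dw _ lk.
  by rewrite ct (le_trans td) // (le_trans (ltW dwj)).
have /andP[ct td] := tcd _ lk; have /andP[dwj we] := dw _ lk.
by rewrite we andbT (le_trans ct) // (le_trans td) // ltW.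
Qed.

Lemma ddbounded_le D k l f : open D -> is_interval D -> (l <= k)%N ->
  ddbounded D k f -> ddbounded D l f.
Proof.
move=> Do Di /subnKC <-; elim: (k - l)%N => [|j IH]; first by rewrite addn0.
by rewrite addnS => /(ddboundedW Do Di).
Qed.

End Regularity.

(** * Derivatives and convexity of scalar k-tone functions *)

Section Smoothness.
Context {R : realType}.
Implicit Types (D : set R) (f g : R -> R) (t : nat -> R).

Lemma open_segment D (x : R) : open D -> D x ->
  exists2 e, 0 < e & forall y, x - e <= y <= x + e -> D y.
Proof.
move=> Do Dx; have /nbhs_ballP[/= e e0 De] := Do _ Dx.
exists (e / 2); first by rewrite divr_gt0.
move=> y yx; apply: De; rewrite /ball /= ltr_norml.
by lra.
Qed.

(** The difference quotient [q] at x satisfies q h - q h' = f[x + h, x, x + h'] (h - h'), so it is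
    Lipschitz in h and therefore Cauchy as h tends to 0. *)
Lemma ddbounded2_derivable D f x : open D -> ddbounded D 2 f -> D x ->
  derivable f x 1.
Proof.
move=> Do fD Dx; have [e e0 De] := open_segment Do Dx.
have [||M fM] := fD (x - e) (x + e); try (apply: De; lra).
pose q (h : R) := h^-1 * (f (h + x) - f x).
have M0 : 0 <= M.
  apply: le_trans (normr_ge0 _) (fM (fun i => x + e * i%:R / 2) _ _).
    move=> i j _ _ /addrI/divIf => /(_ _)/mulfI => /(_ _ _)/eqP.
    by rewrite eqr_nat => /(_ _ _)/eqP; apply; rewrite ?pnatr_eq0 ?gt_eqF.
  move=> i i2; have : 0 <= i%:R :> R by [].
  have : i%:R <= 2 :> R by rewrite ler_nat.
  by nra.
have qM h h' : h != 0 -> h' != 0 -> `|h| <= e -> `|h'| <= e ->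
    `|q h - q h'| <= M * `|h - h'|.
  move=> h0 h'0; move=> /ler_normlP[he1 he2] /ler_normlP[h'e1 h'e2].
  have [->|hh'] := eqVneq h h'; first by rewrite !subrr !normr0 mulr0.
  pose t i := nth 0 [:: h + x; x; h' + x] i.
  have -> : q h - q h' = dd 2 f t * (h - h').
    rewrite !ddS /dd /t /= /q.
    have : h - h' != 0 by rewrite subr_eq0.
    move=> hh'0; field; apply/and4P; split=> //.
    - by rewrite opprD addrCA subrr addr0 oppr_eq0.
    - by rewrite addrK.
    - by rewrite opprD addrACA subrr addr0.
  rewrite normrM ler_wpM2r //; apply: fM.
    move=> [|[|[|//]]] [|[|[|//]]] //= _ _; rewrite /t /= => E; exfalso;
      by first [move/eqP: h0; apply; lra | move/eqP: h'0; apply; lra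
               | move/eqP: hh'; apply; lra].
  by move=> [|[|[|//]]] _; rewrite /t /=; lra.
apply/cauchy_cvgP/cauchy_exP => eps eps0 /=.
pose r := Num.min e (eps / (2 * (M + 1))).
have M1 : 0 < 2 * (M + 1) by lra.
have r0 : 0 < r by rewrite lt_min e0 divr_gt0.
have re : r <= e by rewrite ge_min lexx.
have rM : M * (r * 2) < eps.
  have : r <= eps / (2 * (M + 1)) by rewrite ge_min lexx orbT.
  by rewrite ler_pdivlMr //; nra.
exists (q r); near=> h.
have h0 : h != 0 by near: h; exact: nbhs_dnbhs_neq.
have hr : `|h| < r by near: h; exact: dnbhs0_lt.
rewrite /ball /=.
have -> : h^-1 *: (f (h *: 1 + x) - f x) = q h by rewrite /q [h *: 1]mulr1.
apply: le_lt_trans (qM r h _ _ _ _) _ => //.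
- by rewrite gt_eqF.
- by rewrite gtr0_norm.
- exact/ltW/(lt_le_trans hr).
- apply: le_lt_trans rM; rewrite ler_wpM2l //.
  by rewrite (le_trans (ler_normB _ _)) // gtr0_norm // mulr_natr mulr2n lerD2l ltW.
Unshelve. all: by end_near. Qed.

Lemma near_upto {T : Type} (F : set_system T) {FF : Filter F} k
  (P : nat -> T -> Prop) :
  (forall i, (i <= k)%N -> \forall x \near F, P i x) ->
  \forall x \near F, forall i, (i <= k)%N -> P i x.
Proof.
elim: k => [|k IH] kP.
  by have := kP _ (leqnn 0); apply: filterS => x Px [].
have := kP _ (leqnn k.+1).
have := IH (fun i ik => kP i (leqW ik)).
apply: filterS2 => x Px Pk i; rewrite leq_eqVlt => /orP[/eqP ->//|].
exact: Px.
Qed.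

Lemma near_shift_neq (x y c : R) : c != 0 ->
  \forall h \near 0^'+, x + h * c != y.
Proof.
move=> c0; have [->|xy] := eqVneq x y.
  near=> h; rewrite -subr_eq0 addrAC subrr add0r mulf_neq0 //.
have xyc0 : 0 < `|(y - x) / c|.
  by rewrite normr_gt0 mulf_neq0 ?invr_eq0 // subr_eq0 eq_sym.
near=> h; have h0 : 0 < h by near: h; exact: nbhs_right_gt.
have : h < `|(y - x) / c| by near: h; exact: nbhs_right_lt.
apply: contraTN => /eqP <-.
by rewrite addrAC subrr add0r mulfK // gtr0_norm // -leNgt.
Unshelve. all: by end_near. Qed.

Lemma near_shift_open D (x c : R) : open D -> D x ->
  \forall h \near 0^'+, D (x + h * c).
Proof.
move=> Do Dx.
have : (fun h : R => x + h * c) h @[h --> 0^'+] --> x.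
  apply: cvg_at_right_filter; rewrite -[X in _ --> X]addr0 -[X in _ --> _ + X](mul0r c).
  by apply: cvgD; [exact: cvg_cst|apply: cvgMr_tmp; exact: cvg_id].
by apply; apply: open_nbhs_nbhs; split.
Unshelve. all: by end_near. Qed.

(** The divided difference of (f(y + h) - f(y)) / h is 1 / h times a slide from t to t + h; its
    steps have weight h > 0 and nonnegative divided differences of order k + 1. For small h > 0 the
    two families of nodes are disjoint. *)
Lemma ktone_derive_ktone D k f : open D ->
  (forall x, D x -> derivable f x 1) -> ktone D k.+1 f -> ktone D k (derive1 f).
Proof.
move=> Do df fD t tD tlt; have tinj := increasing_inj tlt.
rewrite ddE // big_mkord.
pose G (h : R) := \sum_(i < k.+1)
  ddcoef k t i * (h^-1 *: (f (h *: 1 + t i) - f (t i))).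
have cvgG : G h @[h --> 0^'+] -->
    \sum_(i < k.+1) ddcoef k t i * derive1 f (t i).
  apply: (cvg_big add_continuous) => i _.
  apply: cvgMl_tmp; apply: cvg_dnbhs_at_right; rewrite derive1E.
  exact: (df _ (tD _ (leq_ord i))).
apply: cvgr_to_ge cvgG _; near=> h.
have h0 : 0 < h by near: h; exact: nbhs_right_gt.
pose th i := t i + h.
have thinj : inj_upto k th by move=> i j ik jk /addIr; exact: tinj.
have thD i : (i <= k)%N -> D (th i).
  rewrite /th -[h]mulr1; move: i; near: h; apply: near_upto => i ik.
  exact: near_shift_open (tD _ ik).
have tht i l : (i <= k)%N -> (l <= k)%N -> th i != t l.
  rewrite /th -[h]mulr1; move=> ik; move: l; move: i ik; near: h.
  apply: near_upto => i ik; apply: near_upto => l lk.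
  exact: near_shift_neq.
have -> : G h = h^-1 * (dd k f th - dd k f t).
  rewrite !ddE // !big_mkord -sumrB mulr_sumr; apply: eq_bigr => i _.
  have -> : ddcoef k th i = ddcoef k t i.
    rewrite /ddcoef; congr (_^-1); apply: eq_bigr => j _.
    by case: eqP => // _; rewrite opprD addrACA subrr addr0.
  rewrite -mulrBr [RHS]mulrCA /th [t i + h]addrC.
  by congr (_ * (_ * (f (_ + _) - _))); exact: mulr1.
apply: mulr_ge0; first by rewrite invr_ge0 ltW.
rewrite dd_slide; last by move=> j jk; exact: tht.
rewrite big_nat; apply: sumr_ge0 => j /andP[_ jk].
rewrite /th addrAC subrr add0r; apply: mulr_ge0; first exact: ltW.
apply: (ktone_inj fD); first exact: inj_slide.
by move=> i ik; apply: slide_prop.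
Unshelve. all: by end_near. Qed.

Lemma ktone_derivable D k f x : open D -> is_interval D ->
  ktone D k.+3 f -> D x -> derivable f x 1.
Proof.
move=> Do Di fD; apply: (ddbounded2_derivable Do).
by apply: (@ddbounded_le _ _ k.+2) => //; exact: ktone_bounded.
Qed.

Lemma ktone_derive1n D j i f : open D -> is_interval D ->
  ktone D (i + j.+2) f -> ktone D j.+2 (derive1n i f).
Proof.
move=> Do Di; elim: i j => [//|i IH] j; rewrite addSnnS => /IH fi.
by apply: ktone_derive_ktone => // x; exact: ktone_derivable fi.
Qed.

(** A bound on divided differences of order 1 is a local Lipschitz condition. *)
Lemma ktone_continuous D k f x : open D -> is_interval D ->
  ktone D k.+2 f -> D x -> {for x, continuous f}.
Proof.
move=> Do Di fD Dx; have [e e0 De] := open_segment Do Dx.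
have [||M fM] := (@ddbounded_le _ _ k.+1 1 _ Do Di isT (ktone_bounded Do Di fD))
  (x - e) (x + e); try (apply: De; lra).
have M0 : 0 <= M.
  apply: le_trans (normr_ge0 _) (fM (fun i => x + e * i%:R) _ _).
    move=> i j _ _ /addrI/mulfI => /(_ (lt0r_neq0 e0))/eqP.
    by rewrite eqr_nat => /eqP.
  move=> i i2; have : 0 <= i%:R :> R by [].
  have : i%:R <= 1%:R :> R by rewrite ler_nat.
  by nra.
apply/cvgrPdist_lt => eps eps0.
have r0 : 0 < Num.min e (eps / (M + 1)).
  by rewrite lt_min e0 divr_gt0 // ltr_wpDl.
have near_r := @nbhsx_ballx _ _ x _ r0.
near=> y; have yx : `|x - y| < Num.min e (eps / (M + 1)) by near: y.
have [<-|neq] := eqVneq x y; first by rewrite subrr normr0.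
have -> : f x - f y = dd 1 f (nth 0 [:: x; y]) * (x - y).
  by rewrite ddS /dd /= mulrAC mulVf ?mul1r // subr_eq0.
move: yx; rewrite lt_min => /andP[/ltr_normlP[xy1 xy2] yx].
apply: le_lt_trans (_ : M * `|x - y| < _).
  rewrite normrM ler_wpM2r //; apply: fM.
    move=> [|[|//]] [|[|//]] //= _ _ xyE;
    by rewrite xyE eqxx in neq.
  by move=> [|[|//]] _ /=; lra.
apply: le_lt_trans (_ : (M + 1) * `|x - y| < _); last first.
  by rewrite mulrC -ltr_pdivlMr // ltr_wpDl.
by rewrite ler_wpM2r // lerDl.
Unshelve. all: by end_near. Qed.

Lemma ktone_Cn D k f : open D -> is_interval D ->
  ktone D k.+2 f -> Cn_on D k f.
Proof.
move=> Do Di fD.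
have fi i j : (i + j.+2 = k.+2)%N -> ktone D j.+2 (derive1n i f).
  by move=> ij; apply: ktone_derive1n; rewrite ?ij.
split=> [j x jk Dx|x Dx]; last first.
  by apply: ktone_continuous Do Di (fi k 0 _) Dx; lia.
by apply: ktone_derivable Do Di (fi j (k - j.+1).+1 _) Dx; lia.
Qed.

(** The convexity gap at z = s x + (1 - s) y is s (1 - s) (x - y)^2 times the divided difference at
    x, z, y. *)
Lemma ktone2_le D f (s x y : R) : is_interval D -> ktone D 2 f ->
  0 <= s -> s <= 1 -> D x -> D y ->
  f (s * x + (1 - s) * y) <= s * f x + (1 - s) * f y.
Proof.
move=> Di fD s0 s1 Dx Dy.
have [->|sn0] := eqVneq s 0; first by rewrite !mul0r !add0r subr0 !mul1r.
have [->|sn1] := eqVneq s 1; first by rewrite subrr !mul0r !addr0 !mul1r.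
have [->|xy] := eqVneq x y; first by rewrite -!mulrDl addrC subrK !mul1r.
have xy0 : x - y != 0 by rewrite subr_eq0.
have s1n0 : 1 - s != 0 by rewrite subr_eq0 eq_sym.
pose z := s * x + (1 - s) * y; pose t := nth 0 [:: x; z; y].
have xz : x - z = (1 - s) * (x - y) by rewrite /z; ring.
have zy : z - y = s * (x - y) by rewrite /z; ring.
have xz0 : x != z by rewrite -subr_eq0 xz mulf_neq0.
have zy0 : z != y by rewrite -subr_eq0 zy mulf_neq0.
have tinj : inj_upto 2 t.
  by move=> [|[|[|//]]] [|[|[|//]]] //= _ _ /eqP;
    rewrite ?(negbTE xz0) ?(negbTE zy0) ?(negbTE xy) // eq_sym
            ?(negbTE xz0) ?(negbTE zy0) ?(negbTE xy).
have Dz : D z.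
  have [lexy|/ltW leyx] := leP x y.
    have h1 : 0 <= s * (y - x) by rewrite mulr_ge0 ?subr_ge0.
    have h2 : 0 <= (1 - s) * (y - x) by rewrite mulr_ge0 ?subr_ge0.
    by apply: (Di x y) => //; rewrite /z; lra.
  have h1 : 0 <= s * (x - y) by rewrite mulr_ge0 ?subr_ge0.
  have h2 : 0 <= (1 - s) * (x - y) by rewrite mulr_ge0 ?subr_ge0.
  by apply: (Di y x) => //; rewrite /z; lra.
have /(ktone_inj fD tinj) dd0 : forall i, (i <= 2)%N -> D (t i).
  by move=> [|[|[|//]]].
rewrite -subr_ge0.
have -> : s * f x + (1 - s) * f y - f z = dd 2 f t * (s * (1 - s) * (x - y) ^+ 2).
  rewrite !ddS /dd /t /= xz zy; field.
  by rewrite xy0 sn0 s1n0.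
by rewrite mulr_ge0 // mulr_ge0 ?sqr_ge0 // mulr_ge0 // subr_ge0.
Qed.

Lemma ktone2_convex D f : is_interval D -> ktone D 2 f ->
  convex_function D (f : R^o -> R^o).
Proof.
move=> Di fD p x y /set_mem Dx /set_mem Dy; rewrite convRE /unstable.onem.
have -> : conv p x y = (p%:num * (x : R) + (1 - p%:num) * (y : R) : R).
  exact: (convRE (x : R^o) (y : R^o) p).
exact: (ktone2_le Di fD (ge0 p) (le1 p)).
Qed.

End Smoothness.

(** * Functional calculus *)

Section FunctionalCalculus.
Context {R : realType}.
Local Open Scope complex_scope.
Local Open Scope sesquilinear_scope.
Implicit Types (f : R -> R).

Lemma poly_interpolation (F : fieldType) (s : seq F) (g : F -> F) :
  exists p : {poly F}, forall x, x \in s -> p.[x] = g x.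
Proof.
elim: s => [|x s [p ps]]; first by exists 0.
have [xs|xs] := boolP (x \in s).
  by exists p => y; rewrite inE => /orP[/eqP ->|]; exact: ps.
pose q := \prod_(y <- s) ('X - y%:P).
have qx : q.[x] != 0 by rewrite -rootE root_prod_XsubC.
exists (p + ((g x - p.[x]) / q.[x])%:P * q) => y.
rewrite inE hornerD hornerM hornerC => /orP[/eqP ->|ys].
  by rewrite divfK // addrC subrK.
suff /rootP -> : root q y by rewrite mulr0 addr0 ps.
by rewrite root_prod_XsubC.
Qed.

Variable n : nat.
Implicit Types (A B X U : 'M[R[i]]_n.+1) (v : 'cV[R[i]]_n.+1).

Lemma horner_mx_similar U (d : 'rV[R[i]]_n.+1) (p : {poly R[i]}) :
  U \in unitmx ->
  horner_mx (invmx U *m diag_mx d *m U) p =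
  invmx U *m diag_mx (map_mx (horner p) d) *m U.
Proof. by move=> Uu; rewrite mxpoly.horner_mx_uconjC // horner_mx_diag. Qed.

Lemma normal_spectralE A : A \is normalmx ->
  A = invmx (spectralmx A) *m diag_mx (spectral_diag A) *m spectralmx A.
Proof. by move=> /orthomx_spectralP. Qed.

Lemma funcalc_horner A f (p : {poly R[i]}) : A \is normalmx ->
  (forall i, p.[spectral_diag A ord0 i] =
     (f (complex.Re (spectral_diag A ord0 i)))%:C) ->
  funcalc f A = horner_mx A p.
Proof.
move=> An pf; have := horner_mx_similar (spectral_diag A) p (spectral_unit A).
rewrite -(normal_spectralE An) => ->.
rewrite (_ : map_mx (horner p) _ =
  map_mx (fun z => (f (complex.Re z))%:C) (spectral_diag A)); first by [].
by apply/rowP => i; rewrite !mxE pf.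
Qed.

(** One polynomial interpolating f on both diagonals turns both sides into [horner_mx A p]; hence
    [funcalc] does not depend on the chosen diagonalization. *)
Lemma funcalc_similar A U (d : 'rV[R[i]]_n.+1) f : A \is normalmx ->
  U \in unitmx -> A = invmx U *m diag_mx d *m U ->
  funcalc f A =
  invmx U *m diag_mx (map_mx (fun z => (f (complex.Re z))%:C) d) *m U.
Proof.
move=> An Uu AU.
have [p pf] := poly_interpolation
  ([seq spectral_diag A ord0 i | i <- enum 'I_n.+1] ++
   [seq d ord0 i | i <- enum 'I_n.+1]) (fun z => (f (complex.Re z))%:C).
have := horner_mx_similar d p Uu; rewrite -AU => pA.
have sp i : p.[spectral_diag A ord0 i] =
    (f (complex.Re (spectral_diag A ord0 i)))%:C.
  by apply: pf; rewrite mem_cat map_f // mem_enum.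
have dE : map_mx (horner p) d = map_mx (fun z => (f (complex.Re z))%:C) d.
  apply/rowP => i; rewrite !mxE; apply: pf.
  by rewrite mem_cat (map_f _ (mem_enum _ i)) orbT.
by rewrite dE in pA; exact: etrans (funcalc_horner An sp) pA.
Qed.

Lemma spectral_diag_eigenvalue A i : A \is normalmx ->
  eigenvalue A (spectral_diag A ord0 i).
Proof.
move=> An; apply/eigenvalueP; exists (row i (spectralmx A)).
  rewrite [X in _ *m X](normal_spectralE An) -row_mul !mulmxA.
  rewrite (mulmxV (spectral_unit A)) mul1mx.
  by apply/rowP => j; rewrite mul_diag_mx !mxE.
apply/eqP => r0; have := spectral_unit A; rewrite -row_free_unit.
move=> /row_freeP[B] /(congr1 (row i)); rewrite row_mul r0 mul0mx.
by move=> /rowP/(_ i); rewrite !mxE eqxx => /esym/eqP; rewrite oner_eq0.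
Qed.

Lemma spectral_diag_real A i : A \is hermsymmx ->
  spectral_diag A ord0 i = (complex.Re (spectral_diag A ord0 i))%:C.
Proof.
move=> /hermitian_spectral_diag_real/mxOverP/(_ ord0 i).
by move=> /RRe_real ->.
Qed.

Lemma hermitian_eigenvalue_real A (z : R[i]) : A \is hermsymmx ->
  eigenvalue A z -> z = (complex.Re z)%:C.
Proof.
move=> Ah /eigenvalueP[v vA v0]; have An := hermitian_normalmx Ah.
pose u := v *m invmx (spectralmx A).
have uv : u *m spectralmx A = v by rewrite /u mulmxKV ?spectral_unit.
have uD : u *m diag_mx (spectral_diag A) = z *: u.
  rewrite /u scalemxAl -vA [X in _ = v *m X *m _](normal_spectralE An) !mulmxA.
  by rewrite mulmxK ?spectral_unit.
have /rV0Pn[j uj] : u != 0.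
  by apply: contra_neq v0 => u0; rewrite -uv u0 mul0mx.
have /rowP/(_ j) := uD; move: (u) uj => y yj.
rewrite mul_mx_diag !mxE mulrC => /(mulIf yj) <-.
exact: spectral_diag_real.
Qed.

(* The spectral measure of X at v. *)
Lemma funcalc_quad X v : X \is hermsymmx ->
  exists c l : 'I_n.+1 -> R,
  [/\ forall i, 0 <= c i,
      forall i, eigenvalue X (l i)%:C,
      (v^t* *m v) ord0 ord0 = (\sum_i c i)%:C &
      forall f, (v^t* *m funcalc f X *m v) ord0 ord0 =
                (\sum_i c i * f (l i))%:C].
Proof.
move=> Xh; have Xn := hermitian_normalmx Xh.
pose P := spectralmx X; pose w := P *m v.
pose c i := complex.Re (w i ord0) ^+ 2 + complex.Im (w i ord0) ^+ 2.
have cE i : (c i)%:C = (w i ord0)^* * w i ord0.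
  by rewrite /c add_Re2_Im2 normCK mulrC.
have vP : v^t* *m invmx P = w^t*.
  by rewrite invmx_unitary ?spectral_unitarymx // /w trmx_mul map_mxM.
have quad (d : 'rV[R]_n.+1) :
    (w^t* *m diag_mx (map_mx (real_complex R) d) *m w) ord0 ord0 =
    (\sum_i c i * d ord0 i)%:C.
  rewrite mxE rmorph_sum; apply: eq_bigr => i _.
  rewrite rmorphM /= cE mulrAC; congr (_ * _).
  by move: (w) => u; rewrite mul_mx_diag !mxE.
exists c, (fun i => complex.Re (spectral_diag X ord0 i)); split.
- by move=> i; rewrite addr_ge0 ?sqr_ge0.
- by move=> i; rewrite -spectral_diag_real //; exact: spectral_diag_eigenvalue.
- have := quad (const_mx 1); rewrite (_ : diag_mx _ = 1%:M); last first.
    by apply/matrixP => i j; rewrite !mxE rmorph1.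
  rewrite mulmx1 => wE.
  have -> : v^t* *m v = w^t* *m w.
    by rewrite -vP /w mulmxA mulmxKV ?spectral_unit.
  by rewrite wE; congr (_%:C); apply: eq_bigr => i _; rewrite mxE mulr1.
move=> f; have := quad (\row_i f (complex.Re (spectral_diag X ord0 i))).
rewrite -vP /funcalc -/P /w !mulmxA => vE.
rewrite (_ : map_mx _ _ = map_mx (real_complex R)
   (\row_i f (complex.Re (spectral_diag X ord0 i)))); last first.
  by apply/rowP => i; rewrite !mxE.
by rewrite vE; congr (_%:C); apply: eq_bigr => i _; rewrite mxE.
Qed.

Lemma funcalc_poly X (p : {poly R}) : X \is hermsymmx ->
  funcalc (horner p) X = horner_mx X (map_poly (real_complex R) p).
Proof.
move=> Xh; apply: funcalc_horner; first exact: hermitian_normalmx.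
by move=> i; rewrite {1}spectral_diag_real // horner_map.
Qed.

Lemma funcalc_shift X f (s : R) : X \is hermsymmx ->
  X + s%:C%:M \is hermsymmx ->
  funcalc f (X + s%:C%:M) = funcalc (fun y => f (y + s)) X.
Proof.
move=> Xh Xsh; have Xn := hermitian_normalmx Xh.
have E : X + s%:C%:M = invmx (spectralmx X) *m
    diag_mx (spectral_diag X + const_mx s%:C) *m spectralmx X.
  rewrite raddfD /= mulmxDr mulmxDl -normal_spectralE //; congr (_ + _).
  rewrite diag_const_mx -mulmxA -scalar_mxC mulmxA.
  by rewrite (mulVmx (spectral_unit X)) mul1mx.
rewrite (funcalc_similar f (hermitian_normalmx Xsh) (spectral_unit X) E).
have dE : map_mx (fun z => (f (complex.Re z))%:C)
      (spectral_diag X + const_mx s%:C) =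
    map_mx (fun z => (f (complex.Re z + s))%:C) (spectral_diag X).
  by apply/rowP => i; rewrite !mxE; case: (spectral_diag X ord0 i).
by rewrite /funcalc -dE.
Qed.

End FunctionalCalculus.

(** * Matrix k-tone functions and their signed spectral measures *)

Section MatrixTone.
Context {R : realType}.
Local Open Scope complex_scope.
Local Open Scope sesquilinear_scope.
Implicit Types (D : set R) (f : R -> R) (t : nat -> R).

Definition herm_on n D (A : 'M[R[i]]_n) : Prop :=
  A \is hermsymmx /\ forall z, eigenvalue A z -> D (complex.Re z).

Definition quad n (v : 'cV[R[i]]_n) (M : 'M[R[i]]_n) : R[i] :=
  (v^t* *m M *m v) ord0 ord0.

(* The part of matrix k-tonicity that the argument uses, with the spectra
   controlled along the whole segment. *)
Definition wtone (k n : nat) D f : Prop :=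
  forall A B : 'M[R[i]]_n,
  (forall s : R, 0 <= s <= 1 -> herm_on D ((1 - s%:C) *: A + s%:C *: B)) ->
  psdmx (B - A) ->
  forall t, t 0%N = 0 -> t k = 1 -> (forall l, (l < k)%N -> t l < t l.+1) ->
  forall v, 0 <= quad v (mx_divdiff f A B k t).

Lemma herm_on_endpoints n D (A B : 'M[R[i]]_n) :
  (forall s : R, 0 <= s <= 1 -> herm_on D ((1 - s%:C) *: A + s%:C *: B)) ->
  herm_on D A /\ herm_on D B.
Proof.
move=> ABD; split.
  have := ABD 0; rewrite lexx ler01 => /(_ isT).
  by rewrite rmorph0 subr0 scale1r scale0r addr0.
have := ABD 1; rewrite lexx ler01 => /(_ isT).
by rewrite rmorph1 subrr scale1r scale0r add0r.
Qed.

Lemma matrix_tone_wtone k n a b f :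
  matrix_tone k n a b f -> wtone k n (eitv a b) f.
Proof.
move=> ft A B /herm_on_endpoints[Ah Bh] AB t t0 t1 tlt.
by have [] := ft A B Ah Bh AB t t0 t1 tlt.
Qed.

Lemma wtone_sub k n D D' f : D' `<=` D -> wtone k n D f -> wtone k n D' f.
Proof.
move=> DD' ft A B ABD; apply: ft => s s01.
by split; [exact: (ABD s s01).1|move=> z /(ABD s s01).2; exact: DD'].
Qed.

Lemma hermsymmxP n (A : 'M[R[i]]_n) : A \is hermsymmx <-> A = A^t*.
Proof.
by split=> [/is_hermitianmxP|H]; [|apply/is_hermitianmxP]; rewrite expr0 scale1r.
Qed.

Lemma hermsymmxD n (A B : 'M[R[i]]_n) :
  A \is hermsymmx -> B \is hermsymmx -> A + B \is hermsymmx.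
Proof.
move=> /hermsymmxP Ah /hermsymmxP Bh; apply/hermsymmxP.
by rewrite linearD /= map_mxD -Ah -Bh.
Qed.

Lemma hermsymmxZ n (A : 'M[R[i]]_n) (s : R) :
  A \is hermsymmx -> s%:C *: A \is hermsymmx.
Proof.
move=> /hermsymmxP Ah; apply/hermsymmxP.
by rewrite linearZ /= map_mxZ -Ah; congr (_ *: _); rewrite [RHS]conjc_real.
Qed.

Lemma hermsymmx_real n (A : 'M[R]_n) : A^T = A ->
  map_mx (real_complex R) A \is hermsymmx.
Proof.
move=> As; apply/hermsymmxP; apply/matrixP => i j.
by rewrite -{1}As !mxE [RHS]conjc_real.
Qed.

Lemma hermsymmx_conv n (A B : 'M[R[i]]_n) (s : R) :
  A \is hermsymmx -> B \is hermsymmx ->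
  (1 - s%:C) *: A + s%:C *: B \is hermsymmx.
Proof.
move=> Ah Bh; apply: hermsymmxD; last exact: hermsymmxZ.
by rewrite -[1]/(1%:C) -rmorphB; exact: hermsymmxZ.
Qed.

Lemma quadD n (v : 'cV[R[i]]_n) M N : quad v (M + N) = quad v M + quad v N.
Proof. by rewrite /quad mulmxDr mulmxDl mxE. Qed.

Lemma quadZ n (v : 'cV[R[i]]_n) a M : quad v (a *: M) = a * quad v M.
Proof. by rewrite /quad -scalemxAr -scalemxAl mxE. Qed.

Lemma quad_sum n (v : 'cV[R[i]]_n) (I : Type) (r : seq I) (F : I -> 'M[R[i]]_n) :
  quad v (\sum_(i <- r) F i) = \sum_(i <- r) quad v (F i).
Proof.
elim/big_rec2: _ => [|i x M _ <-]; last by rewrite quadD.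
by rewrite /quad mulmx0 mul0mx mxE.
Qed.

Lemma ddcoef_real k t i :
  ddcoef k (fun l => (t l)%:C) i = (ddcoef k t i)%:C :> R[i].
Proof.
rewrite /ddcoef fmorphV rmorph_prod; congr (_^-1); apply: eq_bigr => j _.
by case: eqP => _; rewrite ?rmorph1 ?rmorphB.
Qed.

Lemma mx_divdiffE n f (A B : 'M[R[i]]_n) k t : inj_upto k t ->
  mx_divdiff f A B k t = \sum_(0 <= l < k.+1) (ddcoef k t l)%:C *:
    funcalc f ((1 - (t l)%:C) *: A + (t l)%:C *: B).
Proof.
move=> tinj; rewrite /mx_divdiff divdiffE.
  by apply: eq_bigr => l _; rewrite ddcoef_real.
by move=> i j ik jk /complexI; exact: tinj.
Qed.

(* The quadratic form of the divided difference, as a signed measure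
   independent of f. *)
Lemma mx_divdiff_quad n (A B : 'M[R[i]]_n.+1) k t v :
  A \is hermsymmx -> B \is hermsymmx -> inj_upto k t ->
  exists c l : nat -> 'I_n.+1 -> R,
  (forall m, [/\ forall i, 0 <= c m i,
      forall i, eigenvalue ((1 - (t m)%:C) *: A + (t m)%:C *: B) (l m i)%:C &
      (v^t* *m v) ord0 ord0 = (\sum_i c m i)%:C]) /\
  forall f, quad v (mx_divdiff f A B k t) =
    (\sum_(0 <= m < k.+1) ddcoef k t m * \sum_i c m i * f (l m i))%:C.
Proof.
move=> Ah Bh tinj.
have /choice[cl clP] : forall m, exists cl : ('I_n.+1 -> R) * ('I_n.+1 -> R),
    [/\ forall i, 0 <= cl.1 i,
      forall i, eigenvalue ((1 - (t m)%:C) *: A + (t m)%:C *: B) (cl.2 i)%:C,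
      (v^t* *m v) ord0 ord0 = (\sum_i cl.1 i)%:C &
      forall f, quad v (funcalc f ((1 - (t m)%:C) *: A + (t m)%:C *: B)) =
                (\sum_i cl.1 i * f (cl.2 i))%:C].
  move=> m; have [c [l [c0 ev vv fE]]] := funcalc_quad v (hermsymmx_conv (t m) Ah Bh).
  by exists (c, l).
exists (fun m => (cl m).1), (fun m => (cl m).2); split=> [m|f].
  by have [] := clP m.
rewrite mx_divdiffE // quad_sum rmorph_sum; apply: eq_bigr => m _.
by rewrite quadZ rmorphM /=; congr (_ * _); have [_ _ _ ->] := clP m.
Qed.

Lemma eigenvalue_shift n (A : 'M[R[i]]_n) (s z : R[i]) :
  eigenvalue (A + s%:M) z -> eigenvalue A (z - s).
Proof.
move=> /eigenvalueP[v vA v0]; apply/eigenvalueP; exists v => //.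
by rewrite scalerBl -vA mulmxDr mul_mx_scalar addrK.
Qed.

(** Adding a scalar matrix to [A] and [B] changes neither [B - A] nor the eigenvectors. This moves
    the point under study to 0, where the approximating polynomials are centred. *)
Lemma wtone_shift k n D f (s : R) : (0 < k)%N -> wtone k n.+1 D f ->
  wtone k n.+1 [set y | D (y + s)] (fun y => f (y + s)).
Proof.
move=> k0 ft A B ABD AB t t0 t1 tlt v.
have [[Ah _] [Bh _]] := herm_on_endpoints ABD.
have tinj := increasing_inj tlt.
have sh : (s%:C%:M : 'M[R[i]]_n.+1) \is hermsymmx.
  by apply/hermsymmxP; rewrite tr_scalar_mx map_scalar_mx; congr (_%:M);
     rewrite [RHS]conjc_real.
have convE (r : R) :
    (1 - r%:C) *: (A + s%:C%:M) + r%:C *: (B + s%:C%:M) =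
    ((1 - r%:C) *: A + r%:C *: B) + s%:C%:M.
  by rewrite !scalerDr addrACA -scalerDl subrK scale1r.
have ABE : (B + s%:C%:M) - (A + s%:C%:M) = B - A.
  by rewrite opprD addrACA subrr addr0.
have E : mx_divdiff f (A + s%:C%:M) (B + s%:C%:M) k t =
    mx_divdiff (fun y => f (y + s)) A B k t.
  rewrite (mx_divdiffE _ _ _ tinj) (mx_divdiffE _ _ _ tinj).
  apply: eq_bigr => l _; congr (_ *: _).
  have Xh := hermsymmx_conv (t l) Ah Bh.
  by rewrite -(funcalc_shift f Xh (hermsymmxD Xh sh)) convE.
rewrite -E; apply: (ft _ _ _ _ t t0 t1 tlt v); last by rewrite ABE.
move=> r r01; rewrite convE; split; first exact: hermsymmxD (ABD r r01).1 sh.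
by move=> z /eigenvalue_shift/(ABD r r01).2; case: z => x y /=; rewrite subrK.
Qed.

End MatrixTone.

(** * Rank one pencils *)

Section Pencil.
Context {R : realType} {n : nat}.
Local Open Scope complex_scope.
Local Open Scope sesquilinear_scope.
Implicit Types (D : set R) (f : R -> R) (t : nat -> R).
Implicit Types (x : 'rV[R]_n.+1) (u v : 'cV[R]_n.+1).

(** Gershgorin's argument: read the eigenvector equation at the index where the eigenvector is
    largest. *)
Lemma eigenvalue_diag_perturb x (E : 'M[R]_n.+1) (z : R) : E^T = E ->
  eigenvalue (diag_mx x + E) z ->
  exists i, `|z - x ord0 i| <= \sum_j `|E i j|.
Proof.
move=> ET /eigenvalueP[w wE w0].
pose j := [arg max_(j > ord0) `|w ord0 j|]%O.
have jmax i : `|w ord0 i| <= `|w ord0 j|.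
  by rewrite /j; case: arg_maxP => //= l _; apply.
exists j.
have wj0 : 0 < `|w ord0 j|.
  have /rV0Pn[i wi] := w0; apply: lt_le_trans (jmax i).
  by rewrite normr_gt0.
have wjE : (z - x ord0 j) * w ord0 j = \sum_i w ord0 i * E i j.
  have /rowP/(_ j) := wE; rewrite mulmxDr mul_mx_diag !mxE => H.
  by rewrite mulrBl -H [x ord0 j * _]mulrC addrAC subrr add0r.
rewrite -(ler_pM2r wj0) -normrM wjE (le_trans (ler_norm_sum _ _ _)) //.
rewrite mulr_suml; apply: ler_sum => i _.
by rewrite normrM mulrC -{1}ET mxE ler_wpM2l.
Qed.

Definition pencil x u (c s : R) : 'M[R]_n.+1 :=
  diag_mx x + (s * c) *: (u *m u^T).

Lemma pencil_sym x u c s : (pencil x u c s)^T = pencil x u c s.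
Proof. by rewrite linearD linearZ /= tr_diag_mx trmx_mul trmxK. Qed.

Lemma pencil_conv x u c s :
  (1 - s%:C) *: map_mx (real_complex R) (pencil x u c 0) +
    s%:C *: map_mx (real_complex R) (pencil x u c 1) =
  map_mx (real_complex R) (pencil x u c s).
Proof.
rewrite -[1 in X in X + _]/(1%:C) -rmorphB -!map_mxZ -map_mxD; congr map_mx.
rewrite /pencil mul0r scale0r addr0 mul1r scalerDr addrA -scalerDl subrK.
by rewrite scale1r scalerA.
Qed.

Lemma pencil_eigenvalue x u (c s e z : R) : 0 <= c -> 0 <= s <= 1 ->
  (forall i, c * \sum_j `|u i ord0 * u j ord0| <= e) ->
  eigenvalue (pencil x u c s) z -> exists i, `|z - x ord0 i| <= e.
Proof.
move=> c0 /andP[s0 s1] ce /eigenvalue_diag_perturb[|i zx].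
  by rewrite linearZ /= trmx_mul trmxK.
exists i; apply: le_trans zx (le_trans _ (ce i)).
rewrite mulr_sumr; apply: ler_sum => j _.
rewrite !mxE big_ord1 !mxE normrM ler_wpM2r //.
by rewrite ger0_norm ?mulr_ge0 // ler_piMl.
Qed.

(** One admissible choice of parameters; the limits computed below do not depend on it. *)
Definition unit_nodes (k l : nat) : R := l%:R / k%:R.

Lemma unit_nodes_lt k l : (0 < k)%N -> unit_nodes k l < unit_nodes k l.+1.
Proof. by move=> k0; rewrite ltr_pM2r ?invr_gt0 ?ltr0n // ltr_nat. Qed.

Lemma unit_nodes_inj k : (0 < k)%N -> inj_upto k (unit_nodes k).
Proof. by move=> k0; apply: increasing_inj => i _; exact: unit_nodes_lt. Qed.

Lemma unit_nodes_itv k l : (0 < k)%N -> (l <= k)%N -> 0 <= unit_nodes k l <= 1.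
Proof.
move=> k0 lk; rewrite /unit_nodes divr_ge0 //=.
by rewrite ler_pdivrMr ?ltr0n // mul1r ler_nat.
Qed.

(** The factor by which a uniform error in f can grow in the divided difference. *)
Definition unit_nodes_norm k : R :=
  \sum_(0 <= m < k.+1) `|ddcoef k (unit_nodes k) m|.

Lemma quad_real v (M : 'M[R]_n.+1) :
  quad (map_mx (real_complex R) v) (map_mx (real_complex R) M) =
  ((v^T *m M *m v) ord0 ord0)%:C.
Proof.
have -> : ((v^T *m M *m v) ord0 ord0)%:C =
    map_mx (real_complex R) (v^T *m M *m v) ord0 ord0.
  by rewrite [RHS]mxE.
rewrite !map_mxM /quad.
suff -> : (map_mx (real_complex R) v)^t* = map_mx (real_complex R) v^T by [].
by apply/matrixP => i j; rewrite !mxE [LHS]conjc_real.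
Qed.

(** Only the values of f at eigenvalues of the pencil matter, and these lie within e of the x_i.
    Replacing f by p there costs at most d times the spectral mass |v|^2 at each parameter. *)
Lemma tone_pencil k D f x u (c e d : R) (p : {poly R}) v : (0 < k)%N ->
  wtone k n.+1 D f -> 0 <= c ->
  (forall i, c * \sum_j `|u i ord0 * u j ord0| <= e) ->
  (forall i y, `|y - x ord0 i| <= e -> D y /\ `|f y - p.[y]| <= d) ->
  0 <= (v^T *m divdiff (fun s => horner_mx (pencil x u c s) p) k
          (unit_nodes k) *m v) ord0 ord0 +
       unit_nodes_norm k * d * \sum_i v i ord0 ^+ 2.
Proof.
move=> k0 ft c0 ce xe.
pose A s := map_mx (real_complex R) (pencil x u c s).
have Ah s : A s \is hermsymmx by apply: hermsymmx_real; exact: pencil_sym.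
have AD (s : R) : 0 <= s <= 1 -> herm_on D (A s).
  move=> s01; split; first exact: Ah.
  move=> z ev; have zE := hermitian_eigenvalue_real (Ah s) ev.
  move: ev; rewrite {1}zE eigenvalue_map => ev.
  by have [i /xe[]] := pencil_eigenvalue c0 s01 ce ev.
have AB : psdmx (A 1 - A 0).
  split; first by apply: hermsymmxD => //; rewrite -scaleN1r -[-1]/(-(1%:C));
     rewrite -rmorphN; exact: hermsymmxZ.
  move=> w; rewrite -/(quad _ _) /A -map_mxB.
  have -> : pencil x u c 1 - pencil x u c 0 = c *: (u *m u^T).
    by rewrite /pencil mul0r scale0r addr0 mul1r addrAC subrr add0r.
  rewrite map_mxZ quadZ mulr_ge0 ?ler0c //.
  pose y := map_mx (real_complex R) u^T *m w.
  have -> : quad w (map_mx (real_complex R) (u *m u^T)) = `|y ord0 ord0| ^+ 2.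
    rewrite /quad map_mxM !mulmxA -mulmxA -/y mxE big_ord1 normCK [RHS]mulrC.
    congr (_ * _).
    transitivity ((y^t*) ord0 ord0).
      2: by rewrite [LHS]mxE; congr (Num.conj _); rewrite [LHS]mxE.
    rewrite /y trmx_mul map_mxM.
    suff -> : (map_mx (real_complex R) u^T)^t* = map_mx (real_complex R) u by [].
    by apply/matrixP => i j; rewrite !mxE [LHS]conjc_real.
  by rewrite exprn_ge0.
pose t := unit_nodes k.
have t0 : t 0%N = 0 by rewrite /t /unit_nodes mul0r.
have tk : t k = 1 by rewrite /t /unit_nodes divff // pnatr_eq0 -lt0n.
have tlt l : (l < k)%N -> t l < t l.+1 by move=> _; exact: unit_nodes_lt.
have tinj : inj_upto k t := unit_nodes_inj k0.
pose w := map_mx (real_complex R) v.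
have ABD (s : R) : 0 <= s <= 1 ->
    herm_on D ((1 - s%:C) *: A 0 + s%:C *: A 1).
  by move=> s01; rewrite pencil_conv; exact: AD.
have := ft _ _ ABD AB t t0 tk tlt w.
(* The masses [cc] and the eigenvalues [l] do not depend on the function, so f and p can be compared
   term by term. *)
have [cc [l [clP quadE]]] := mx_divdiff_quad w (Ah 0) (Ah 1) tinj.
rewrite quadE ler0c => fge0.
have pE : (\sum_(0 <= m < k.+1) ddcoef k t m * \sum_i cc m i * p.[l m i])%:C =
   ((v^T *m divdiff (fun s => horner_mx (pencil x u c s) p) k t *m v)
     ord0 ord0)%:C.
  rewrite -quadE (mx_divdiffE _ _ _ tinj) quad_sum (divdiffE _ tinj) -quad_real.
  rewrite map_mx_sum quad_sum.
  apply: eq_bigr => m _.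
  rewrite map_mxZ !quadZ map_horner_mx pencil_conv.
  by rewrite (funcalc_poly p (Ah (t m))).
rewrite -(complexI pE) -lerBlDl sub0r.
have : \sum_(0 <= m < k.+1) ddcoef k t m * \sum_i cc m i * f (l m i) -
   \sum_(0 <= m < k.+1) ddcoef k t m * \sum_i cc m i * p.[l m i] <=
   unit_nodes_norm k * d * \sum_i v i ord0 ^+ 2; last by lra.
rewrite -sumrB -mulrA mulr_suml big_nat [leRHS]big_nat.
apply: ler_sum => m /andP[_ mk]; rewrite -mulrBr -sumrB.
rewrite (le_trans (ler_norm _)) // normrM ler_wpM2l //.
rewrite (le_trans (ler_norm_sum _ _ _)) //.
have [cc0 ev vv] := clP m.
have -> : \sum_i v i ord0 ^+ 2 = \sum_i cc m i.
  apply: complexI; rewrite -vv mxE rmorph_sum; apply: eq_bigr => i _.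
  by rewrite !mxE [X in X * _]conjc_real -expr2 rmorphXn.
rewrite mulr_sumr; apply: ler_sum => i _.
rewrite -mulrBr normrM ger0_norm // mulrC ler_wpM2r //.
have := ev i; rewrite pencil_conv eigenvalue_map.
move=> /(pencil_eigenvalue c0 (unit_nodes_itv k0 mk) ce) ev'.
by have [i' /xe[]] := ev'.
Qed.

End Pencil.

(** * Moments of divided differences of powers of a pencil *)

Section Moments.
Context {R : realType} {n : nat}.
Implicit Types (D : set R) (f : R -> R) (t : nat -> R).
Implicit Types (x : 'rV[R]_n.+1) (u v y z : 'cV[R]_n.+1) (M P Q : 'M[R]_n.+1).

Definition bil y z M : R := (y^T *m M *m z) ord0 ord0.

Lemma bilD y z M P : bil y z (M + P) = bil y z M + bil y z P.
Proof. by rewrite /bil mulmxDr mulmxDl mxE. Qed.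

Lemma bilZ y z a M : bil y z (a *: M) = a * bil y z M.
Proof. by rewrite /bil -scalemxAr -scalemxAl mxE. Qed.

Lemma bil0 y z : bil y z 0 = 0.
Proof. by rewrite /bil mulmx0 mul0mx mxE. Qed.

Lemma bil_sum y z (I : Type) (r : seq I) (F : I -> 'M[R]_n.+1) :
  bil y z (\sum_(i <- r) F i) = \sum_(i <- r) bil y z (F i).
Proof.
by elim/big_rec2: _ => [|i s M _ <-]; [exact: bil0|rewrite bilD].
Qed.

(** A rank one factor cuts a word in X and u u^T into a product of two moments. *)
Lemma bil_rank1 y z u P Q :
  bil y z (P * (u *m u^T * Q)) = bil y u P * bil u z Q.
Proof.
rewrite /bil.
have -> : y^T *m (P * (u *m u^T * Q)) *m z = (y^T *m P *m u) *m (u^T *m Q *m z).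
  by rewrite -!mulmxE !mulmxA.
by rewrite mxE big_ord1.
Qed.

Lemma bil_diagX y z x a :
  bil y z (diag_mx x ^+ a) = \sum_i y i ord0 * z i ord0 * x ord0 i ^+ a.
Proof.
have -> : diag_mx x ^+ a = diag_mx (\row_i x ord0 i ^+ a).
  elim: a => [|a IH].
    by apply/matrixP => i j; rewrite expr0 !mxE expr0.
  rewrite exprS IH -mulmxE mulmx_diag; congr diag_mx.
  by apply/rowP => i; rewrite !mxE exprS.
by rewrite /bil mxE; apply: eq_bigr => i _; rewrite mul_mx_diag !mxE mulrAC.
Qed.

Definition ddpow x u c (k m : nat) t : 'M[R]_n.+1 :=
  divdiff (fun s => pencil x u c s ^+ m) k t.

Lemma ddpow0 x u c k t : ddpow x u c k 0 t = (k == 0)%:R.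
Proof.
elim: k t => [//|k IH] t; rewrite /ddpow /= -![divdiff _ _ _]/(ddpow x u c k 0 _).
by rewrite !IH subrr scaler0.
Qed.

Lemma ddpowS x u c k m t : inj_upto k t ->
  ddpow x u c k m.+1 t =
  (diag_mx x + (t 0%N * c) *: (u *m u^T)) * ddpow x u c k m t +
  (if k is k'.+1 then (c *: (u *m u^T)) * ddpow x u c k' m (fun l => t l.+1)
   else 0).
Proof.
have XE s : pencil x u c s = diag_mx x + s *: (c *: (u *m u^T)).
  by rewrite /pencil scalerA.
case: k => [|k] tinj.
  by rewrite addr0 /ddpow /= exprS /pencil.
have := divdiff_affineM (diag_mx x) (c *: (u *m u^T))
  (fun s => pencil x u c s ^+ m) tinj.
rewrite scalerA /ddpow => <-.
by apply: eq_divdiff => // i ik; rewrite exprS XE.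
Qed.

(** Leibniz rule for the leftmost factor of the power: it contributes X, and the exponent a grows,
    or it contributes c u u^T, and the form splits, with or without lowering the order k. *)
Lemma bil_ddpowS y z x u c k m t a : inj_upto k t ->
  bil y z (diag_mx x ^+ a * ddpow x u c k m.+1 t) =
  bil y z (diag_mx x ^+ a.+1 * ddpow x u c k m t) +
  t 0%N * c * (bil y u (diag_mx x ^+ a) * bil u z (ddpow x u c k m t)) +
  (if k is k'.+1 then c * (bil y u (diag_mx x ^+ a) *
     bil u z (ddpow x u c k' m (fun l => t l.+1))) else 0).
Proof.
move=> tinj; rewrite ddpowS // mulrDr bilD mulrDl mulrDr bilD.
rewrite mulrA -exprSr -scalerAl -scalerAr bilZ bil_rank1.
congr (_ + _ + _); case: k tinj => [|k] tinj; first by rewrite mulr0 bil0.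
by rewrite -scalerAl -scalerAr bilZ bil_rank1.
Qed.

Context {T : Type} {F : set_system T} {FF : ProperFilter F}.
Variables (x : T -> 'rV[R]_n.+1) (u v : T -> 'cV[R]_n.+1) (c : T -> R).
Variables (mu : nat -> R) (beta : R).
Hypothesis c_pos : \forall N \near F, 0 < c N.
Hypothesis c_cvg : c N @[N --> F] --> 0.
Hypothesis vu_cvg : forall a,
  bil (v N) (u N) (diag_mx (x N) ^+ a) @[N --> F] --> mu a.
Hypothesis uv_cvg : forall a,
  bil (u N) (v N) (diag_mx (x N) ^+ a) @[N --> F] --> mu a.
Hypothesis uu_cvg : forall a,
  bil (u N) (u N) (diag_mx (x N) ^+ a) @[N --> F] --> beta * (a == 0)%:R.

(** The limit in [ddpow_u_cvg]. As long as an insertion of u u^T is still to come, a letter X before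
    it would create a factor u^T X^a u with a > 0, which tends to 0. *)
Fixpoint ulim (k a m : nat) : R :=
  if k is k'.+1 then
    if m is m'.+1 then beta * (a == 0)%:R * ulim k' 0 m' else 0
  else mu (a + m).

Fixpoint vlim (k a m : nat) : R :=
  if m is m'.+1 then vlim k a.+1 m' + mu a * ulim k 0 m' else 0.

Lemma ulimE k m : ulim k 0 m = if (k <= m)%N then beta ^+ k * mu (m - k) else 0.
Proof.
elim: k m => [|k IH] [|m] //=; rewrite ?expr0 ?mul1r ?subn0 // ltnS IH.
by rewrite mulr1; case: ifP => _; rewrite ?mulr0 // mulrA -exprS.
Qed.

Lemma vlimE k m : vlim k 0 m =
  \sum_(0 <= i < m) mu i * ulim k 0 (m.-1 - i).
Proof.
suff H a : vlim k a m = \sum_(0 <= i < m) mu (a + i) * ulim k 0 (m.-1 - i).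
  by rewrite H; apply: eq_bigr => i _; rewrite add0n.
elim: m a => [|m IH] a /=; first by rewrite big_geq.
rewrite IH big_nat_recl // addn0 subn0 addrC; congr (_ + _).
apply: eq_big_nat => i /andP[_ im].
by rewrite addSnnS; congr (_ * ulim _ _ _); lia.
Qed.

Lemma ddpow_u_cvg k a m t : inj_upto k t ->
  c N ^- k * bil (u N) (v N) (diag_mx (x N) ^+ a * ddpow (x N) (u N) (c N) k m t)
    @[N --> F] --> ulim k a m.
Proof.
elim: m k a t => [|m IH] k a t tinj.
  case: k tinj => [|k] tinj /=.
    rewrite addn0 (_ : (fun N => _) =
      (fun N => bil (u N) (v N) (diag_mx (x N) ^+ a))); first exact: uv_cvg.
    by apply/funext => N; rewrite ddpow0 expr0 invr1 mul1r mulr1.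
  rewrite (_ : (fun N => _) = fun=> 0); first exact: cvg_cst.
  by apply/funext => N; rewrite ddpow0 mulr0 bil0 mulr0.
pose X N := diag_mx (x N).
pose Z k' a' t' N := c N ^- k' *
  bil (u N) (v N) (X N ^+ a' * ddpow (x N) (u N) (c N) k' m t').
pose rest N := if k is k'.+1 then
   bil (u N) (u N) (X N ^+ a) * Z k' 0%N (fun l => t l.+1) N else 0.
(* The middle term keeps the order k and so has a spare factor c, which makes it vanish in the
   limit. *)
have main : Z k a.+1 t N +
    t 0%N * (c N * (bil (u N) (u N) (X N ^+ a) * Z k 0%N t N)) + rest N
   @[N --> F] --> ulim k a.+1 m + t 0%N * (0 * (beta * (a == 0)%:R * ulim k 0 m)) +
     (if k is k'.+1 then beta * (a == 0)%:R * ulim k' 0 m else 0).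
  apply: cvgD.
    apply: cvgD; first exact: IH.
    apply: cvgMl_tmp; apply: cvgM; first exact: c_cvg.
    by apply: cvgM; [exact: uu_cvg|exact: IH].
  rewrite /rest; case: (k) tinj => [|k'] tinj; first exact: cvg_cst.
  by apply: cvgM; [exact: uu_cvg|apply: IH; exact: inj_uptoS].
have -> : ulim k a m.+1 = ulim k a.+1 m +
    t 0%N * (0 * (beta * (a == 0)%:R * ulim k 0 m)) +
     (if k is k'.+1 then beta * (a == 0)%:R * ulim k' 0 m else 0).
  rewrite mul0r mulr0 addr0; case: (k) => [|k'] /=; first by rewrite addr0 addSnnS.
  by case: (m) => [|m'] //=; rewrite ?mulr0 ?mul0r add0r.
apply: cvg_trans main; apply: near_eq_cvg; near=> N.
have c0 : 0 < c N by near: N.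
rewrite /rest /Z bil_ddpowS // expr0 !mul1r !mulrDr.
congr (_ + _ + _); first by ring.
case: (k) => [|k'] /=; first by rewrite mulr0.
rewrite mul1r exprS /X; have := expf_neq0 k' (lt0r_neq0 c0); move: (c N ^+ k') => q q0.
by field; rewrite q0 gt_eqF.
Unshelve. all: by end_near. Qed.

Lemma ddpow_v_cvg k a m t : inj_upto k.+1 t ->
  c N ^- k.+1 *
    bil (v N) (v N) (diag_mx (x N) ^+ a * ddpow (x N) (u N) (c N) k.+1 m t)
    @[N --> F] --> vlim k a m.
Proof.
elim: m a => [|m IH] a tinj.
  rewrite (_ : (fun N => _) = fun=> 0); first exact: cvg_cst.
  by apply/funext => N; rewrite ddpow0 mulr0 bil0 mulr0.
pose X N := diag_mx (x N).
pose Z k' t' N := c N ^- k' *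
  bil (u N) (v N) (X N ^+ 0 * ddpow (x N) (u N) (c N) k' m t').
have main : c N ^- k.+1 *
    bil (v N) (v N) (X N ^+ a.+1 * ddpow (x N) (u N) (c N) k.+1 m t) +
    t 0%N * (c N * (bil (v N) (u N) (X N ^+ a) * Z k.+1 t N)) +
    bil (v N) (u N) (X N ^+ a) * Z k (fun l => t l.+1) N
   @[N --> F] --> vlim k a.+1 m + t 0%N * (0 * (mu a * ulim k.+1 0 m)) +
     mu a * ulim k 0 m.
  apply: cvgD; last first.
    apply: cvgM; first exact: vu_cvg.
    by apply: ddpow_u_cvg; exact: inj_uptoS.
  apply: cvgD; first exact: IH.
  apply: cvgMl_tmp; apply: cvgM; first exact: c_cvg.
  by apply: cvgM; [exact: vu_cvg|exact: ddpow_u_cvg].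
rewrite mul0r mulr0 addr0 in main.
apply: cvg_trans main; apply: near_eq_cvg; near=> N.
have c0 : 0 < c N by near: N.
rewrite /Z /X bil_ddpowS // expr0 !mul1r !mulrDr.
congr (_ + _ + _); first by ring.
rewrite exprS; have := expf_neq0 k (lt0r_neq0 c0); move: (c N ^+ k) => q q0.
by field; rewrite q0 gt_eqF.
Unshelve. all: by end_near. Qed.

End Moments.

Lemma horner_mx_sum (R : comNzRingType) n (A : 'M[R]_n.+1) (p : {poly R}) :
  horner_mx A p = \sum_(m < size p) p`_m *: A ^+ m.
Proof.
rewrite -{1}[p]coefK poly_def rmorph_sum; apply: eq_bigr => i _.
by rewrite /= horner_mxZ rmorphXn /= horner_mx_X.
Qed.

Lemma sum_coef_shift (R : comNzRingType) (p : {poly R}) k (F : nat -> R) :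
  (forall m, (m <= k)%N -> F m = 0) ->
  \sum_(m < size p) p`_m * F m =
  \sum_(0 <= q < size p) p`_(k.+1 + q) * F (k.+1 + q)%N.
Proof.
move=> F0; rewrite -(big_mkord xpredT (fun m => p`_m * F m)).
have -> : \sum_(0 <= m < size p) p`_m * F m =
    \sum_(0 <= m < size p + k.+1) p`_m * F m.
  rewrite [RHS](big_cat_nat (n := size p)) ?leq_addr //=.
  rewrite [X in _ = _ + X]big_nat [X in _ = _ + X]big1 ?addr0 // => m /andP[pm _].
  by rewrite nth_default // mul0r.
rewrite (big_cat_nat (n := k.+1)) ?leq_addl //= big_nat big1 ?add0r; last first.
  by move=> m /andP[_ mk]; rewrite F0 ?mulr0.
rewrite -{1}[k.+1]add0n big_addn addnK; apply: eq_bigr => q _.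
by rewrite addnC.
Qed.

(** * The limiting quadratic form *)

Section Cauchy.
Context {R : realType} {n : nat}.
Implicit Types (D : set R) (f : R -> R) (t : nat -> R).
Context {T : Type} {F : set_system T} {FF : ProperFilter F}.

(* If the spectral data of diag x at u and v converge as in ddpow_v_cvg and the
   error of approximating f by a polynomial p is negligible, then the quadratic
   form on the sequence mu of the Hankel matrix (p_(i+j+k)) is nonnegative. *)
Lemma wtone_cauchy k D f (p : {poly R}) (x : T -> 'rV[R]_n.+1)
    (u v : T -> 'cV[R]_n.+1) (c e : T -> R) (mu : nat -> R) (beta : R) :
  wtone k.+1 n.+1 D f -> 0 < beta ->
  (\forall N \near F, 0 < c N) -> c N @[N --> F] --> 0 ->
  (forall a, bil (v N) (u N) (diag_mx (x N) ^+ a) @[N --> F] --> mu a) ->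
  (forall a, bil (u N) (u N) (diag_mx (x N) ^+ a) @[N --> F] -->
     beta * (a == 0)%:R) ->
  (\forall N \near F, forall i,
     c N * \sum_j `|u N i ord0 * u N j ord0| <= e N) ->
  (forall del : R, 0 < del -> \forall N \near F, exists2 d : R,
     forall i y, `|y - x N ord0 i| <= e N -> D y /\ `|f y - p.[y]| <= d &
     c N ^- k.+1 * (d * \sum_i v N i ord0 ^+ 2) <= del) ->
  0 <= \sum_(0 <= q < size p) p`_(k.+1 + q) *
         \sum_(0 <= i < q.+1) mu i * mu (q - i)%N.
Proof.
move=> ft b0 c_pos c_cvg vu_cvg uu_cvg ce xe.
have uv_cvg a : bil (u N) (v N) (diag_mx (x N) ^+ a) @[N --> F] --> mu a.
  rewrite (_ : (fun N => _) = (fun N => bil (v N) (u N) (diag_mx (x N) ^+ a))) //.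
  apply/funext => N; rewrite !bil_diagX; apply: eq_bigr => i _.
  by congr (_ * _); rewrite mulrC.
pose L N := bil (v N) (v N)
  (divdiff (fun s => horner_mx (pencil (x N) (u N) (c N) s) p) k.+1
    (unit_nodes k.+1)).
have L_cvg : c N ^- k.+1 * L N @[N --> F] --> \sum_(m < size p) p`_m * vlim mu beta k 0 m.
  rewrite (_ : (fun N => _) = fun N => \sum_(m < size p) p`_m * (c N ^- k.+1 *
     bil (v N) (v N) (diag_mx (x N) ^+ 0 *
       ddpow (x N) (u N) (c N) k.+1 m (unit_nodes k.+1)))).
    apply: (cvg_big add_continuous) => m _; apply: cvgMl_tmp.
    by apply: ddpow_v_cvg => //; exact: unit_nodes_inj.
  apply/funext => N; rewrite /L divdiffE; last exact: unit_nodes_inj.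
  have E m : bil (v N) (v N) (diag_mx (x N) ^+ 0 *
        ddpow (x N) (u N) (c N) k.+1 m (unit_nodes k.+1)) =
      \sum_(0 <= l < k.+2) ddcoef k.+1 (unit_nodes k.+1) l *
        bil (v N) (v N) (pencil (x N) (u N) (c N) (unit_nodes k.+1 l) ^+ m).
    rewrite expr0 mul1r /ddpow divdiffE; last exact: unit_nodes_inj.
    by rewrite bil_sum; apply: eq_bigr => l _; rewrite bilZ.
  under [RHS]eq_bigr => m _ do rewrite E !mulr_sumr.
  rewrite bil_sum mulr_sumr exchange_big; apply: eq_bigr => l _.
  rewrite bilZ horner_mx_sum bil_sum !mulr_sumr; apply: eq_bigr => m _.
  by rewrite bilZ; ring.
have K0 : 0 <= unit_nodes_norm k.+1 :> R by apply: sumr_ge0.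
have L_ge0 : 0 <= \sum_(m < size p) p`_m * vlim mu beta k 0 m.
  apply/ler_addgt0Pr => eps eps0; rewrite -lerBlDr sub0r.
  pose del := eps / (unit_nodes_norm k.+1 + 1).
  have del0 : 0 < del by rewrite divr_gt0 // ltr_wpDl.
  have Kdel : unit_nodes_norm k.+1 * del <= eps.
    by rewrite /del mulrA ler_pdivrMr ?ltr_wpDl // mulrC ler_pM2l // lerDl.
  apply: (cvgr_to_ge L_cvg); near=> N.
  have [d xd dN] : exists2 d : R,
      forall i y, `|y - x N ord0 i| <= e N -> D y /\ `|f y - p.[y]| <= d &
      c N ^- k.+1 * (d * \sum_i v N i ord0 ^+ 2) <= del.
    by near: N; exact: xe.
  have c0 : 0 < c N by near: N.
  have ceN : forall i, c N * \sum_j `|u N i ord0 * u N j ord0| <= e N by near: N.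
  (* After division by c^(k+1), the error of [tone_pencil] is at most [unit_nodes_norm k.+1 * del],
     hence at most eps. *)
  have := tone_pencil (v N) (ltn0Sn k) ft (ltW c0) ceN xd.
  rewrite -(pmulr_rge0 _ (_ : 0 < c N ^- k.+1)); last first.
    by rewrite invr_gt0 exprn_gt0.
  rewrite mulrDr -[X in X + _]/(c N ^- k.+1 * L N) -[_ * d * _]mulrA mulrCA => h.
  have := ler_wpM2l K0 dN.
  by lra.
(* There are k + 1 insertions of u u^T, hence k inner factors, each with limit beta > 0; dividing by
   beta^k leaves the convolution. *)
rewrite -(pmulr_rge0 _ (exprn_gt0 k b0)).
suff <- : \sum_(m < size p) p`_m * vlim mu beta k 0 m = beta ^+ k *
  \sum_(0 <= q < size p) p`_(k.+1 + q) * \sum_(0 <= i < q.+1) mu i * mu (q - i)%N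
  by [].
have vlim0 m : (m <= k)%N -> vlim mu beta k 0 m = 0.
  move=> mk; rewrite vlimE big_nat big1 // => i /andP[_ im].
  by rewrite ulimE ifF ?mulr0 //; apply/negbTE; rewrite -ltnNge; lia.
have vlimS q : vlim mu beta k 0 (k.+1 + q) =
    beta ^+ k * \sum_(0 <= i < q.+1) mu i * mu (q - i)%N.
  rewrite vlimE (big_cat_nat (n := q.+1)) //= ?[X in _ + X]big_nat.
    rewrite [X in _ + X]big1 ?addr0; last first.
      move=> i /andP[qi ik]; rewrite ulimE ifF ?mulr0 //.
      by apply/negbTE; rewrite -ltnNge; lia.
    rewrite mulr_sumr; apply: eq_big_nat => i /andP[_ iq].
    rewrite ulimE ifT; last by lia.
    by rewrite mulrCA; congr (_ * (_ * mu _)); lia.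
  by lia.
rewrite (sum_coef_shift p vlim0) mulr_sumr; apply: eq_bigr => q _.
by rewrite vlimS mulrCA.
Unshelve. all: by end_near. Qed.

End Cauchy.

(** * The Hankel matrix of Taylor coefficients *)

Section Hankel.
Context {R : realType} {n : nat}.
Implicit Types (D : set R) (f : R -> R).

(** Row a of [W] reads the coefficient of X^a off the values at 0, ..., n of a polynomial of degree
    at most n; it comes from the inverse of a Vandermonde matrix. *)
Lemma nodes_dual_basis : exists W : nat -> 'I_n.+1 -> R,
  forall a b, (a <= n)%N -> (b <= n)%N ->
  \sum_i W a i * i%:R ^+ b = (a == b)%:R.
Proof.
pose V : 'M[R]_n.+1 := Vandermonde n.+1 (\row_i i%:R).
have Vu : V^T \in unitmx.
  rewrite unitmx_tr unitmxE det_Vandermonde unitfE.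
  apply/prodf_neq0 => i _; apply/prodf_neq0 => j ij.
  by rewrite !mxE subr_eq0 eqr_nat gtn_eqF.
exists (fun a i => invmx V^T (inord a) i) => a b an bn.
have /matrixP/(_ (inord a) (inord b)) := mulVmx Vu.
rewrite !mxE -val_eqE /= !inordK // => <-.
by apply: eq_bigr => i _; rewrite !mxE inordK.
Qed.

Lemma cvg_expr0 b : (0 < b)%N -> (s ^+ b : R) @[s --> 0^'+] --> (0 : R).
Proof.
case: b => // b _; apply: cvg_at_right_filter.
rewrite -[X in _ --> X](expr0n R b.+1).
by apply: exprn_continuous.
Qed.

(* With nodes s * i, i <= n, and s tending to 0, a vector v whose moments
   s^a (sum_i v_i i^a) are the prescribed mu_a for a <= n has size s^-n, which
   makes a remainder o(y^(2n+k+1)) of f negligible in wtone_cauchy. *)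
Lemma wtone_hankel k D f (p : {poly R}) (mu : nat -> R) :
  wtone k.+1 n.+1 D f -> nbhs (0 : R) D ->
  (forall a, (n < a)%N -> mu a = 0) ->
  (forall eps : R, 0 < eps -> \forall y \near (0 : R),
     `|f y - p.[y]| <= eps * `|y| ^+ (2 * n + k.+1)) ->
  0 <= \sum_(0 <= q < size p) p`_(k.+1 + q) *
         \sum_(0 <= i < q.+1) mu i * mu (q - i)%N.
Proof.
move=> ft nD mu0 fp.
have [W WE] := nodes_dual_basis.
pose x (s : R) : 'rV[R]_n.+1 := \row_i (s * i%:R).
pose u (s : R) : 'cV[R]_n.+1 := const_mx 1.
pose v (s : R) : 'cV[R]_n.+1 := \col_i \sum_(a < n.+1) s ^- a * (mu a * W a i).
(* All entries of u are 1, so u^T X^a u = s^a sum_i i^a: this gives beta = n + 1. With c = s the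
   eigenvalues stay within s (n + 1) of the nodes. *)
apply: (@wtone_cauchy _ _ _ 0^'+ _ k D f p x u v id (fun s => s * n.+1%:R) mu n.+1%:R).
- exact: ft.
- by rewrite ltr0n.
- exact: nbhs_right_gt.
- exact: cvg_at_right_filter cvg_id.
- move=> b.
  have uvE s : bil (v s) (u s) (diag_mx (x s) ^+ b) =
      \sum_(a < n.+1) s ^- a * s ^+ b * (mu a * \sum_i W a i * i%:R ^+ b).
    rewrite bil_diagX; under eq_bigr => i _ do rewrite !mxE mulr1 mulr_suml.
    rewrite exchange_big; apply: eq_bigr => a _.
    rewrite !mulr_sumr; apply: eq_bigr => i _.
    by rewrite exprMn; ring.
  rewrite (funext uvE).
  (* For b <= n the moment is exactly mu b when s > 0; for b > n every term carries s^(b - a) with a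
     <= n, and mu b = 0. *)
  have [bn|nb] := leqP b n.
    apply: cvg_trans (_ : (fun=> mu b) s @[s --> 0^'+] --> mu b); last exact: cvg_cst.
    apply: near_eq_cvg; near=> s.
    have s0 : 0 < s by near: s; exact: nbhs_right_gt.
    rewrite (bigD1 (Ordinal (bn : (b < n.+1)%N))) //= WE // eqxx mulr1.
    rewrite mulVf ?mul1r ?expf_neq0 ?gt_eqF // big1 ?addr0 // => i ib.
    by rewrite WE ?leq_ord // (negbTE (_ : i != b :> nat)) ?mulr0 //.
  rewrite mu0 //.
  rewrite [X in _ --> X](_ : 0 = \sum_(a < n.+1) (0 : R)); last by rewrite big1.
  apply: (cvg_big add_continuous) => a _.
  rewrite -[X in _ --> X](mul0r (mu a * \sum_i W a i * i%:R ^+ b)).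
  apply: cvgMr_tmp.
  apply: cvg_trans (@cvg_expr0 (b - a) _); last by have := leq_ord a; lia.
  apply: near_eq_cvg; near=> s.
  have s0 : 0 < s by near: s; exact: nbhs_right_gt.
  by rewrite expfB 1?mulrC //; have := leq_ord a; lia.
- move=> a.
  have uuE s : bil (u s) (u s) (diag_mx (x s) ^+ a) =
      s ^+ a * \sum_(i < n.+1) i%:R ^+ a.
    rewrite bil_diagX mulr_sumr; apply: eq_bigr => i _.
    by rewrite !mxE !mul1r exprMn.
  rewrite (funext uuE); case: a {uuE} => [|a].
    under [X in X @ _ --> _]eq_fun do rewrite expr0 mul1r.
    under eq_bigr do rewrite expr0.
    by rewrite sumr_const card_ord mulr1; exact: cvg_cst.
  rewrite mulr0 -[X in _ --> X](mul0r (\sum_(i < n.+1) i%:R ^+ a.+1)).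
  by apply: cvgMr_tmp; exact: cvg_expr0.
- near=> s; have s0 : 0 < s by near: s; exact: nbhs_right_gt.
  move=> i; apply: ler_wpM2l; first exact: ltW.
  under eq_bigr do rewrite !mxE mulr1 normr1.
  by rewrite sumr_const card_ord.
move=> del del0.
pose m := (2 * n + k.+1)%N.
pose S i := \sum_(a < n.+1) `|mu a * W a i|.
pose C := 1 + \sum_(i < n.+1) S i ^+ 2.
have C0 : 0 < C by rewrite ltr_wpDr // sumr_ge0 // => i _; rewrite sqr_ge0.
(* Nodes are at most s n and eigenvalues deviate by at most s (n + 1), so |y| <= s B. The choice of
   eps makes s^-(k+1) eps (s B)^m s^(-2n) C equal to del. *)
pose B : R := (2 * n.+1)%:R.
have B0 : 0 < B by rewrite ltr0n.
pose eps := del / (C * B ^+ m).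
have eps0 : 0 < eps by rewrite divr_gt0 // mulr_gt0 // exprn_gt0.
have near0 : nbhs (0 : R)
    [set y | D y /\ `|f y - p.[y]| <= eps * `|y| ^+ (2 * n + k.+1)].
  exact: filterI nD (fp _ eps0).
have /nbhs_ballP[r /= r0 Hr] := near0.
near=> s.
have s0 : 0 < s by near: s; exact: nbhs_right_gt.
have s1 : s <= 1 by near: s; exact: nbhs_right_le.
have sB : s * B < r.
  by rewrite -ltr_pdivlMr //; near: s; apply: nbhs_right_lt; rewrite divr_gt0.
exists (eps * (s * B) ^+ m).
  move=> i y yi.
  have yB : `|y| <= s * B.
    have -> : y = (y - x s ord0 i) + x s ord0 i by rewrite subrK.
    rewrite (le_trans (ler_normD _ _)) //.
    rewrite /B mulnC muln2 -addnn natrD mulrDr lerD // mxE ger0_norm.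
      by rewrite ler_pM2l // ler_nat ltnW.
    by rewrite mulr_ge0 // ltW.
  have [] := Hr y; first by rewrite /ball /= sub0r normrN (le_lt_trans yB).
  move=> Dy fy; split => //; apply: le_trans fy _.
  by rewrite ler_pM2l // lerXn2r ?nnegrE // mulr_ge0 // ltW.
have se j : 0 <= s ^- j by rewrite invr_ge0 exprn_ge0 // ltW.
have vS i : `|v s i ord0| <= s ^- n * S i.
  rewrite mxE (le_trans (ler_norm_sum _ _ _)) // mulr_sumr.
  apply: ler_sum => a _; rewrite normrM ler_wpM2r //.
  rewrite ger0_norm // lef_pV2 ?posrE ?exprn_gt0 //.
  by apply: ler_wiXn2l; rewrite ?leq_ord // ltW.
have vC : \sum_i v s i ord0 ^+ 2 <= s ^- (2 * n) * C.
  apply: (@le_trans _ _ (\sum_i s ^- (2 * n) * S i ^+ 2)).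
    apply: ler_sum => i _; rewrite -[_ ^+ 2]ger0_norm ?sqr_ge0 // normrX.
    rewrite mulnC exprM -exprVn -exprMn lerXn2r ?nnegrE //.
    by rewrite mulr_ge0 // sumr_ge0.
  rewrite -mulr_sumr ler_wpM2l //.
  by rewrite /C lerDr.
apply: le_trans (_ : s ^- k.+1 * (eps * (s * B) ^+ m * (s ^- (2 * n) * C)) <= _).
  rewrite ler_wpM2l // ler_wpM2l //.
  apply: mulr_ge0; first exact: ltW.
  by apply: exprn_ge0; apply: mulr_ge0; exact: ltW.
rewrite /eps exprMn (_ : s ^+ m = s ^+ (2 * n) * s ^+ k.+1); last exact: exprD.
have sn0 := expf_neq0 (2 * n) (lt0r_neq0 s0).
have sk0 := expf_neq0 k.+1 (lt0r_neq0 s0).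
have Bm0 := expf_neq0 m (lt0r_neq0 B0).
rewrite le_eqVlt; apply/orP; left; apply/eqP.
move: (s ^+ (2 * n)) (s ^+ k.+1) (B ^+ _) sn0 sk0 Bm0 => p1 p2 p3 h1 h2 h3.
by field; rewrite h1 h2 h3 (gt_eqF C0).
Unshelve. all: by end_near. Qed.

End Hankel.

(** * The Loewner form at several points *)

Section Loewner.
Context {R : realType} {n : nat}.
Implicit Types (D : set R) (f : R -> R).

(* The perturbation direction u concentrates at the first basis vector, whose
   eigenvalue is 0, while the products u_i v_i = w_i are kept fixed. *)
Lemma wtone_loewner k D f (p : {poly R}) (x w : 'I_n.+1 -> R) :
  wtone k.+1 n.+1 D f -> x ord0 = 0 -> (forall i, nbhs (x i) D) ->
  (forall i (eps : R), 0 < eps -> \forall y \near x i,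
     `|f y - p.[y]| <= eps * `|y - x i| ^+ k.+1) ->
  0 <= \sum_(0 <= q < size p) p`_(k.+1 + q) *
         \sum_(0 <= i < q.+1)
           (\sum_j w j * x j ^+ i) * (\sum_j w j * x j ^+ (q - i)).
Proof.
move=> ft x0 nD fp.
(* The entries of v grow like 1 / s, so |v|^2 is of order s^-2; an error rate s^3 leaves a factor s.
   For each s > 0, some [c s] is small enough to reach this rate at all the points. *)
pose M : R := n.+1%:R; have M0 : 0 < M by rewrite ltr0n.
have /choice[c cP] : forall s : R, exists c : R, 0 < s -> [/\ 0 < c, c <= s &
    forall i y, `|y - x i| <= c * M ->
      D y /\ `|f y - p.[y]| <= s ^+ 3 * `|y - x i| ^+ k.+1].
  move=> s; have [s0|] := ltP 0 s; last by exists 0; rewrite ltNge.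
  have /choice[r rP] : forall i, exists r : R, 0 < r /\ forall y, `|y - x i| < r ->
      D y /\ `|f y - p.[y]| <= s ^+ 3 * `|y - x i| ^+ k.+1.
    move=> i; have near_xi : nbhs (x i)
        [set y | D y /\ `|f y - p.[y]| <= s ^+ 3 * `|y - x i| ^+ k.+1].
      exact: filterI (nD i) (fp i _ (exprn_gt0 3 s0)).
    have /nbhs_ballP[r /= r0 Hr] := near_xi.
    by exists r; split => // y yx; apply: Hr; rewrite /ball /= distrC.
  pose c := \big[Num.min/s]_i (r i / 2 / M).
  exists c => _; split.
  - by apply: lt_bigmin => // i _; have [r0 _] := rP i; rewrite !divr_gt0.
  - exact: bigmin_le_id.
  - move=> i y yx; have [r0] := rP i; apply; apply: le_lt_trans yx _.
    have : c <= r i / 2 / M by apply: bigmin_le.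
    by rewrite ler_pdivlMr // => /le_lt_trans; apply; lra.
pose X : R -> 'rV[R]_n.+1 := fun=> \row_i x i.
pose ui (s : R) (i : 'I_n.+1) := if i == ord0 then 1 else s.
pose u (s : R) : 'cV[R]_n.+1 := \col_i ui s i.
pose v (s : R) : 'cV[R]_n.+1 := \col_i (w i / ui s i).
apply: (@wtone_cauchy _ _ _ 0^'+ _ k D f p X u v c (fun s => c s * M) _ 1) => //.
- near=> s; have s0 : 0 < s by near: s; exact: nbhs_right_gt.
  by have [] := cP _ s0.
- apply/cvgrPdist_le => eps eps0; near=> s.
  have s0 : 0 < s by near: s; exact: nbhs_right_gt.
  have [c0 cs _] := cP _ s0; rewrite sub0r normrN gtr0_norm // (le_trans cs) //.
  by near: s; exact: nbhs_right_le.
- move=> a.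
  apply: cvg_trans (_ : (fun=> \sum_j w j * x j ^+ a) s @[s --> 0^'+] --> _);
    last exact: cvg_cst.
  apply: near_eq_cvg; near=> s.
  have s0 : 0 < s by near: s; exact: nbhs_right_gt.
  rewrite bil_diagX; apply: eq_bigr => i _; rewrite !mxE divfK // /ui.
  by case: ifP => _; rewrite ?oner_eq0 ?gt_eqF.
- move=> a; rewrite mul1r.
  (* Since x_0 = 0, the first coordinate contributes 0^a, which is 1 for a = 0 only; hence beta =
     1. *)
  have uuE s : bil (u s) (u s) (diag_mx (X s) ^+ a) =
      (a == 0)%:R + s ^+ 2 * \sum_(i < n) x (lift ord0 i) ^+ a.
    rewrite bil_diagX big_ord_recl mulr_sumr; congr (_ + _).
      by rewrite !mxE /ui eqxx !mul1r x0 expr0n.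
    by apply: eq_bigr => i _; rewrite !mxE /ui /= expr2.
  rewrite (funext uuE) -[X in _ --> X]addr0.
  apply: cvgD; first exact: cvg_cst.
  rewrite -[X in _ --> X](mul0r (\sum_(i < n) x (lift ord0 i) ^+ a)).
  by apply: cvgMr_tmp; exact: cvg_expr0.
- near=> s; have s0 : 0 < s by near: s; exact: nbhs_right_gt.
  have s1 : s <= 1 by near: s; exact: nbhs_right_le.
  have [c0 _ _] := cP _ s0.
  move=> i; rewrite ler_pM2l //.
  apply: (@le_trans _ _ (\sum_(j < n.+1) 1)); last by rewrite sumr_const card_ord.
  apply: ler_sum => j _; rewrite !mxE /ui normrM mulr_ile1 //.
    by case: ifP => _; rewrite ?normr1 ?gtr0_norm.
  by case: ifP => _; rewrite ?normr1 ?gtr0_norm.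
move=> del del0.
pose S := \sum_i w i ^+ 2.
have S0 : 0 <= S by apply: sumr_ge0 => i _; rewrite sqr_ge0.
have MS0 : 0 <= M ^+ k.+1 * S by rewrite mulr_ge0 // exprn_ge0 // ltW.
have MS1 : 0 < M ^+ k.+1 * S + 1 by rewrite ltr_wpDl.
have B0 : 0 < del / (M ^+ k.+1 * S + 1) by rewrite divr_gt0.
near=> s; have s0 : 0 < s by near: s; exact: nbhs_right_gt.
have s1 : s <= 1 by near: s; exact: nbhs_right_le.
have [c0 _ cD] := cP _ s0.
exists (s ^+ 3 * (c s * M) ^+ k.+1).
  move=> i y; rewrite mxE => yx; have [Dy fy] := cD _ _ yx; split=> //.
  apply: le_trans fy _; rewrite ler_pM2l ?exprn_gt0 //.
  by rewrite lerXn2r ?nnegrE // mulr_ge0 // ltW.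
have vS : \sum_i v s i ord0 ^+ 2 <= s ^- 2 * S.
  rewrite mulr_sumr; apply: ler_sum => i _.
  rewrite mxE expr_div_n mulrC ler_wpM2r ?sqr_ge0 //.
  rewrite lef_pV2 ?posrE ?exprn_gt0 // /ui.
    by case: ifP => _ //; rewrite expr1n exprn_ile1 // ltW.
  by case: ifP.
apply: le_trans (_ : c s ^- k.+1 * (s ^+ 3 * (c s * M) ^+ k.+1 * (s ^- 2 * S)) <= _).
  rewrite ler_wpM2l ?invr_ge0 ?exprn_ge0 ?(ltW c0) // ler_wpM2l //.
  apply: mulr_ge0; first exact/exprn_ge0/ltW.
  by apply: exprn_ge0; apply: mulr_ge0; exact: ltW.
have -> : c s ^- k.+1 * (s ^+ 3 * (c s * M) ^+ k.+1 * (s ^- 2 * S)) =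
    s * (M ^+ k.+1 * S).
  rewrite exprMn; have := expf_neq0 k.+1 (lt0r_neq0 c0).
  move: (c s ^+ k.+1) (M ^+ k.+1) => p1 p2 p10.
  by field; rewrite p10 gt_eqF.
apply: le_trans (_ : s * (M ^+ k.+1 * S + 1) <= _).
  by rewrite ler_pM2l // lerDl.
by rewrite -ler_pdivlMr //; near: s; exact: nbhs_right_le.
Unshelve. all: by end_near. Qed.

End Loewner.

(** * Taylor expansions and one-sided derivatives *)

Section Taylor.
Context {R : realType}.
Implicit Types (D : set R) (f g : R -> R) (p : {poly R}).

Lemma near_right (x : R) (P : R -> Prop) : (\forall y \near x^'+, P y) ->
  exists2 r : R, 0 < r & forall y, x < y < x + r -> P y.
Proof.
move=> nP; have /nbhs_ballP[r /= r0 Hr] : nbhs x (fun y => x < y -> P y).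
  exact: nP.
exists r => // y /andP[xy yr]; apply: Hr => //.
by rewrite /ball /= distrC gtr0_norm; lra.
Qed.

Lemma near_at_right (P : R -> Prop) : (\forall h \near 0^'+, P h) ->
  exists2 r : R, 0 < r & forall h, 0 < h < r -> P h.
Proof.
by move=> /near_right[r r0 Hr]; exists r => // h; have := Hr h; rewrite add0r.
Qed.

(** Continuous induction with slope -eps: let c be the supremum of the points up to which phi stays
    above the line. Continuity puts c itself in the set, and the hypothesis at c < b would extend it
    further. *)
Lemma right_derivative_le (phi : R -> R) (a b : R) : a <= b ->
  (forall s, a <= s -> s <= b -> {for s, continuous phi}) ->
  (forall s, a <= s -> s < b -> forall eps : R, 0 < eps ->
     \forall h \near 0^'+, phi s - eps * h <= phi (s + h)) ->
  phi a <= phi b.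
Proof.
move=> ab phic phid; apply/ler_addgt0Pr => e e0.
have ba1 : 0 < b - a + 1 by lra.
pose eps := e / (b - a + 1); have eps0 : 0 < eps by rewrite divr_gt0.
suff H : phi a - eps * (b - a) <= phi b.
  have : eps * (b - a) <= e.
    by rewrite /eps mulrAC ler_pdivrMr // ler_pM2l //; lra.
  by lra.
pose S := [set s | a <= s <= b /\
  forall t, a <= t -> t <= s -> phi a - eps * (t - a) <= phi t].
have Sa : S a.
  split; first by rewrite lexx.
  move=> t at_ ta; have -> : t = a by apply/eqP; rewrite eq_le ta at_.
  by rewrite subrr mulr0 subr0.
have Sub : ubound S b by move=> s [/andP[]].
have Ssup : has_sup S by split; [exists a|exists b].
pose c := sup S.
have ac : a <= c by apply: ub_le_sup Sa; exists b.
have cb : c <= b by apply: ge_sup => //; exists a.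
have below t : a <= t -> t < c -> phi a - eps * (t - a) <= phi t.
  move=> at_ tc; have [s [_ Ss] ts] := sup_gt Ssup.1 tc.
  by apply: Ss => //; exact: ltW.
have cS : phi a - eps * (c - a) <= phi c.
  have [->|anc] := eqVneq c a; first by rewrite subrr mulr0 subr0.
  have lac : a < c by rewrite lt_def anc.
  have psi_cvg : phi t + eps * (t - a) @[t --> c^'-] --> phi c + eps * (c - a).
    apply: cvg_at_left_filter; apply: cvgD; first exact: phic.
    by apply: cvgMl_tmp; apply: cvgB; [exact: cvg_id|exact: cvg_cst].
  rewrite lerBlDr; apply: (cvgr_to_ge psi_cvg); near=> t.
  rewrite -lerBlDr; apply: below.
    by near: t; exact: nbhs_left_ge.
  by near: t; exact: nbhs_left_lt.
have [<-//|ncb] := eqVneq c b.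
have lcb : c < b by rewrite lt_def eq_sym ncb.
have [r r0 Hr] := near_at_right (phid c ac lcb eps eps0).
exfalso; pose h := Num.min (r / 2) (b - c).
have h0 : 0 < h by rewrite lt_min divr_gt0 //= subr_gt0.
have hr : h <= r / 2 by rewrite ge_min lexx.
have hb : h <= b - c by rewrite ge_min lexx orbT.
have Sch : S (c + h).
  split; first by lra.
  move=> t at_ tc; have [tltc|] := ltP t c; first exact: below.
  rewrite le_eqVlt => /orP[/eqP <- //|ct].
  have := Hr (t - c); rewrite [c + _]addrC subrK => /(_ ltac:(lra)).
  by lra.
have : c + h <= c by apply: ub_le_sup Sch; exists b.
by lra.
Unshelve. all: by end_near. Qed.

(** An expansion with remainder o(|y|^m), where [p] is a polynomial in the increment y; no
    differentiability is presupposed. *)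
Definition peano f (x : R) p (m : nat) := forall eps : R, 0 < eps ->
  \forall y \near (0 : R), `|f (y + x) - p.[y]| <= eps * `|y| ^+ m.

(** The mean value theorem, applied to f(y + x) - p(y) between 0 and y, gains the factor |y|. *)
Lemma peano_primitive f (x : R) p m :
  (\forall z \near x, derivable f z 1) -> p.[0] = f x ->
  peano (derive1 f) x p^`() m -> peano f x p m.+1.
Proof.
move=> df px fp eps eps0.
have [r' /= r'0 Hr'] := (nbhs_ballP _ _).1 df.
have [r /= r0 Hr] := (nbhs_ballP _ _).1 (fp _ eps0).
pose phi y := f (y + x) - p.[y].
pose rr := Num.min r r'.
have rr0 : 0 < rr by rewrite lt_min r0.
have dphi (y : R) : `|y| < rr -> is_derive y 1 phi (derive1 f (y + x) - p^`().[y]).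
  rewrite lt_min => /andP[yr yr'].
  have df' : is_derive (y + x) 1 f (derive1 f (y + x)).
    rewrite derive1E; apply/derivableP/Hr'; rewrite /ball /=.
    by rewrite opprD addrCA subrr addr0 normrN.
  apply: is_deriveB.
  rewrite -[derive1 f _]mulr1; apply: (@is_derive1_comp _ f (fun y => y + x)).
  by apply: is_derive_eq; rewrite addr0.
apply/nbhs_ballP; exists rr => // y; rewrite /ball /= sub0r normrN => yrr.
have phi0 : phi 0 = 0 by rewrite /phi add0r px subrr.
have bound (z : R) : `|z| <= `|y| ->
    `|derive1 f (z + x) - p^`().[z]| <= eps * `|y| ^+ m.
  move=> zy; have zr : `|z| < r.
    by apply: le_lt_trans zy (lt_le_trans yrr _); rewrite ge_min lexx.
  have := Hr z; rewrite /ball /= sub0r normrN => /(_ zr) /le_trans; apply.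
  by rewrite ler_pM2l // lerXn2r ?nnegrE.
have contphi (z : R) : `|z| < rr -> {for z, continuous phi}.
  move=> zr; apply: differentiable_continuous; apply/derivable1_diffP.
  exact: (@ex_derive _ _ _ _ _ _ _ (dphi _ zr)).
rewrite -/(phi y).
have mvt (a b : R) : a <= b -> `|a| <= `|y| -> `|b| <= `|y| ->
    exists2 c, `|c| <= `|y| & phi b - phi a =
      (derive1 f (c + x) - p^`().[c]) * (b - a).
  move=> ab ay by_.
  have cy c : a <= c -> c <= b -> `|c| <= `|y|.
    move=> ac cb; move: ay by_; rewrite !ler_norml => /andP[? _] /andP[_ ?].
    by apply/andP; split; lra.
  have [||c] := @MVT_segment _ phi (fun z => derive1 f (z + x) - p^`().[z]) a b ab.
  - move=> z; rewrite in_itv /= => /andP[az zb]; apply: dphi.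
    by apply: le_lt_trans yrr; apply: cy; exact: ltW.
  - apply: continuous_in_subspaceT => z; rewrite inE /= in_itv /= => /andP[az zb].
    by apply: contphi; apply: le_lt_trans yrr; exact: cy.
  by rewrite in_itv /= => /andP[ac cb] E; exists c => //; exact: cy.
have -> : `|phi y| = `|phi y - phi 0| by rewrite phi0 subr0.
have [y0|/ltW y0] := leP 0 y.
  have [||c cy ->] := mvt 0 y y0; rewrite ?normr0 //.
  by rewrite normrM subr0 exprSr mulrA ler_wpM2r // bound.
have [||c cy] := mvt y 0 y0; rewrite ?normr0 //.
rewrite distrC => ->.
by rewrite normrM sub0r normrN exprSr mulrA ler_wpM2r // bound.
Qed.

Lemma peano_iter f (x : R) p M j :
  (forall i, (i < M)%N -> \forall z \near x, derivable (derive1n i f) z 1) ->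
  (forall i, (i < M)%N -> p^`(i).[0] = derive1n i f x) ->
  peano (derive1n M f) x p^`(M) j -> peano f x p (M + j).
Proof.
elim: M j => [//|M IH] j df px fM; rewrite addSnnS.
apply: IH => [i iM|i iM|].
- by apply: df; exact: leqW.
- by apply: px; exact: leqW.
apply: peano_primitive; [exact: df|exact: px|].
by rewrite -derivnS.
Qed.

End Taylor.

(** * Steklov averages *)

Section Primitive.
Context {R : realType}.
Implicit Types (f F : R -> R).
Notation mu := (@lebesgue_measure R).

(* The mean value bounds satisfied by an indefinite integral F of f. *)
Definition mean_bounds f F (a b : R) := forall x y, a <= x -> x < y -> y <= b ->
  forall l u, (forall z, x < z <= y -> l <= f z <= u) ->
  l * (y - x) <= F y - F x <= u * (y - x).

Lemma primitive_exists f (a b : R) : mu.-integrable `[a, b] (EFin \o f) ->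
  exists F, mean_bounds f F a b.
Proof.
move=> intf; exists (fun x => \int[mu]_(t in `[a, x]) f t)%R.
move=> x y ax xy yb l u lfu.
have sub : `[a, y] `<=` `[a, b] by apply: subset_itvl; rewrite bnd_simp.
rewrite Rintegral_itvB ?bnd_simp //; last 2 first.
- exact: integrableS intf.
- exact: ltW.
have sub' : `]x, y] `<=` `[a, b].
  by move=> z /=; rewrite !in_itv /= => /andP[xz zy]; apply/andP; split; lra.
have intf' : mu.-integrable `]x, y] (EFin \o f) by apply: integrableS intf.
have intc c : mu.-integrable `]x, y] (EFin \o (fun=> c : R)).
  apply: (@measurable_bounded_integrable _ _ _ mu) => //.
  - by rewrite /= lebesgue_measure_itv /= lte_fin xy -EFinB ltry.
  - exact: bounded_cst.
have cE c : c * (y - x) = (\int[mu]_(t in `]x, y]) c)%R.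
  by rewrite Rintegral_cst //= lebesgue_measure_itv /= lte_fin xy -EFinB.
rewrite !cE; apply/andP; split.
  apply: (le_Rintegral _ (intc l) intf') => // z; rewrite /= in_itv /=.
  by move=> /lfu/andP[].
apply: (le_Rintegral _ intf' (intc u)) => // z; rewrite /= in_itv /=.
by move=> /lfu/andP[].
Qed.

(** The bounds use f on (x, x + h] and ignore f(x), so the right derivative of F is the right limit
    of f even where f jumps. *)
Lemma mean_bounds_right f F (a b x l : R) : mean_bounds f F a b -> a <= x -> x < b ->
  f y @[y --> x^'+] --> l ->
  (F (x + h) - F x) / h @[h --> 0^'+] --> l.
Proof.
move=> fF ax xb fl; apply/cvgrPdist_le => eps eps0.
move: fl => /cvgrPdist_le/(_ eps eps0)/near_right[r r0 Hr].
near=> h; have h0 : 0 < h by near: h; exact: nbhs_right_gt.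
have hr : h < r by near: h; exact: nbhs_right_lt.
have hb : h <= b - x by near: h; apply: nbhs_right_le; rewrite subr_gt0.
have xhE : x + h - x = h by rewrite addrAC subrr add0r.
have := fF x (x + h) ax _ _ (l - eps) (l + eps); rewrite xhE => fh.
have /andP[h1 h2] : (l - eps) * h <= F (x + h) - F x <= (l + eps) * h.
  apply: fh; [lra|lra|move=> z /andP[xz zh]].
  have : `|l - f z| <= eps.
    by apply: Hr; lra.
  by rewrite ler_norml => /andP[? ?]; lra.
rewrite ler_norml; apply/andP; split.
  by rewrite lerBrDr -lerBrDl opprK ler_pdivrMr // addrC.
by rewrite lerBlDr -lerBlDl ler_pdivlMr.
Unshelve. all: by end_near. Qed.

Lemma mean_bounds_lip f F (a b M : R) : mean_bounds f F a b ->
  (forall z, a <= z <= b -> `|f z| <= M) ->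
  forall x y, a <= x <= b -> a <= y <= b -> `|F y - F x| <= M * `|y - x|.
Proof.
move=> fF fM.
have H x y : a <= x -> x < y -> y <= b -> `|F y - F x| <= M * (y - x).
  move=> ax xy yb; have /andP[h1 h2] : (- M) * (y - x) <= F y - F x <= M * (y - x).
    apply: fF => // z /andP[xz zy].
    by rewrite -ler_norml; apply: fM; lra.
  by rewrite ler_norml h2 -mulNr h1.
move=> x y /andP[ax xb] /andP[ay yb]; case: (ltgtP x y) => [xy|yx|->].
- by rewrite [X in M * X]gtr0_norm ?subr_gt0 // H.
- by rewrite distrC [X in M * X]distrC [X in M * X]gtr0_norm ?subr_gt0 // H.
- by rewrite !subrr !normr0 mulr0.
Qed.

Lemma mean_bounds_continuous f F (a b M x : R) : mean_bounds f F a b ->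
  (forall z, a <= z <= b -> `|f z| <= M) -> a < x -> x < b ->
  {for x, continuous F}.
Proof.
move=> fF fM ax xb; have M0 : 0 <= M.
  by apply: le_trans (normr_ge0 _) (fM x _); rewrite !ltW.
apply/cvgrPdist_le => eps eps0.
have r0 : 0 < eps / (M + 1) by rewrite divr_gt0 // ltr_wpDl.
have near_r := @nbhsx_ballx _ _ x _ r0.
near=> y; have yx : `|x - y| < eps / (M + 1) by near: y.
have yab : a <= y <= b.
  by apply/andP; split; rewrite ltW //; near: y; [exact: lt_nbhsr|exact: lt_nbhsl].
have xab : a <= x <= b by rewrite !ltW.
rewrite (le_trans (mean_bounds_lip fF fM yab xab)) //.
apply: (@le_trans _ _ ((M + 1) * `|x - y|)); first by rewrite ler_wpM2r // lerDl.
by rewrite mulrC -ler_pdivlMr ?ltW // ltr_wpDl.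
Unshelve. all: by end_near. Qed.

Lemma mean_bounds_derive f F (a b x : R) : mean_bounds f F a b -> a < x -> x < b ->
  {for x, continuous f} -> is_derive x 1 F (f x).
Proof.
move=> fF ax xb fx.
have H : h^-1 *: (F (h *: 1 + x) - F x) @[h --> 0^'] --> f x.
  apply/cvgrPdist_le => eps eps0.
  move: fx => /cvgrPdist_le/(_ eps eps0)/nbhs_ballP[r /= r0 Hr].
  near=> h; have h0 : h != 0 by near: h; exact: nbhs_dnbhs_neq.
  have hr : `|h| < Num.min r (Num.min (x - a) (b - x)).
    by near: h; apply: dnbhs0_lt; rewrite !lt_min r0 !subr_gt0 ax.
  have -> : h *: (1 : R) + x = x + h by rewrite addrC; congr (_ + _); exact: mulr1.
  move: hr; rewrite !lt_min => /and3P[hr ha hb].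
  have near_f z : `|z - x| <= `|h| -> f x - eps <= f z <= f x + eps.
    move=> zx; have : `|f x - f z| <= eps.
      by apply: Hr; rewrite /ball /= distrC (le_lt_trans zx).
    by rewrite ler_norml => /andP[? ?]; lra.
  rewrite -[h^-1 *: _]/(h^-1 * _) mulrC ler_norml.
  have [hpos|hneg] := ltP 0 h.
    move: hr ha hb near_f; rewrite gtr0_norm // => hr ha hb near_f.
    have /andP[h1 h2] : (f x - eps) * (x + h - x) <= F (x + h) - F x <=
        (f x + eps) * (x + h - x).
      apply: fF; try lra.
      by move=> z /andP[xz zh]; apply: near_f; rewrite ger0_norm; lra.
    rewrite addrAC subrr add0r in h1 h2.
    apply/andP; split.
      by rewrite lerBrDr -lerBrDl opprK ler_pdivrMr // addrC.
    by rewrite lerBlDr -lerBlDl ler_pdivlMr.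
  have hn : h < 0 by rewrite lt_neqAle h0.
  move: hr ha hb near_f; rewrite ltr0_norm // => hr ha hb near_f.
  have /andP[h1 h2] : (f x - eps) * (x - (x + h)) <= F x - F (x + h) <=
      (f x + eps) * (x - (x + h)).
    apply: fF; try lra.
    by move=> z /andP[xz zh]; apply: near_f; rewrite ler0_norm; lra.
  have E : (F (x + h) - F x) / h = (F x - F (x + h)) / (- h).
    by rewrite invrN mulrN -mulNr opprB.
  have hn' : 0 < - h by lra.
  rewrite opprD addrA subrr sub0r in h1 h2.
  rewrite E; apply/andP; split.
    by rewrite lerBrDr -lerBrDl opprK ler_pdivrMr // addrC.
  by rewrite lerBlDr -lerBlDl ler_pdivlMr.
apply: DeriveDef; first by apply/cvg_ex; exists (f x).
exact: cvg_lim H.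
Unshelve. all: by end_near. Qed.

End Primitive.

(** * Tonicity of Steklov averages *)

Section Steklov.
Context {R : realType} {n : nat}.
Local Open Scope complex_scope.
Implicit Types (D : set R) (f F : R -> R).

(** The mean of f over [x, x + h] when F is an indefinite integral of f. *)
Definition steklov F (h x : R) : R := (F (x + h) - F x) / h.

(** Here [f'] is the right limit of f, not its derivative. The quadratic form is a finite sum [L],
    and s |-> L(F(y + s)) has right derivative L(f'(y + s)), a limit of the nonnegative values L(f(y
    + r)) given by tonicity of the translates. No matrix-valued integral is involved. *)
Lemma wtone_steklov k D f f' F h : wtone k.+1 n.+1 D f -> is_interval D ->
  (forall x, D x -> f y @[y --> x^'+] --> f' x) ->
  (forall x, D x -> {for x, continuous F}) ->
  (forall x, D x -> steklov F e x @[e --> 0^'+] --> f' x) ->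
  0 < h -> wtone k.+1 n.+1 [set x | D x /\ D (x + h)] (steklov F h).
Proof.
move=> ft Di ff' cF FF' h0 A B ABD AB t t0 t1 tlt v.
have [[Ah _] [Bh _]] := herm_on_endpoints ABD.
have tinj := increasing_inj tlt.
have [c [l [clP E]]] := mx_divdiff_quad v Ah Bh tinj.
pose L g := \sum_(m < k.+2) ddcoef k.+1 t m * \sum_i c m i * g (l m i).
have LE g : quad v (mx_divdiff g A B k.+1 t) = (L g)%:C by rewrite E big_mkord.
rewrite LE ler0c.
have t01 (m : nat) : (m <= k.+1)%N -> 0 <= t m <= 1.
  move=> mk; apply/andP; split.
    case: m mk => [|m] mk; first by rewrite t0.
    by rewrite -t0; apply/ltW/(increasing_lt tlt).
  move: mk; rewrite leq_eqVlt => /orP[/eqP ->|mk]; first by rewrite t1.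
  by rewrite -t1; apply/ltW/(increasing_lt tlt).
have lD (m : 'I_k.+2) i : D (l m i) /\ D (l m i + h).
  have [_ ev _] := clP m.
  exact: ((ABD _ (t01 _ (leq_ord m))).2 _ (ev i)).
have lsD (m : 'I_k.+2) i s : 0 <= s -> s <= h -> D (l m i + s).
  move=> s0 sh; have [Dl Dlh] := lD m i.
  by apply: (Di _ _ Dl Dlh); apply/andP; split; lra.
(* The spectra lie in D and, after translation by h, again in D; as D is an interval, all
   translations by s in [0, h] are allowed. *)
have pos s : 0 <= s -> s <= h -> 0 <= L (fun y => f (y + s)).
  move=> s0 sh; rewrite -ler0c -LE.
  have fts := wtone_shift (s := s) (ltn0Sn k) ft.
  apply: (fts A B _ AB t t0 t1 tlt v) => r r01.
  split; first exact: (ABD r r01).1.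
  move=> z /(ABD r r01).2[Dz Dzh]; apply: (Di _ _ Dz Dzh).
  by apply/andP; split; lra.
have cvgL (T : Type) (G : set_system T) (FG : Filter G) (g : T -> R -> R) (g' : R -> R) :
    (forall (m : 'I_k.+2) i, g N (l m i) @[N --> G] --> g' (l m i)) ->
    L (g N) @[N --> G] --> L g'.
  move=> gg'; apply: (cvg_big add_continuous) => m _; apply: cvgMl_tmp.
  by apply: (cvg_big add_continuous) => i _; apply: cvgMl_tmp; exact: gg'.
have LB g1 g2 : L g1 - L g2 = L (fun y => g1 y - g2 y).
  rewrite /L -sumrB; apply: eq_bigr => m _; rewrite -mulrBr -sumrB.
  by congr (_ * _); apply: eq_bigr => i _; rewrite mulrBr.
have LZ a g : L g * a = L (fun y => g y * a).
  rewrite /L mulr_suml; apply: eq_bigr => m _; rewrite -mulrA mulr_suml.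
  by congr (_ * _); apply: eq_bigr => i _; rewrite mulrA.
rewrite /steklov -LZ -LB mulr_ge0 ?invr_ge0 ?(ltW h0) // subr_ge0.
pose phi s := L (fun y => F (y + s)).
have -> : L F = phi 0.
  by rewrite /phi; congr L; apply/funext => y; rewrite addr0.
rewrite -/(phi h); apply: right_derivative_le; first exact: ltW.
  move=> s s0 sh; apply: cvgL => m i.
  apply: (@continuous_comp _ _ _ (fun s => l m i + s) F).
    by apply: cvgD; [exact: cvg_cst|exact: cvg_id].
  exact/cF/lsD.
move=> s s0 sh eps eps0.
have limge0 : 0 <= L (fun y => f' (y + s)).
  have H : L (fun y => f (y + r)) @[r --> s^'+] --> L (fun y => f' (y + s)).
    apply: cvgL => m i.
    have := ff' _ (lsD m i s s0 (ltW sh)) => /cvgrPdist_le H.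
    apply/cvgrPdist_le => e e0; have [r r0 Hr] := near_right (H e e0).
    near=> z; apply: Hr.
    have : s < z by near: z; exact: nbhs_right_gt.
    have : z < s + r by near: z; apply: nbhs_right_lt; rewrite ltrDl.
    by move=> ? ?; apply/andP; split; lra.
  apply: (cvgr_to_ge H); near=> r; apply: pos.
    by rewrite (le_trans s0) // ltW //; near: r; exact: nbhs_right_gt.
  by near: r; exact: nbhs_right_le.
have H : L (fun y => steklov F e (y + s)) @[e --> 0^'+] --> L (fun y => f' (y + s)).
  by apply: cvgL => m i; apply/FF'/lsD => //; exact: ltW.
have Hlt : - eps < L (fun y => f' (y + s)) by lra.
have Hge := cvgr_ge _ H _ Hlt.
near=> e; have e0 : 0 < e by near: e; exact: nbhs_right_gt.
have : - eps <= L (fun y => steklov F e (y + s)) by near: e; exact: Hge.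
rewrite /steklov -LZ -LB ler_pdivlMr //.
have -> : L (fun y => F (y + s + e)) = phi (s + e).
  by rewrite /phi; congr L; apply/funext => y; rewrite addrA.
by rewrite -/(phi s); lra.
Unshelve. all: by end_near. Qed.

(** At fixed nodes a divided difference is a finite sum, so its sign survives the pointwise limit;
    for small h the nodes lie in the shrunken domain. *)
Lemma steklov_ktone D j f' F : open D ->
  (forall x, D x -> steklov F e x @[e --> 0^'+] --> f' x) ->
  (forall h, 0 < h -> ktone [set x | D x /\ D (x + h)] j (steklov F h)) ->
  ktone D j f'.
Proof.
move=> Do FF' Fh t tD tlt; have tinj := increasing_inj tlt.
rewrite ddE // big_mkord.
have H : \sum_(i < j.+1) ddcoef j t i * steklov F h (t i) @[h --> 0^'+] -->
    \sum_(i < j.+1) ddcoef j t i * f' (t i).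
  apply: (cvg_big add_continuous) => i _; apply: cvgMl_tmp.
  by apply/FF'/tD; exact: leq_ord.
have near_D : \forall h \near 0^'+, forall i, (i <= j)%N -> D (t i + h * 1).
  by apply: near_upto => i ik; exact: near_shift_open (tD _ ik).
apply: (cvgr_to_ge H); near=> h.
have h0 : 0 < h by near: h; exact: nbhs_right_gt.
rewrite -(big_mkord xpredT (fun i => ddcoef j t i * steklov F h (t i))) -ddE //.
apply: (Fh _ h0) => // i ik; split; first exact: tD.
by rewrite -[h]mulr1; move: i ik; near: h.
Unshelve. all: by end_near. Qed.

(** Tone of order 0 is nonnegativity, and [ktone_derive] climbs one order per antiderivative. *)
Lemma ktone_ge0_derive D j f : is_interval D ->
  (forall i x, (i < j)%N -> D x -> derivable (derive1n i f) x 1) ->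
  (forall x, D x -> 0 <= derive1n j f x) -> ktone D j f.
Proof.
move=> Di df f0.
suff H i : (i <= j)%N -> ktone D i (derive1n (j - i) f).
  by have := H j (leqnn j); rewrite subnn.
elim: i => [|i IH] ij; first by rewrite subn0 => t tD _; apply/f0/tD.
apply: ktone_derive => //; first by move=> x Dx; apply: df => //; lia.
rewrite -[derive1 _]/(derive1n (j - i.+1).+1 f) subnSK //.
by apply: IH; exact: ltnW.
Qed.

End Steklov.

(** * Scalar tonicity from smoothness, and smoothness of averages *)

Section Gain.
Context {R : realType}.
Local Open Scope complex_scope.
Implicit Types (D : set R) (f F : R -> R).

Lemma derive1n_continuous D N i f x : Cn_on D N f -> (i <= N)%N -> D x ->
  {for x, continuous (derive1n i f)}.
Proof.
move=> [df cf]; rewrite leq_eqVlt => /orP[/eqP ->|iN] Dx; first exact: cf.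
by apply: differentiable_continuous; apply/derivable1_diffP; exact: df.
Qed.

Lemma taylor_coef (c : nat -> R) m M i : (M + i <= m)%N ->
  (\poly_(j < m.+1) (c j / j`!%:R))^`(M)`_i = c (M + i)%N / i`!%:R.
Proof.
move=> Mi; rewrite coef_derivn coef_poly ltnS Mi -[LHS]mulr_natr -mulrA.
congr (_ * _); rewrite -(ffact_fact (leq_addr i M)) natrM addKn invfM.
by rewrite mulrAC mulVf ?mul1r // pnatr_eq0 -lt0n ffact_gt0 leq_addr.
Qed.

Lemma Cn_peano D m f (x : R) : open D -> Cn_on D m f -> D x ->
  peano f x (\poly_(j < m.+1) (derive1n j f x / j`!%:R)) m.
Proof.
move=> Do fC Dx; rewrite -[X in peano _ _ _ X]addn0.
have nD : nbhs x D by apply: open_nbhs_nbhs.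
apply: peano_iter.
- move=> i im; apply: filterS nD => z Dz; exact: fC.1.
- by move=> i im; rewrite horner_coef0 taylor_coef ?addn0 ?divr1 // ltnW.
have -> : (\poly_(j < m.+1) (derive1n j f x / j`!%:R))^`(m) = (derive1n m f x)%:P.
  apply/polyP => -[|i]; first by rewrite taylor_coef ?addn0 // coefC divr1.
  rewrite coefC /= coef_derivn coef_poly ltnS ifF ?mul0rn //.
  by apply/negbTE; rewrite -ltnNge; lia.
move=> eps eps0; have := derive1n_continuous fC (leqnn m) Dx.
move=> /cvgrPdist_le/(_ eps eps0)/nbhs_ballP[r /= r0 Hr].
apply/nbhs_ballP; exists r => // y; rewrite /ball /= sub0r normrN => yr.
rewrite hornerC expr0 mulr1 distrC; apply: Hr.
by rewrite /ball /= opprD addrCA subrr addr0 normrN.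
Qed.

Lemma Cn_sub D D' N f : D' `<=` D -> Cn_on D N f -> Cn_on D' N f.
Proof. by move=> DD' [df cf]; split=> *; [apply: df|apply: cf]; auto. Qed.

Lemma sum_coef_delta (p : {poly R}) k s :
  \sum_(0 <= q < size p) p`_(k + q) * (q == s)%:R = p`_(k + s).
Proof.
have [sp|ps] := ltnP s (size p).
  rewrite (bigD1_seq s) ?mem_index_iota ?iota_uniq //= big1 ?addr0.
    by rewrite eqxx mulr1.
  by move=> i /negbTE ->; rewrite mulr0.
rewrite nth_default; last by rewrite (leq_trans ps) // leq_addl.
rewrite big_nat big1 // => i /andP[_ iq]; rewrite ltn_eqF ?mulr0 //.
exact: leq_trans iq ps.
Qed.

(* The diagonal entries of the Hankel matrix are the derivatives of order
   k + 2l. *)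
Lemma hankel_ktone k n D f l : open D -> is_interval D ->
  wtone k.+1 n.+1 D f -> Cn_on D (2 * n + k.+1) f -> (l <= n)%N ->
  ktone D (k.+1 + 2 * l) f.
Proof.
move=> Do Di ft fC ln; set m := (2 * n + k.+1)%N in fC.
apply: ktone_ge0_derive => //; first by move=> i x im Dx; apply: fC.1 => //; lia.
move=> x Dx; pose p := \poly_(j < m.+1) (derive1n j f x / j`!%:R).
have fx : wtone k.+1 n.+1 [set y | D (y + x)] (fun y => f (y + x)).
  exact: wtone_shift.
have nD : nbhs (0 : R) [set y | D (y + x)].
  have : (fun y : R => y + x) y @[y --> (0 : R)] --> x.
    rewrite -[X in _ --> X]add0r; apply: cvgD; [exact: cvg_id|exact: cvg_cst].
  by apply; apply: open_nbhs_nbhs.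
(* For a basis vector the convolution square is concentrated at q = 2 l, which isolates one diagonal
   entry of the Hankel matrix. *)
pose mu a : R := (a == l)%:R.
have mu0 a : (n < a)%N -> mu a = 0.
  by rewrite /mu => na; rewrite gtn_eqF // (leq_ltn_trans ln).
have := wtone_hankel fx nD mu0 (Cn_peano Do fC Dx).
have E q : \sum_(0 <= i < q.+1) mu i * mu (q - i)%N = (q == 2 * l)%:R.
  have [lq|ql] := leqP l q.
    rewrite (bigD1_seq l) ?mem_index_iota ?iota_uniq //= big1 ?addr0.
      by rewrite /mu eqxx mul1r; congr (_%:R : R); congr (nat_of_bool _); lia.
    by move=> i /negbTE il; rewrite /mu il mul0r.
  rewrite big_nat big1 => [|i /andP[_ iq]]; last by rewrite /mu ltn_eqF ?mul0r //; lia.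
  by rewrite ltn_eqF //; lia.
under eq_bigr do rewrite E.
rewrite sum_coef_delta.
rewrite coef_poly ifT; last by rewrite /m; lia.
by rewrite pmulr_lge0 // invr_gt0 ltr0n fact_gt0.
Qed.

Lemma is_derive_steklov f F (h x : R) : h != 0 ->
  is_derive x 1 F (f x) -> is_derive (x + h) 1 F (f (x + h)) ->
  is_derive x 1 (steklov F h) (steklov f h x).
Proof.
move=> h0 Fx Fxh.
have -> : steklov F h = h^-1 \*: ((F \o (fun y => y + h)) - F).
  by apply/funext => y; rewrite /steklov /= mulrC.
rewrite /steklov mulrC; apply: is_deriveZ; apply: is_deriveB.
rewrite -[f (x + h)]mulr1; apply: is_derive1_comp.
by apply: is_derive_eq; rewrite addr0.
Qed.

(** Differentiating an average once replaces F by f: the derivative of order i + 1 is the difference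
    quotient with step h of the i-th derivative of f, continuous up to i = N. *)
Lemma steklov_Cn D N f F (h : R) : open D -> h != 0 ->
  (forall x, D x -> is_derive x 1 F (f x)) -> Cn_on D N f ->
  Cn_on [set x | D x /\ D (x + h)] N.+1 (steklov F h).
Proof.
move=> Do h0 dF fC.
have nD (x : R) : D x -> D (x + h) -> \forall y \near x, D y /\ D (y + h).
  move=> Dx Dxh.
  have : (fun y : R => y + h) y @[y --> x] --> x + h.
    by apply: cvgD; [exact: cvg_id|exact: cvg_cst].
  move=> H; apply: filterI; first exact: open_nbhs_nbhs.
  by apply: H; exact: open_nbhs_nbhs.
have dS i (x : R) : (i <= N)%N -> D x -> D (x + h) ->
    is_derive x 1 (derive1n i (steklov F h)) (steklov (derive1n i f) h x).
  elim: i x => [|i IH] x iN Dx Dxh.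
    by apply: is_derive_steklov => //; exact: dF.
  have E : \near x, steklov (derive1n i f) h x = derive1n i.+1 (steklov F h) x.
    near=> y; have [Dy Dyh] : D y /\ D (y + h) by near: y; exact: nD.
    rewrite -[RHS]/(derive1 (derive1n i (steklov F h)) y) derive1E.
    by have /@derive_val -> := IH y (ltnW iN) Dy Dyh.
  apply: near_eq_is_derive E _.
  have dfi z : D z -> is_derive z 1 (derive1n i f) (derive1n i.+1 f z).
    move=> Dz; rewrite -[derive1n i.+1 f z]/(derive1 (derive1n i f) z) derive1E.
    exact/derivableP/fC.1.
  by apply: is_derive_steklov h0 (dfi x Dx) (dfi _ Dxh).
split=> [i x iN [Dx Dxh]|x [Dx Dxh]].
  by have := dS i x iN Dx Dxh => ?; exact: ex_derive.
have E : \near x, steklov (derive1n N f) h x = derive1n N.+1 (steklov F h) x.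
  near=> y; have [Dy Dyh] : D y /\ D (y + h) by near: y; exact: nD.
  rewrite -[RHS]/(derive1 (derive1n N (steklov F h)) y) derive1E.
  by have /@derive_val -> := dS N y (leqnn N) Dy Dyh.
have cS : {for x, continuous (steklov (derive1n N f) h)}.
  apply: cvgMr_tmp; apply: cvgB; last exact: derive1n_continuous fC _ Dx.
  apply: (@continuous_comp _ _ _ (fun y => y + h) (derive1n N f)).
    by apply: cvgD; [exact: cvg_id|exact: cvg_cst].
  exact: derive1n_continuous fC _ Dxh.
suff H : derive1n N.+1 (steklov F h) y @[y --> x] --> derive1n N.+1 (steklov F h) x.
  exact: H.
rewrite -[X in _ --> X](nbhs_singleton E); apply: cvg_trans cS.
exact: near_eq_cvg.
Unshelve. all: by end_near. Qed.

End Gain.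

(** * Induction on smoothness *)

Section ToneGain.
Context {R : realType}.
Local Open Scope complex_scope.
Implicit Types (D : set R) (f F : R -> R).
Notation mu := (@lebesgue_measure R).

Lemma funcalc_scalar_eigenvalue n (s z : R) (v : 'cV[R[i]]_n.+1) :
  eigenvalue (s%:C%:M : 'M[R[i]]_n.+1) z%:C -> z = s.
Proof.
move=> /eigenvalueP[w ws w0]; move: ws; rewrite mul_mx_scalar => /eqP.
by rewrite -subr_eq0 -scalerBl scaler_eq0 (negbTE w0) orbF subr_eq0 => /eqP/complexI.
Qed.

(** Scalar matrices t_0 and t_(k+1) give the scalar divided difference, once the nodes are rescaled
    affinely to [0, 1]: the spectral measure at a unit vector has mass 1 and sits at the node. *)
Lemma wtone_ktone k n D f : is_interval D -> wtone k.+1 n.+1 D f ->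
  ktone D k.+1 f.
Proof.
move=> Di ft t tD tlt; have tinj := increasing_inj tlt.
pose l := t k.+1 - t 0%N.
have l0 : 0 < l by rewrite subr_gt0; exact: (increasing_lt tlt).
pose r i := (t i - t 0%N) / l.
have rE i : t i = t 0%N + l * r i.
  by rewrite /r mulrC divfK ?gt_eqF // addrC subrK.
pose S (s : R) : 'M[R[i]]_n.+1 := s%:C%:M.
have SE (s : R) : (1 - s%:C) *: S (t 0%N) + s%:C *: S (t k.+1) =
    S (t 0%N + l * s).
  rewrite /S !scale_scalar_mx -raddfD /= -[1]/(1%:C) -rmorphB -!rmorphM -rmorphD.
  by congr (_%:M); congr (_%:C); rewrite /l; ring.
have Sh s : S s \is hermsymmx.
  apply/hermsymmxP; rewrite tr_scalar_mx map_scalar_mx; congr (_%:M).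
  by rewrite [RHS]conjc_real.
have rlt i : (i < k.+1)%N -> r i < r i.+1.
  by move=> ik; rewrite ltr_pM2r ?invr_gt0 // ltrD2r tlt.
have r0 : r 0%N = 0 by rewrite /r subrr mul0r.
have r1 : r k.+1 = 1 by rewrite /r divff // gt_eqF.
have rinj := increasing_inj rlt.
have SD (s : R) : 0 <= s <= 1 ->
    herm_on D ((1 - s%:C) *: S (t 0%N) + s%:C *: S (t k.+1)).
  move=> /andP[s0 s1]; rewrite SE; split; first exact: Sh.
  move=> z ev; have zE := hermitian_eigenvalue_real (Sh _) ev.
  rewrite zE in ev; rewrite (funcalc_scalar_eigenvalue 0 ev).
  apply: (Di _ _ (tD 0%N isT) (tD k.+1 (leqnn _))).
  have h1 : 0 <= l * s by apply: mulr_ge0 => //; exact: ltW.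
  have h2 : 0 <= l * (1 - s) by apply: mulr_ge0; [exact: ltW|lra].
  by apply/andP; rewrite /l in h1 h2 *; split; lra.
have SP : psdmx (S (t k.+1) - S (t 0%N)).
  have -> : S (t k.+1) - S (t 0%N) = S l by rewrite /S -raddfB /= -rmorphB.
  split; first exact: Sh.
  move=> v; rewrite mul_mx_scalar -scalemxAl mxE.
  apply: mulr_ge0; first by rewrite ler0c; exact: ltW.
  rewrite mxE sumr_ge0 // => i _; rewrite !mxE; by rewrite mulrC mul_conjC_ge0.
pose v : 'cV[R[i]]_n.+1 := delta_mx ord0 ord0.
have := ft _ _ SD SP r r0 r1 rlt v.
have [c [lam [clP ->]]] := mx_divdiff_quad v (Sh (t 0%N)) (Sh (t k.+1)) rinj.
rewrite ler0c => H; rewrite ddE //.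
have lamE m i : lam m i = t m.
  have [_ ev _] := clP m; have := ev i; rewrite SE -rE.
  exact: funcalc_scalar_eigenvalue.
have c1 m : \sum_i c m i = 1.
  have [_ _ vv] := clP m; apply: complexI; rewrite -vv mxE (bigD1 ord0) //=.
  rewrite !mxE eqxx mulr1 conjC1 big1 ?addr0 // => i /negbTE i0.
  by rewrite !mxE i0 mulr0.
have -> : \sum_(0 <= i < k.+2) ddcoef k.+1 t i * f (t i) = l ^- k.+1 *
    \sum_(0 <= m < k.+2) ddcoef k.+1 r m * \sum_i c m i * f (lam m i).
  rewrite mulr_sumr; apply: eq_big_nat => m /andP[_ mk].
  under [X in _ = _ * (_ * X)]eq_bigr do rewrite lamE.
  rewrite -mulr_suml c1 mul1r mulrA; congr (_ * _).
  rewrite -(ddcoef_affine r (t 0%N) l (mk : (m <= k.+1)%N)); congr (ddcoef _ _ _).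
  by apply/funext => i; exact: rE.
by rewrite mulr_ge0 // invr_ge0 exprn_ge0 // ltW.
Qed.

Lemma increasing_segment D j t : open D ->
  (forall i, (i <= j)%N -> D (t i)) -> (forall i, (i < j)%N -> t i < t i.+1) ->
  exists a b, [/\ D a, D b & forall i, (i <= j)%N -> a < t i < b].
Proof.
move=> Do tD tlt.
have [e e0 De] := open_segment Do (tD _ (leq0n j)).
have [e' e'0 De'] := open_segment Do (tD _ (leqnn j)).
exists (t 0%N - e), (t j + e'); split.
- by apply: De; lra.
- by apply: De'; lra.
move=> i ij; apply/andP; split.
  case: i ij => [|i] ij; first by lra.
  by have := increasing_lt tlt (ltn0Sn i) ij; lra.
move: ij; rewrite leq_eqVlt => /orP[/eqP ->|ij]; first by lra.
by have := increasing_lt tlt ij (leqnn j); lra.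
Qed.

Lemma is_interval_shift D h : is_interval D ->
  is_interval [set x | D x /\ D (x + h)].
Proof.
move=> Di x y [Dx Dxh] [Dy Dyh] z /andP[xz zy]; split.
  by apply: (Di _ _ Dx Dy); rewrite xz.
by apply: (Di _ _ Dxh Dyh); rewrite !lerD2r xz.
Qed.

Lemma open_shift D h : open D -> open [set x | D x /\ D (x + h)].
Proof.
move=> Do; apply: openI => //; apply: open_comp => // x _.
by apply: cvgD; [exact: cvg_id|exact: cvg_cst].
Qed.

(* Each Steklov average gains one derivative, so that hankel_ktone applies
   after finitely many of them. *)
Lemma Cn_wtone_ktone k n d N D f l : (N + d = 2 * n + k.+1)%N -> (l <= n)%N ->
  open D -> is_interval D -> wtone k.+1 n.+1 D f -> Cn_on D N f ->
  ktone D (k.+1 + 2 * l) f.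
Proof.
move=> + ln; elim: d N D f => [|d IH] N D f.
  by rewrite addn0 => -> Do Di ft fC; apply: (@hankel_ktone _ k n).
rewrite addnS -addSn => Nd Do Di ft fC t tD tlt.
(* Only finitely many nodes matter at a time; on a compact segment around them f is integrable and
   has a primitive F. *)
have [a [b [Da Db tab]]] := increasing_segment Do tD tlt.
pose D' : set R := [set x | a < x < b].
have D'E : D' = [set` `]a, b[] by apply/seteqP; split => x; rewrite /= in_itv.
have D'o : open D' by rewrite D'E; exact: interval_open.
have D'i : is_interval D' by rewrite D'E; exact: interval_is_interval.
have abD x : a <= x <= b -> D x by move=> xab; exact: (Di _ _ Da Db).
have D'D : D' `<=` D by move=> x /andP[ax xb]; apply: abD; rewrite !ltW.
have cf x : D x -> {for x, continuous f} := @derive1n_continuous _ D N 0 f x fC isT.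
have intf : mu.-integrable `[a, b] (EFin \o f).
  apply: continuous_compact_integrable; first exact: segment_compact.
  apply: continuous_in_subspaceT => x; rewrite inE /= in_itv /= => xab.
  exact/cf/abD.
have [F fF] := primitive_exists intf.
have dF x : D' x -> is_derive x 1 F (f x).
  by move=> /andP[ax xb]; apply: (mean_bounds_derive fF ax xb); apply/cf/abD; rewrite !ltW.
suff H : ktone D' (k.+1 + 2 * l) f by apply: H => // i ij; exact: tab.
apply: (@steklov_ktone _ D' _ f F) => //.
  move=> x /andP[ax xb]; apply: (mean_bounds_right fF (ltW ax) xb).
  by apply: cvg_at_right_filter; apply/cf/abD; rewrite !ltW.
move=> h h0; apply: IH Nd _ _ _ _.
- exact: open_shift.
- exact: is_interval_shift.
- apply: (@wtone_steklov _ _ _ _ f f) => //.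
  + exact: wtone_sub D'D ft.
  + move=> x /D'D Dx; apply: cvg_at_right_filter; exact: cf.
  + move=> x /dF dFx; apply: differentiable_continuous; apply/derivable1_diffP.
    exact: ex_derive.
  + move=> x /andP[ax xb]; apply: (mean_bounds_right fF (ltW ax) xb).
    by apply: cvg_at_right_filter; apply/cf/abD; rewrite !ltW.
- apply: steklov_Cn => //; first by rewrite gt_eqF.
  exact: Cn_sub D'D fC.
Qed.

End ToneGain.

(** * Order one, and scalar tone orders in general *)

Section Monotone.
Context {R : realType}.
Implicit Types (D : set R) (f F : R -> R).
Notation mu := (@lebesgue_measure R).

Lemma eq_ktone D j f g : (forall x, D x -> f x = g x) ->
  ktone D j f -> ktone D j g.
Proof.
move=> fg fD t tD tlt; rewrite /dd -(@eq_divdiff _ _ (f : R -> R^o) _ j t) //.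
  exact: fD.
by move=> i ij; apply/fg/tD.
Qed.

Lemma ktone1_le D f x y : ktone D 1 f -> D x -> D y -> x <= y -> f x <= f y.
Proof.
move=> fD Dx Dy; rewrite le_eqVlt => /orP[/eqP ->//|xy].
have := fD (nth 0 [:: x; y]); rewrite ddS /dd /= => H.
have {H} : 0 <= (x - y)^-1 * (f x - f y) by apply: H => [[|[|//]]|[|//]].
by rewrite nmulr_rge0 ?subr_le0 // invr_lt0 subr_lt0.
Qed.

(** At first f is only nondecreasing. Its averages are continuous, so the induction on smoothness
    applies to them, and they tend to the right limit [f']. Thus [f'] has the tone orders claimed,
    is continuous, and this forces f = f'. *)
Lemma wtone1_ktone n D f l : (0 < n)%N -> (l <= n)%N ->
  open D -> is_interval D -> wtone 1 n.+1 D f -> ktone D (1 + 2 * l) f.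
Proof.
move=> n0 ln Do Di ft.
have fle x y := @ktone1_le D f x y (wtone_ktone Di ft).
pose f' x := lim (f y @[y --> x^'+]).
have f'P x : D x -> f y @[y --> x^'+] --> f' x.
  move=> Dx; have [e e0 De] := open_segment Do Dx.
  apply: nondecreasing_at_right_is_cvgr.
    near=> c => y z; rewrite !in_itv /= => /andP[xy yc] /andP[xz zc] yz.
    have cxe : c <= x + e by near: c; apply: nbhs_right_le; rewrite ltrDl.
    by apply: fle => //; apply: De; lra.
  near=> c; exists (f x) => z [y /=]; rewrite in_itv /= => /andP[xy yc] <-.
  have cxe : c <= x + e by near: c; apply: nbhs_right_le; rewrite ltrDl.
  by apply: fle => //; [apply: De; lra|exact: ltW].
have f'D l' : (l' <= n)%N -> ktone D (1 + 2 * l') f'.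
  move=> ln' t tD tlt.
  have [a [b [Da Db tab]]] := increasing_segment Do tD tlt.
  have ab : a < b by have := tab 0%N isT => /andP[]; exact: lt_trans.
  pose D' : set R := [set x | a < x < b].
  have D'E : D' = [set` `]a, b[] by apply/seteqP; split => x; rewrite /= in_itv.
  have D'o : open D' by rewrite D'E; exact: interval_open.
  have D'i : is_interval D' by rewrite D'E; exact: interval_is_interval.
  have abD x : a <= x <= b -> D x by move=> xab; exact: (Di _ _ Da Db).
  have D'D : D' `<=` D by move=> x /andP[ax xb]; apply: abD; rewrite !ltW.
  have fM x : a <= x <= b -> `|f x| <= `|f a| + `|f b|.
    move=> xab; have Dx := abD _ xab; case/andP: xab => ax xb.
    have h1 := fle _ _ Da Dx ax; have h2 := fle _ _ Dx Db xb.
    have := ler_norm (f b); have := ler_norm (- f a); rewrite normrN.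
    have := normr_ge0 (f a); have := normr_ge0 (f b).
    by rewrite ler_norml => ? ? ? ?; apply/andP; split; lra.
  have intf : mu.-integrable `[a, b] (EFin \o f).
    apply: measurable_bounded_integrable => //.
    - by rewrite /= lebesgue_measure_itv /= lte_fin ab -EFinB ltry.
    (* Clamping the argument to [a, b] makes f nondecreasing on the whole line, hence measurable. *)
    - pose g x := f (Num.min (Num.max x a) b).
      have clamp x : a <= Num.min (Num.max x a) b <= b.
        by rewrite le_min le_max lexx orbT (ltW ab) ge_min lexx orbT.
      apply: (eq_measurable_fun g).
        move=> x; rewrite inE /= in_itv /= => /andP[ax xb].
        by rewrite /g (max_idPl _) // (min_idPl _).
      apply: nondecreasing_measurable => //.
      move=> x y xy; apply: fle; try exact: abD.
      by rewrite le_min ge_min ge_min lexx orbT andbT; apply/orP; left;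
        rewrite ge_max !le_max xy lexx orbT.
    - exists (`|f a| + `|f b|); split; first exact: num_real.
      move=> M fabM x /=; rewrite in_itv /= => xab.
      exact: le_trans (fM x xab) (ltW fabM).
  have [F fF] := primitive_exists intf.
  have cF x : D' x -> {for x, continuous F}.
    by move=> /andP[ax xb]; exact: mean_bounds_continuous fF fM ax xb.
  have rF x : D' x -> steklov F e x @[e --> 0^'+] --> f' x.
    move=> /[dup] D'x /andP[ax xb]; apply: (mean_bounds_right fF (ltW ax) xb).
    exact/f'P/D'D.
  suff H : ktone D' (1 + 2 * l') f' by apply: H => // i ij; exact: tab.
  apply: (@steklov_ktone _ D' _ f' F) => // h h0.
  apply: (@Cn_wtone_ktone _ 0 n (2 * n + 1) 0) => //.
  - exact: open_shift.
  - exact: is_interval_shift.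
  - apply: (@wtone_steklov _ _ _ _ f f') => //; first exact: wtone_sub D'D ft.
    by move=> x /D'D; exact: f'P.
  split=> // x [D'x D'xh] /=.
  apply: cvgMr_tmp; apply: cvgB; last exact: cF.
  apply: (@continuous_comp _ _ _ (fun y => y + h) F).
    by apply: cvgD; [exact: cvg_id|exact: cvg_cst].
  exact: cF.
suff ff' x : D x -> f' x = f x by apply: (eq_ktone ff'); exact: f'D.
move=> Dx; have [e e0 De] := open_segment Do Dx.
(* Tone of order 3 is available because the matrices have size at least 2. Then f'(y) <= f(x) for y
   < x gives f'(x) <= f(x) by continuity, and the converse is monotonicity. *)
have f'x : {for x, continuous f'} by apply: ktone_continuous Do Di (f'D 1%N n0) Dx.
apply/eqP; rewrite eq_le; apply/andP; split.
  have H : f' y @[y --> x^'-] --> f' x by exact: cvg_at_left_filter.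
  apply: (cvgr_to_le H); near=> y.
  have yx : y < x by near: y; exact: nbhs_left_lt.
  have yxe : x - e <= y by near: y; apply: nbhs_left_ge; rewrite ltrBlDr ltrDl.
  have Dy : D y by apply: De; lra.
  apply: (cvgr_to_le (f'P _ Dy)); near=> z.
  have yz : y < z by near: z; exact: nbhs_right_gt.
  have zx : z <= x by near: z; exact: nbhs_right_le.
  by apply: fle => //; apply: De; lra.
apply: (cvgr_to_ge (f'P _ Dx)); near=> y.
have xy : x < y by near: y; exact: nbhs_right_gt.
have yxe : y <= x + e by near: y; apply: nbhs_right_le; rewrite ltrDl.
by apply: fle; [|apply: De; lra|exact: ltW].
Unshelve. all: by end_near. Qed.

(** The averaging must start from a continuous function. From order 2 on, scalar tonicity provides
    continuity; order 1 with size at least 2 is [wtone1_ktone], and with size 1 only l = 0 is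
    left. *)
Lemma matrix_tone_ktone k n D f l : open D -> is_interval D ->
  wtone k.+1 n.+1 D f -> (l <= n)%N -> ktone D (k.+1 + 2 * l) f.
Proof.
move=> Do Di ft ln; have f0 := wtone_ktone Di ft.
case: k ft f0 => [|k] ft f0.
  case: n ln ft => [|n] ln ft; last exact: wtone1_ktone ft.
  by move: ln; rewrite leqn0 => /eqP ->.
apply: (@Cn_wtone_ktone _ k.+1 n (2 * n + k.+2) 0) => //.
by split=> // x Dx; exact: ktone_continuous Do Di f0 Dx.
Qed.

End Monotone.

(** * Continuous extension of divided differences *)

Section Extension.
Context {R : realType}.
Implicit Types (D : set R) (f : R -> R) (y w : nat -> R).

(** Separates coincident nodes for all small s > 0. *)
Definition spread y (s : R) : nat -> R := fun l => y l + s * l%:R.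

Lemma near_spread_inj k y : \forall s \near 0^'+, inj_upto k (spread y s).
Proof.
have H : \forall s \near (0 : R)^'+, forall i, (i <= k)%N -> forall j, (j <= k)%N ->
    i != j -> y i + s * (i%:R - j%:R) != y j.
  apply: near_upto => i ik; apply: near_upto => j jk.
  have [->|ij] := eqVneq i j; first by near=> s.
  have : \forall s \near (0 : R)^'+, y i + s * (i%:R - j%:R) != y j.
    by apply: near_shift_neq; rewrite subr_eq0 eqr_nat.
  by apply: filterS.
near=> s => i j ik jk yij; apply/eqP; apply: contraT => ij.
have Hs : forall i, (i <= k)%N -> forall j, (j <= k)%N ->
    i != j -> y i + s * (i%:R - j%:R) != y j by near: s.
have := Hs i ik j jk ij; rewrite mulrBr addrA -/(spread y s i) yij /spread.
by rewrite addrK eqxx.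
Unshelve. all: by end_near. Qed.

(** Sliding gives the bound when the two families share no value. Otherwise the slide goes through a
    third family close to w, at a cost proportional to s. *)
Lemma dd_lipschitz D k f c d : open D -> is_interval D ->
  ddbounded D k.+1 f -> D c -> D d ->
  exists2 M : R, 0 <= M & forall y w, inj_upto k y -> inj_upto k w ->
    (forall i, (i <= k)%N -> c <= y i <= d) ->
    (forall i, (i <= k)%N -> c <= w i <= d) ->
    `|dd k f y - dd k f w| <= M * \sum_(0 <= i < k.+1) `|y i - w i|.
Proof.
move=> Do Di fb Dc Dd.
have [e e0 De] := open_segment Do Dd.
have Dd' : D (d + e) by apply: De; lra.
have [M fM] := fb _ _ Dc Dd'.
exists `|M| => // y w yinj winj ycd wcd.
have cross y' w' : inj_upto k y' -> inj_upto k w' ->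
    (forall i, (i <= k)%N -> c <= y' i <= d + e) ->
    (forall i, (i <= k)%N -> c <= w' i <= d + e) ->
    (forall i l, (i <= k)%N -> (l <= k)%N -> y' i != w' l) ->
    `|dd k f y' - dd k f w'| <= `|M| * \sum_(0 <= i < k.+1) `|y' i - w' i|.
  move=> y'inj w'inj y'cd w'cd y'w'.
  rewrite dd_slide; last by move=> j jk; exact: y'w'.
  rewrite (le_trans (ler_norm_sum _ _ _)) // mulr_sumr big_nat [leRHS]big_nat.
  apply: ler_sum => j /andP[_ jk]; rewrite normrM mulrC ler_wpM2r //.
  apply: le_trans (ler_norm M); apply: fM; first exact: inj_slide.
  by move=> i ik; apply: (@slide_prop _ (fun x => c <= x <= d + e)).
apply/ler_addgt0Pr => eps eps0.
pose S : R := \sum_(0 <= i < k.+1) i.+1%:R.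
have S0 : 0 <= S by apply: sumr_ge0.
(* The detour costs [|M| * (s * S)] twice. *)
pose B := `|M| * (2 * S) + 1.
have B0 : 0 < B by rewrite ltr_wpDl // !mulr_ge0.
(* The factor i + 1, unlike i, moves the first node too, so that [v s] avoids w as well as y. *)
pose v s i : R := w i + s * i.+1%:R.
have near_v : \forall s \near 0^'+, forall i, (i <= k)%N ->
    (v s i <= d + e) /\ forall j, (j <= k)%N ->
      [/\ v s i != y j, v s i != w j & i != j -> v s i != v s j].
  apply: near_upto => i ik; near=> s; have s0 : 0 < s by near: s; exact: nbhs_right_gt.
  split.
    have /andP[_ wd] := wcd i ik; rewrite /v lerD // -ler_pdivlMr //.
    by near: s; apply: nbhs_right_le; rewrite divr_gt0.
  near: s; apply: near_upto => j jk.
  have h1 : \forall s \near 0^'+, v s i != y j by exact: near_shift_neq.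
  have h2 : \forall s \near 0^'+, v s i != w j by exact: near_shift_neq.
  have [ij|ij] := eqVneq i j.
    by apply: filterS2 h1 h2 => s ? ?; split.
  have h3 : \forall s \near 0^'+, w i + s * (i.+1%:R - j.+1%:R) != w j.
    by apply: near_shift_neq; rewrite subr_eq0 eqr_nat eqSS.
  apply: filterS3 h1 h2 h3 => s ? ? h; split=> // _.
  apply: contra_neq h; rewrite mulrBr addrA -/(v s i) => ->.
  by rewrite /v addrK.
near (0 : R)^'+ => s.
have s0 : 0 < s by near: s; exact: nbhs_right_gt.
have sB : s <= eps / B by near: s; apply: nbhs_right_le; rewrite divr_gt0.
have vP : forall i, (i <= k)%N -> (v s i <= d + e) /\ forall j, (j <= k)%N ->
      [/\ v s i != y j, v s i != w j & i != j -> v s i != v s j] by near: s.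
have vinj : inj_upto k (v s).
  move=> i j ik jk vij; apply/eqP; apply: contraT => ij.
  by have [_ /(_ _ jk)[_ _ /(_ ij)]] := vP i ik; rewrite vij eqxx.
have vcd i : (i <= k)%N -> c <= v s i <= d + e.
  move=> ik; have [-> _] := vP i ik; rewrite andbT.
  by have /andP[cw _] := wcd i ik; rewrite /v (le_trans cw) // lerDl mulr_ge0 // ltW.
have cd' (u : nat -> R) : (forall i, (i <= k)%N -> c <= u i <= d) ->
    forall i, (i <= k)%N -> c <= u i <= d + e.
  by move=> ucd i ik; have /andP[-> ud] := ucd i ik; rewrite (le_trans ud) // lerDl ltW.
have h1 : `|dd k f y - dd k f (v s)| <= `|M| * \sum_(0 <= i < k.+1) `|y i - v s i|.
  apply: cross => //; first exact: cd'.
  by move=> i l ik lk; have [_ /(_ _ ik)[+ _ _]] := vP l lk; rewrite eq_sym.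
have h2 : `|dd k f (v s) - dd k f w| <= `|M| * \sum_(0 <= i < k.+1) `|v s i - w i|.
  apply: cross => //; first exact: cd'.
  by move=> i l ik lk; have [_ /(_ _ lk)[_ + _]] := vP i ik.
have h3 : \sum_(0 <= i < k.+1) `|v s i - w i| = s * S.
  rewrite mulr_sumr; apply: eq_bigr => i _.
  by rewrite /v addrAC subrr add0r ger0_norm // mulr_ge0 // ltW.
have h4 : \sum_(0 <= i < k.+1) `|y i - v s i| <=
    \sum_(0 <= i < k.+1) `|y i - w i| + s * S.
  rewrite -h3 -big_split; apply: ler_sum => i _ /=.
  by rewrite [`|v s i - _|]distrC ler_distD.
have h5 : s * B <= eps by rewrite -ler_pdivlMr.
have M0 := normr_ge0 M.
rewrite (le_trans (ler_distD (dd k f (v s)) _ _)) //.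
rewrite h3 in h2; move: h5; rewrite /B => h5.
have := ler_wpM2l M0 h4; nra.
Unshelve. all: by end_near. Qed.

(** The value at possibly coincident nodes, as a limit along one explicit separation; [dd_lipschitz]
    makes the limit exist. *)
Definition ddext (k : nat) f y : R := lim (dd k f (spread y s) @[s --> 0^'+]).

Lemma near_spread_sub k D y c d : open D -> (forall i, (i <= k)%N -> c < y i < d) ->
  \forall s \near 0^'+, forall i, (i <= k)%N -> c <= spread y s i <= d.
Proof.
move=> Do ycd; apply: near_upto => i ik; have /andP[cy yd] := ycd i ik.
near=> s; have s0 : 0 < s by near: s; exact: nbhs_right_gt.
apply/andP; split; first by rewrite (le_trans (ltW cy)) // lerDl mulr_ge0 // ltW.
have i1 : 0 < i.+1%:R :> R by rewrite ltr0n.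
have sd : s <= (d - y i) / i.+1%:R.
  by near: s; apply: nbhs_right_le; rewrite divr_gt0 // subr_gt0.
move: sd; rewrite ler_pdivlMr // /spread -natr1 => sd; lra.
Unshelve. all: by end_near. Qed.

Lemma in_segment D k y : open D -> is_interval D -> (forall i, (i <= k)%N -> D (y i)) ->
  exists c d, [/\ D c, D d & forall i, (i <= k)%N -> c < y i < d].
Proof.
move=> Do Di; elim: k => [|k IH] yD.
  have [e e0 De] := open_segment Do (yD _ (leqnn 0)).
  exists (y 0%N - e), (y 0%N + e); split; try (apply: De; lra).
  by move=> i; rewrite leqn0 => /eqP ->; lra.
have [c [d [Dc Dd ycd]]] := IH (fun i ik => yD i (leqW ik)).
have [e e0 De] := open_segment Do (yD _ (leqnn k.+1)).
have De1 : D (y k.+1 - e) by apply: De; lra.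
have De2 : D (y k.+1 + e) by apply: De; lra.
exists (Num.min c (y k.+1 - e)), (Num.max d (y k.+1 + e)); split.
- by rewrite minEle; case: ifP.
- by rewrite maxEle; case: ifP.
move=> i; rewrite leq_eqVlt gt_min lt_max => /orP[/eqP ->|ik].
  by apply/andP; split; apply/orP; right; lra.
by have /andP[-> ->] := ycd i ik.
Qed.

Lemma spread_dist k y w (s r : R) :
  \sum_(0 <= i < k.+1) `|spread y s i - spread w r i| <=
  \sum_(0 <= i < k.+1) `|y i - w i| + `|s - r| * \sum_(0 <= i < k.+1) i%:R.
Proof.
rewrite mulr_sumr -big_split /=; apply: ler_sum => i _.
rewrite /spread opprD addrACA -mulrBl (le_trans (ler_normD _ _)) //.
by rewrite lerD2l normrM normr_nat.
Qed.

Lemma ddext_cvg D k f y : open D -> is_interval D -> ddbounded D k.+1 f ->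
  (forall i, (i <= k)%N -> D (y i)) ->
  dd k f (spread y s) @[s --> 0^'+] --> ddext k f y.
Proof.
move=> Do Di fb yD; have [c [d [Dc Dd ycd]]] := in_segment Do Di yD.
have [M M0 fM] := dd_lipschitz Do Di fb Dc Dd.
apply/cauchy_cvgP/cauchy_exP => eps eps0 /=.
pose S : R := \sum_(0 <= i < k.+1) i%:R.
have S0 : 0 <= S by apply: sumr_ge0.
have B0 : 0 < M * S + 1 by rewrite ltr_wpDl // mulr_ge0.
have n1 := near_spread_inj k y.
have n2 := near_spread_sub Do ycd.
near (0 : R)^'+ => r.
have r0 : 0 < r by near: r; exact: nbhs_right_gt.
have rE : r < eps / (M * S + 1) by near: r; apply: nbhs_right_lt; rewrite divr_gt0.
have rinj : inj_upto k (spread y r) by near: r.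
have rcd : forall i, (i <= k)%N -> c <= spread y r i <= d by near: r.
exists (dd k f (spread y r)); near=> s.
have s0 : 0 < s by near: s; exact: nbhs_right_gt.
have sr : s < r by near: s; exact: nbhs_right_lt.
have sinj : inj_upto k (spread y s) by near: s.
have scd : forall i, (i <= k)%N -> c <= spread y s i <= d by near: s.
rewrite /ball /=; apply: le_lt_trans (fM _ _ rinj sinj rcd scd) _.
apply: le_lt_trans (ler_wpM2l M0 (spread_dist _ _ _ _ _)) _.
rewrite [X in X + _]big1; last by move=> i _; rewrite subrr normr0.
rewrite add0r -/S gtr0_norm ?subr_gt0 //.
move: rE; rewrite ltr_pdivlMr // => rE.
have : M * S * (r - s) <= M * S * r by rewrite ler_wpM2l ?mulr_ge0 //; lra.
by nra.
Unshelve. all: by end_near. Qed.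

Lemma ddext_lipschitz D k f c d : open D -> is_interval D ->
  ddbounded D k.+1 f -> D c -> D d ->
  exists2 M : R, 0 <= M & forall y w,
    (forall i, (i <= k)%N -> c < y i < d) ->
    (forall i, (i <= k)%N -> c < w i < d) ->
    `|ddext k f y - ddext k f w| <= M * \sum_(0 <= i < k.+1) `|y i - w i|.
Proof.
move=> Do Di fb Dc Dd; have [M M0 fM] := dd_lipschitz Do Di fb Dc Dd.
exists M => // y w ycd wcd.
have cdD (u : nat -> R) : (forall i, (i <= k)%N -> c < u i < d) ->
    forall i, (i <= k)%N -> D (u i).
  by move=> ucd i ik; apply: (Di _ _ Dc Dd); have /andP[? ?] := ucd i ik; rewrite !ltW.
have H : `|dd k f (spread y s) - dd k f (spread w s)| @[s --> 0^'+] -->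
    `|ddext k f y - ddext k f w|.
  by apply: cvg_norm; apply: cvgB; apply: (ddext_cvg Do Di fb); exact: cdD.
have n1 := near_spread_inj k y; have n2 := near_spread_sub Do ycd.
have n3 := near_spread_inj k w; have n4 := near_spread_sub Do wcd.
apply: (cvgr_to_le H); near=> s.
have h1 : inj_upto k (spread y s) by near: s.
have h2 : inj_upto k (spread w s) by near: s.
apply: le_trans (fM _ _ h1 h2 _ _) _; try by near: s.
rewrite ler_wpM2l // (le_trans (spread_dist _ _ _ _ _)) //.
by rewrite subrr normr0 mul0r addr0.
Unshelve. all: by end_near. Qed.

Lemma ddext_inj D k f y : open D -> is_interval D -> ddbounded D k.+1 f ->
  (forall i, (i <= k)%N -> D (y i)) -> inj_upto k y -> ddext k f y = dd k f y.
Proof.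
move=> Do Di fb yD yinj; have [c [d [Dc Dd ycd]]] := in_segment Do Di yD.
have [M M0 fM] := dd_lipschitz Do Di fb Dc Dd.
apply: cvg_lim => //; apply/cvgrPdist_le => eps eps0.
pose S : R := \sum_(0 <= i < k.+1) i%:R.
have S0 : 0 <= S by apply: sumr_ge0.
have B0 : 0 < M * S + 1 by rewrite ltr_wpDl // mulr_ge0.
have n1 := near_spread_inj k y; have n2 := near_spread_sub Do ycd.
near=> s; have s0 : 0 < s by near: s; exact: nbhs_right_gt.
have sE : s < eps / (M * S + 1) by near: s; apply: nbhs_right_lt; rewrite divr_gt0.
have sinj : inj_upto k (spread y s) by near: s.
have scd : forall i, (i <= k)%N -> c <= spread y s i <= d by near: s.
have ycd' i : (i <= k)%N -> c <= y i <= d.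
  by move=> ik; have /andP[? ?] := ycd i ik; rewrite !ltW.
apply: le_trans (fM _ _ yinj sinj ycd' scd) _.
have -> : \sum_(0 <= i < k.+1) `|y i - spread y s i| = s * S.
  rewrite mulr_sumr; apply: eq_bigr => i _.
  by rewrite /spread opprD addrA subrr sub0r normrN ger0_norm // mulr_ge0 // ltW.
by move: sE; rewrite ltr_pdivlMr // => sE; nra.
Unshelve. all: by end_near. Qed.

Lemma ddext_continuous D k f : open D -> is_interval D -> ddbounded D k.+1 f ->
  {within [set y : 'rV[R]_k.+1 | forall l, D (y ord0 l)],
    continuous (fun y : 'rV[R]_k.+1 => ddext k f (fun l => y ord0 (inord l)))}.
Proof.
move=> Do Di fb; apply: continuous_in_subspaceT => y; rewrite inE /= => yD.
have yD' i : (i <= k)%N -> D (y ord0 (inord i)) by move=> _; exact: yD.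
have [c [d [Dc Dd ycd]]] := in_segment Do Di yD'.
have [M M0 fM] := ddext_lipschitz Do Di fb Dc Dd.
suff H : forall eps : R, 0 < eps -> nbhs y (fun z : 'rV[R]_k.+1 =>
    `|ddext k f (fun l => y ord0 (inord l)) -
      ddext k f (fun l => z ord0 (inord l))| <= eps).
  by apply/(@cvgrPdist_le _ _ _ (nbhs y) (nbhs_filter y)) => eps; exact: H.
move=> eps eps0.
have B0 : 0 < M * k.+1%:R + 1 by rewrite ltr_wpDl // mulr_ge0.
have near_cd i : (i <= k)%N -> \forall r \near (0 : R)^'+,
    r < y ord0 (inord i) - c /\ r < d - y ord0 (inord i).
  move=> ik; have /andP[? ?] := ycd i ik; near=> r.
  by split; near: r; apply: nbhs_right_lt; rewrite subr_gt0.
have near_all := near_upto near_cd.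
near (0 : R)^'+ => r.
have r0 : 0 < r by near: r; exact: nbhs_right_gt.
have rE : r <= eps / (M * k.+1%:R + 1).
  by near: r; apply: nbhs_right_le; rewrite divr_gt0.
have rcd : forall i, (i <= k)%N -> r < y ord0 (inord i) - c /\ r < d - y ord0 (inord i).
  by near: r; exact: near_all.
apply/nbhs_ballP; exists r => // z yz.
have dist i : `|y ord0 (inord i) - z ord0 (inord i)| < r.
  by have [_] := yz; apply.
have zcd i : (i <= k)%N -> c < z ord0 (inord i) < d.
  move=> ik; have [? ?] := rcd i ik; have := dist i; rewrite ltr_norml.
  by move=> /andP[? ?]; apply/andP; split; lra.
apply: le_trans (fM _ _ ycd zcd) _.
apply: (@le_trans _ _ (M * (r * k.+1%:R))).
  rewrite ler_wpM2l //; apply: (@le_trans _ _ (\sum_(0 <= i < k.+1) r)).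
    by apply: ler_sum => i _; apply: ltW; exact: dist.
  by rewrite sumr_const_nat subn0 mulr_natr.
move: rE; rewrite ler_pdivlMr // => rE.
have := ltW r0; nra.
Unshelve. all: by end_near. Qed.

End Extension.

(** * The matrix of divided differences *)

Section Confluent.
Context {R : realType}.
Implicit Types (f : R -> R) (t z : nat -> R) (p : {poly R}).

(** Chinese remaindering: a single p must match prescribed Taylor polynomials at all the points. *)
Lemma hermite_interpolation (s : seq R) (T : R -> {poly R}) N :
  exists p, forall x, x \in s -> ('X - x%:P) ^+ N %| p - T x.
Proof.
elim: s => [|x s [p pT]]; first by exists 0.
have [xs|xs] := boolP (x \in s).
  by exists p => y; rewrite inE => /orP[/eqP ->|]; exact: pT.
pose Q := \prod_(y <- s) ('X - y%:P) ^+ N.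
have QP y : y \in s -> ('X - y%:P) ^+ N %| Q.
  by move=> ys; rewrite /Q (big_rem y ys) /= dvdp_mulIl.
have : coprimep Q (('X - x%:P) ^+ N).
  rewrite /Q big_seq; elim/big_ind: _ => [|q1 q2 h1 h2|y ys].
  - exact: coprime1p.
  - by rewrite coprimepMl h1.
  - apply/coprimep_expl/coprimep_expr; rewrite coprimep_XsubC root_XsubC.
    by apply: contra xs => /eqP ->.
move=> /Bezout_eq1_coprimepP[[u v] /= uv].
(* By the Bezout identity, u Q is 0 modulo the previous moduli and 1 modulo the new one. *)
exists (p + u * (T x - p) * Q) => y; rewrite inE => /orP[/eqP ->|ys].
  have -> : p + u * (T x - p) * Q - T x = v * (p - T x) * ('X - x%:P) ^+ N.
    have -> : p + u * (T x - p) * Q - T x = (u * Q - 1) * (T x - p).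
      by move: (T x) => q; ring.
    by rewrite -uv opprD addrA subrr sub0r; move: (T x) (('X - x%:P) ^+ N) => q X; ring.
  by rewrite dvdp_mulIr.
by rewrite addrAC dvdp_addr ?pT // dvdp_mull // QP.
Qed.

(* The complete homogeneous symmetric polynomial of degree m - k in
   z_0, ..., z_k, which is the divided difference of order k of x^m. *)
Fixpoint hsym (k m : nat) z : R :=
  if m is m'.+1 then
    z 0%N * hsym k m' z +
    (if k is k'.+1 then hsym k' m' (fun l => z l.+1) else 0)
  else (k == 0)%:R.

Lemma hsym_lt k m z : (m < k)%N -> hsym k m z = 0.
Proof.
elim: m k z => [|m IH] [|k] z //= mk.
by rewrite !IH ?mulr0 ?addr0 // ltnW.
Qed.

Lemma hsym_diag k z : hsym k k z = 1.
Proof. by elim: k z => [|k IH] z //=; rewrite hsym_lt // mulr0 add0r. Qed.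

Lemma hsym_zero k m z : (forall l, z l = 0) -> (k < m)%N -> hsym k m z = 0.
Proof.
elim: m k z => [|m IH] [|k] z //= z0 km; rewrite z0 mul0r add0r //.
by apply: IH.
Qed.

Lemma hsym_expr k q z : (forall l, z l.+1 = 0) -> hsym k (k + q) z = z 0%N ^+ q.
Proof.
move=> z0; elim: q => [|q IH]; first by rewrite addn0 hsym_diag.
rewrite addnS /= IH exprS; case: k IH => [|k] _; rewrite ?addr0 //.
by rewrite hsym_zero ?addr0 // addSn ltnS leq_addr.
Qed.

(** After translating x_1 to 0, the nodes in (c) are x_i, x_j and zeros; what is left is the
    two-variable sum that occurs in [wtone_loewner]. *)
Lemma hsym_sum k q z : (forall l, z l.+2 = 0) ->
  hsym k.+1 (k.+1 + q) z = \sum_(0 <= i < q.+1) z 0%N ^+ i * z 1%N ^+ (q - i).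
Proof.
move=> z0; elim: q => [|q IH].
  by rewrite addn0 hsym_diag big_nat1 mul1r.
rewrite addnS.
have -> : hsym k.+1 (k.+1 + q).+1 z = z 0%N * hsym k.+1 (k.+1 + q) z +
    hsym k (k.+1 + q) (fun l => z l.+1) by [].
rewrite IH addSnnS hsym_expr //.
rewrite [RHS]big_nat_recl // mul1r subn0 addrC; congr (_ + _).
by rewrite mulr_sumr; apply: eq_bigr => i _; rewrite mulrA -exprS.
Qed.

(** The Leibniz rule for x^(m+1) = x x^m is the recursion of [hsym], and it passes to the limit even
    when the limit nodes coincide. *)
Lemma dd_expr_cvg T (F : set_system T) {FF : ProperFilter F} k m
    (t : T -> nat -> R) z :
  (forall l, t s l @[s --> F] --> z l) ->
  (\forall s \near F, inj_upto k (t s)) ->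
  dd k (fun x => x ^+ m) (t s) @[s --> F] --> hsym k m z.
Proof.
elim: m k t z => [|m IH] k t z tz tinj.
  apply: cvg_trans (_ : (cst ((k == 0)%:R : R)) s @[s --> F] --> _);
    last exact: cvg_cst.
  apply: near_eq_cvg; case: k tinj => [|k] tinj; near=> s.
    by rewrite /dd /= expr0.
  have e : dd k.+1 (fun=> 1) (t s) = 0 by apply: dd_cst; near: s.
  by rewrite -[LHS]e; apply: eq_divdiff.
case: k tinj => [|k] tinj /=.
  rewrite addr0; have := IH 0%N t z tz tinj; rewrite /dd /= => h.
  rewrite (_ : (fun s => _) = (fun s => t s 0%N * t s 0%N ^+ m)); last first.
    by apply/funext => s; rewrite exprS.
  exact: cvgM.
apply: cvg_trans (_ : (t s 0%N * dd k.+1 (fun x => x ^+ m) (t s) +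
   dd k (fun x => x ^+ m) (fun l => t s l.+1)) @[s --> F] --> _); last first.
  apply: cvgD; first by apply: cvgM => //; exact: IH.
  apply: (IH k (fun s l => t s l.+1)) => //.
  by apply: filterS tinj => s; exact: inj_uptoS.
apply: near_eq_cvg; near=> s.
have tsinj : inj_upto k.+1 (t s) by near: s.
have e := @divdiff_affineM _ (R^o) 0 1 (fun x : R => (x ^+ m : R^o)) k _ tsinj.
rewrite {1}/dd (_ : (fun x : R => x ^+ m.+1) =
    fun x : R => (0 + x *: (1 : R^o)) * x ^+ m).
  by rewrite [RHS]e add0r mul1r /GRing.scale /= mulr1.
by apply/funext => x; rewrite add0r exprS /GRing.scale /= mulr1.
Unshelve. all: by end_near. Qed.


Lemma dd_poly k p t : inj_upto k t ->
  dd k (fun x => p.[x]) t =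
  \sum_(0 <= m < size p) p`_m * dd k (fun x => x ^+ m) t.
Proof.
move=> tinj; rewrite ddE //.
under eq_bigr do rewrite horner_coef big_distrr /=.
rewrite exchange_big /= big_mkord; apply: eq_bigr => m _.
rewrite ddE // big_distrr /=; apply: eq_bigr => i _.
by rewrite mulrCA.
Qed.

(** For small s the spread nodes are at least s apart, whether or not their limits coincide, so the
    weights are at most s^-k; the remainder at the l-th node is o((s l)^k), and the powers of s
    cancel. *)
Lemma dd_remainder_cvg k (r : R -> R) z :
  (forall l, (l <= k)%N -> forall eps : R, 0 < eps ->
     \forall y \near z l, `|r y| <= eps * `|y - z l| ^+ k) ->
  dd k r (spread z s) @[s --> 0^'+] --> (0 : R).
Proof.
move=> rz; apply/cvgr0Pnorm_le => eps eps0.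
pose C : R := k.+1%:R * k%:R ^+ k + 1.
have C0 : 0 < C by rewrite ltr_wpDl // mulr_ge0 ?exprn_ge0.
have near_r : \forall s \near (0 : R)^'+, forall l, (l <= k)%N ->
    `|r (spread z s l)| <= eps / C * (s * l%:R) ^+ k.
  apply: near_upto => l lk.
  have /nbhs_ballP[d /= d0 dr] := rz l lk (eps / C) (divr_gt0 eps0 C0).
  near=> s; have s0 : 0 < s by near: s; exact: nbhs_right_gt.
  have sl0 : 0 <= s * l%:R by rewrite mulr_ge0 // ltW.
  have := dr (spread z s l); rewrite /ball /= /spread distrC addrC addKr.
  rewrite ger0_norm //; apply.
  have l1 : 0 < l.+1%:R :> R by rewrite ltr0n.
  have : s < d / l.+1%:R by near: s; apply: nbhs_right_lt; rewrite divr_gt0.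
  by rewrite ltr_pdivlMr // -natr1; lra.
have near_d : \forall s \near (0 : R)^'+, forall i, (i <= k)%N ->
    forall j, (j <= k)%N -> i != j -> s <= `|spread z s i - spread z s j|.
  apply: near_upto => i ik; apply: near_upto => j jk.
  have [->|ij] := eqVneq i j; first by near=> s.
  have n1 : 1 <= `|i%:R - j%:R| :> R.
    have : (1 <= `|i%:Z - j%:Z|)%R by lia.
    by rewrite -(ler_int R) intr_norm rmorphB.
  have [zij|zij] := eqVneq (z i) (z j).
    near=> s => _; have s0 : 0 < s by near: s; exact: nbhs_right_gt.
    rewrite /spread zij opprD addrACA subrr add0r -mulrBr normrM gtr0_norm //.
    by rewrite ler_peMr // ltW.
  have zd : 0 < `|z i - z j| by rewrite normr_gt0 subr_eq0.
  pose M : R := `|i%:R - j%:R|.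
  have M0 : 0 < 1 + M by rewrite ltr_pwDl // normr_ge0.
  near=> s => _; have s0 : 0 < s by near: s; exact: nbhs_right_gt.
  have : s <= `|z i - z j| / (1 + M).
    by near: s; apply: nbhs_right_le; rewrite divr_gt0.
  rewrite ler_pdivlMr // /spread => sM.
  have -> : z i + s * i%:R - (z j + s * j%:R) = (z i - z j) + s * (i%:R - j%:R).
    by ring.
  have := lerB_normD (z i - z j) (s * (i%:R - j%:R)).
  by rewrite normrM (gtr0_norm s0) -/M; lra.
have near_inj := near_spread_inj k z.
near=> s; have s0 : 0 < s by near: s; exact: nbhs_right_gt.
have sr : forall l, (l <= k)%N ->
    `|r (spread z s l)| <= eps / C * (s * l%:R) ^+ k by near: s.
have sd : forall i, (i <= k)%N -> forall j, (j <= k)%N -> i != j ->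
  s <= `|spread z s i - spread z s j| by near: s.
rewrite ddE; last by near: s.
apply: le_trans (_ : \sum_(0 <= i < k.+1) eps / C * k%:R ^+ k <= _); last first.
  rewrite sumr_const_nat subn0 -[leLHS]mulr_natr -mulrA [k%:R ^+ k * _]mulrC.
  by rewrite mulrAC ler_pdivrMr // ler_pM2l // /C lerDl.
rewrite (le_trans (ler_norm_sum _ _ _)) // big_nat [leRHS]big_nat.
apply: ler_sum => i /andP[_ ik]; rewrite normrM.
have coefs : `|ddcoef k (spread z s) i| <= s ^- k.
  have le_prod : s ^+ k <=
      `|\prod_(0 <= j < k.+1) (if j == i then 1 else spread z s i - spread z s j)|.
    rewrite -(@prod_except R k s i ik) normr_prod big_nat [leRHS]big_nat.
    apply: ler_prod => j /andP[_ jk]; have [_|ji] := eqVneq j i.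
      by rewrite normr1 ler01 lexx.
    by rewrite (ltW s0) /= sd // eq_sym.
  rewrite /ddcoef normfV lef_pV2 ?posrE ?exprn_gt0 //.
  by apply: lt_le_trans le_prod; rewrite exprn_gt0.
apply: le_trans (ler_pM _ _ coefs (sr i ik)) _; rewrite ?normr_ge0 //.
rewrite exprMn mulrCA; apply: ler_wpM2l; first by rewrite divr_ge0 ?ltW.
rewrite mulKf ?expf_neq0 ?gt_eqF // lerXn2r ?nnegrE //.
by rewrite ler_nat.
Unshelve. all: by end_near. Qed.

Lemma ddext_sum k f p z :
  (forall l, (l <= k)%N -> forall eps : R, 0 < eps ->
     \forall y \near z l, `|f y - p.[y]| <= eps * `|y - z l| ^+ k) ->
  ddext k f z = \sum_(0 <= m < size p) p`_m * hsym k m z.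
Proof.
move=> fp; apply: cvg_lim => //.
have zs l : spread z s l @[s --> 0^'+] --> z l.
  rewrite -[X in _ --> X]addr0; apply: cvgD; first exact: cvg_cst.
  rewrite -[X in _ --> X](mul0r (l%:R : R)); apply: cvgMr_tmp.
  by apply: cvg_at_right_filter; exact: cvg_id.
have near_inj := near_spread_inj k z.
rewrite -[X in _ --> X]addr0.
apply: cvg_trans (_ : (\sum_(0 <= m < size p) p`_m * dd k (fun x => x ^+ m) (spread z s) +
   dd k (fun x => f x - p.[x]) (spread z s)) @[s --> 0^'+] --> _); last first.
  apply: cvgD; last exact: dd_remainder_cvg.
  apply: cvg_big => [|m _]; first exact: add_continuous.
  apply: cvgMl_tmp.
  exact: dd_expr_cvg.
apply: near_eq_cvg; near=> s.
have sinj : inj_upto k (spread z s) by near: s.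
rewrite -dd_poly // !ddE // -big_split /=; apply: eq_bigr => i _.
by rewrite -mulrDr addrC subrK.
Unshelve. all: by end_near. Qed.

End Confluent.

(** * The matrix in (c) as a Loewner form *)

Section Loewner.
Context {R : realType}.
Implicit Types (D : set R) (f : R -> R).

Lemma eq_ddext k f y z : (forall l, (l <= k)%N -> y l = z l) ->
  ddext k f y = ddext k f z.
Proof.
move=> yz; rewrite /ddext; suff -> : (fun s => dd k f (spread y s)) =
  (fun s => dd k f (spread z s)) by [].
by apply/funext => s; apply: (@eq_divdiff _ (R^o)) => // i ik; rewrite /spread yz.
Qed.

Lemma ddext_shift k f (c : R) y :
  ddext k (fun x => f (x + c)) y = ddext k f (fun l => y l + c).
Proof.
rewrite /ddext; suff -> : (fun s => dd k (fun x => f (x + c)) (spread y s)) =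
  (fun s => dd k f (spread (fun l => y l + c) s)) by [].
apply/funext => s.
rewrite /dd (@divdiff_shift _ (R^o)); apply: (@eq_divdiff _ (R^o)) => [i _|//].
by rewrite /spread addrAC.
Qed.

(** The same polynomial p expresses the confluent divided differences, through [ddext_sum], and the
    nonnegative form of [wtone_loewner]. The default value [x ord0] of [nth] supplies the repeated
    argument x_1. *)
Lemma ddext_loewner k n D f (x : 'I_n.+2 -> R)
    (G := fun i j => ddext k.+1 f (nth (x ord0) [:: x i; x j])) :
  open D -> is_interval D -> wtone k.+1 n.+2 D f -> (forall i, D (x i)) ->
  (forall i j, G i j = G j i) /\
  forall w : 'I_n.+2 -> R, 0 <= \sum_i \sum_j w i * w j * G i j.
Proof.
move=> Do Di ft xD; pose c := x ord0; pose y i := x i - c.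
have yc i : y i + c = x i by rewrite subrK.
(* Taking l = 1 gives tone of order k + 3, hence class C^(k+1). *)
have fC : Cn_on D k.+1 f.
  by apply: ktone_Cn => //; have := @matrix_tone_ktone _ k n.+1 D f 1 Do Di ft isT;
     rewrite muln1 addn2.
pose taylor (v : R) := \poly_(j < k.+2) (derive1n j f (v + c) / j`!%:R).
(* Contact of order k + 2 makes p differ from each Taylor polynomial by O(|v - y_i|^(k+2)),
   negligible against |v - y_i|^(k+1). *)
have [p pT] := hermite_interpolation [seq y i | i <- enum 'I_n.+2]
   (fun v => taylor v \Po ('X - v%:P)) k.+2.
pose f0 v := f (v + c).
have fp i (eps : R) : 0 < eps ->
    \forall v \near y i, `|f0 v - p.[v]| <= eps * `|v - y i| ^+ k.+1.
  move=> eps0; have e2 : 0 < eps / 2 by rewrite divr_gt0.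
  have yin : y i \in [seq y i | i <- enum 'I_n.+2] by rewrite map_f // mem_enum.
  have /dvdpP[q qE] := pT _ yin.
  have h1 : \forall v \near y i,
      `|f (v - y i + x i) - (taylor (y i)).[v - y i]| <= eps / 2 * `|v - y i| ^+ k.+1.
    have h0 := @Cn_peano _ D k.+1 f (x i) Do fC (xD i) _ e2.
    have : v - y i @[v --> y i] --> (0 : R).
      by rewrite -[X in _ --> X](subrr (y i)); apply: cvgB; [exact: cvg_id|exact: cvg_cst].
    by move=> /(_ _ h0); rewrite /= /taylor yc.
  have h2 : \forall v \near y i, `|q.[v] * (v - y i)| <= eps / 2.
    have : q.[v] * (v - y i) @[v --> y i] --> q.[y i] * (y i - y i).
      apply: cvgM; first exact: continuous_horner.
      by apply: cvgB; [exact: cvg_id|exact: cvg_cst].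
    rewrite subrr mulr0.
    by move=> /cvgr0Pnorm_le; apply.
  apply: filterS2 h1 h2 => v h1 h2.
  have pE : p.[v] = (taylor (y i)).[v - y i] + q.[v] * (v - y i) ^+ k.+2.
    have := congr1 (fun P => P.[v]) qE.
    rewrite /= hornerD hornerN horner_comp hornerM horner_exp !hornerXsubC.
    by move=> <-; rewrite addrC subrK.
  rewrite pE opprD addrA (le_trans (ler_normB _ _)) //.
  rewrite [eps]splitr mulrDl; apply: lerD.
    by move: h1; rewrite -yc addrA subrK.
  by rewrite exprS mulrA normrM normrX ler_wpM2r // exprn_ge0.
have nD i : nbhs (y i) [set v | D (v + c)].
  have : nbhs (x i) D by move: Do; rewrite openE; exact.
  have h : v + c @[v --> y i] --> x i.
    by rewrite -[X in _ --> X]yc; apply: cvgD; [exact: cvg_id|exact: cvg_cst].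
  by move=> /h.
have f0t : wtone k.+1 n.+2 [set v | D (v + c)] f0 by exact: wtone_shift.
have y0 : y ord0 = 0 by rewrite /y subrr.
have hE i j : G i j =
    \sum_(0 <= q < size p) p`_(k.+1 + q) *
      \sum_(0 <= a < q.+1) y i ^+ a * y j ^+ (q - a).
  rewrite /G; have -> : nth c [:: x i; x j] = (fun l => nth 0 [:: y i; y j] l + c).
    by apply/funext => -[|[|l]] /=; rewrite ?yc // nth_nil nth_nil add0r.
  rewrite -ddext_shift (@ddext_sum _ k.+1 f0 p); last first.
    move=> [|[|l]] _; [exact: fp|exact: fp|].
    by rewrite [nth _ _ _]nth_nil => eps; have := fp ord0 eps; rewrite y0.
  rewrite big_mkord (@sum_coef_shift _ p k (fun m => hsym k.+1 m (nth 0 [:: y i; y j]))); last by move=> m mk; exact: hsym_lt.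
  apply: eq_bigr => q _; rewrite hsym_sum //.
  by move=> l /=; rewrite nth_nil.
split=> [i j|w].
  rewrite !hE; apply: eq_bigr => q _; congr (_ * _).
  rewrite big_nat_rev big_nat [RHS]big_nat; apply: eq_bigr => a /andP[_ aq].
  by rewrite mulrC add0n subSS subKn.
have := wtone_loewner w f0t y0 nD fp; congr (0 <= _).
under [RHS]eq_bigr do under eq_bigr do rewrite hE mulr_sumr.
under [RHS]eq_bigr do rewrite exchange_big /=.
rewrite [RHS]exchange_big; apply: eq_bigr => q _.
under [RHS]eq_bigr do under eq_bigr do rewrite mulrCA.
under [RHS]eq_bigr do rewrite -mulr_sumr.
rewrite -[RHS]mulr_sumr; congr (_ * _).
under [RHS]eq_bigr do under eq_bigr do rewrite mulr_sumr.
under [RHS]eq_bigr do rewrite exchange_big /=.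
rewrite [RHS]exchange_big; apply: eq_bigr => a _.
rewrite mulr_suml; apply: eq_bigr => i _.
rewrite mulr_sumr; apply: eq_bigr => j _.
by rewrite mulrACA.
Qed.

End Loewner.

(** * Real symmetric matrices as complex positive semidefinite ones *)

Section RealPsd.
Context {R : realType}.
Local Open Scope complex_scope.
Local Open Scope sesquilinear_scope.

Lemma conj_mul_real (g : R) (y z : R[i]) :
  (y^*)%C * g%:C * z =
  (g * (complex.Re y * complex.Re z + complex.Im y * complex.Im z)) +i*
  (g * (complex.Re y * complex.Im z - complex.Im y * complex.Re z)).
Proof.
by case: y z => [a b] [c d]; apply/eqP; rewrite eq_complex /=; apply/andP; split;
  apply/eqP; ring.
Qed.

Lemma sum_complex (I : finType) (a b : I -> R) :
  \sum_i (a i +i* b i) = (\sum_i a i) +i* (\sum_i b i).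
Proof.
elim/big_rec3: _ => [//|i x y z _ ->]; exact: erefl.
Qed.

(** On v = a + i b the form is the sum of its values at a and at b; the imaginary part is
    antisymmetric in the two indices and cancels. *)
Lemma psdmx_real n (G : 'I_n -> 'I_n -> R) : (forall i j, G i j = G j i) ->
  (forall w : 'I_n -> R, 0 <= \sum_i \sum_j w i * w j * G i j) ->
  psdmx (\matrix_(i < n, j < n) (G i j)%:C).
Proof.
move=> Gs G0; split.
  have -> : \matrix_(i < n, j < n) (G i j)%:C =
      map_mx (real_complex R) (\matrix_(i < n, j < n) G i j).
    by apply/matrixP => i j; rewrite !mxE.
  by apply: hermsymmx_real; apply/matrixP => i j; rewrite !mxE.
move=> v; pose a i := complex.Re (v i ord0); pose b i := complex.Im (v i ord0).
pose X i j := G i j * (a i * a j + b i * b j).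
pose Y i j := G i j * (a i * b j - b i * a j).
have -> : (v ^t* *m (\matrix_(i < n, j < n) (G i j)%:C) *m v) ord0 ord0 =
    \sum_j (\sum_i X i j) +i* (\sum_i Y i j).
  rewrite mxE; apply: eq_bigr => j _; rewrite -sum_complex mxE mulr_suml.
  by apply: eq_bigr => i _; rewrite -conj_mul_real !mxE.
have XE : \sum_j \sum_i X i j =
    \sum_i \sum_j a i * a j * G i j + \sum_i \sum_j b i * b j * G i j.
  rewrite exchange_big -big_split; apply: eq_bigr => i _ /=.
  rewrite -big_split; apply: eq_bigr => j _ /=; rewrite /X; ring.
have YE : \sum_j \sum_i Y i j = 0.
  suff E : \sum_j \sum_i Y i j = - \sum_j \sum_i Y i j by lra.
  rewrite [LHS]exchange_big -sumrN; apply: eq_bigr => i _ /=.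
  by rewrite -sumrN; apply: eq_bigr => j _; rewrite /Y Gs; ring.
rewrite sum_complex lecE /= YE eqxx /= XE; exact: addr_ge0.
Qed.


Lemma divdiff_extension_psd k n (a b : \bar R) f (x : 'I_n.+2 -> R)
    (g := fun y : 'rV[R]_k.+2 => ddext k.+1 f (fun l => y ord0 (inord l))) :
  open (eitv a b) -> is_interval (eitv a b) -> wtone k.+1 n.+2 (eitv a b) f ->
  (forall i, eitv a b (x i)) ->
  psdmx (\matrix_(i < n.+2, j < n.+2)
    (g (\row_(l < k.+2) nth (x ord0) [:: x i; x j] l))%:C).
Proof.
move=> Do Di ft xD; have [Gs G0] := ddext_loewner Do Di ft xD.
have gE i j : g (\row_(l < k.+2) nth (x ord0) [:: x i; x j] l) =
    ddext k.+1 f (nth (x ord0) [:: x i; x j]).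
  rewrite /g; apply: eq_ddext => l lk; rewrite mxE inordK //.
have -> : \matrix_(i < n.+2, j < n.+2)
    (g (\row_(l < k.+2) nth (x ord0) [:: x i; x j] l))%:C =
  \matrix_(i < n.+2, j < n.+2) (ddext k.+1 f (nth (x ord0) [:: x i; x j]))%:C.
  by apply/matrixP => i j; rewrite !mxE gE.
exact: psdmx_real Gs G0.
Qed.

Lemma ddext_extension k n (a b : \bar R) f :
  open (eitv a b) -> is_interval (eitv a b) -> wtone k.+1 n.+2 (eitv a b) f ->
  divdiff_extension a b f
    (fun y : 'rV[R]_k.+2 => ddext k.+1 f (fun l => y ord0 (inord l))).
Proof.
move=> Do Di ft.
have fb : ddbounded (eitv a b) k.+2 f.
  have := @matrix_tone_ktone _ k n.+1 (eitv a b) f 1 Do Di ft isT.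
  by rewrite muln1 addn2; exact: ktone_bounded.
split; first exact: ddext_continuous.
move=> y yD yinj; apply: (ddext_inj Do Di fb) => [i _|i j ik jk]; first exact: yD.
by move=> /yinj /(congr1 (@nat_of_ord _)); rewrite !inordK.
Qed.

End RealPsd.

(** * Differentiability of monotone functions *)

Section Monotone.
Context {R : realType}.
Implicit Types (D : set R) (f phi F : R -> R).
Notation mu := (@lebesgue_measure R).

(** The push-forward by phi of Lebesgue measure on [c, d]. Measurability of phi is an argument so
    that the measure structure can be attached to this constant. *)
Definition image_length phi (c d : R) (mphi : measurable_fun [set: R] phi) :
    set (measurableTypeR R) -> \bar R :=
  fun A => mu ((phi @^-1` A) `&` `[c, d]).

Section ImageLength.
Context (phi : R -> R) (c d : R) (mphi : measurable_fun [set: R] phi).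
Notation nu := (image_length c d mphi).

Let nu0 : nu set0 = 0%E.
Proof. by rewrite /image_length preimage_set0 set0I measure0. Qed.

Let nu_ge0 A : (0 <= nu A)%E.
Proof. exact: measure_ge0. Qed.

Let mpre A : measurable A -> measurable (phi @^-1` A).
Proof. by move=> mA; rewrite -[X in measurable X]setTI; exact: mphi. Qed.

Let nu_sigma_additive : semi_sigma_additive nu.
Proof.
move=> A mA tA mUA; rewrite /image_length preimage_bigcup setI_bigcupl.
apply: measure_semi_sigma_additive.
- by move=> n; apply: measurableI; [apply: mpre; exact: mA|exact: measurable_itv].
- apply/trivIsetP => /= i j _ _ ij; rewrite setIACA -preimage_setI.
  by move/trivIsetP : tA => /(_ _ _ _ _ ij) ->//; rewrite preimage_set0 set0I.
- rewrite -setI_bigcupl -preimage_bigcup; apply: measurableI; last exact: measurable_itv.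
  by apply: mpre; apply: bigcupT_measurable => n; exact: mA.
Qed.

HB.instance Definition _ := isMeasure.Build _ _ _ nu nu0 nu_ge0 nu_sigma_additive.

Let nu_fin : fin_num_fun nu.
Proof.
move=> A mA; rewrite ge0_fin_numE //.
apply: (@le_lt_trans _ _ (mu `[c, d])); last first.
  by rewrite lebesgue_measure_itv /=; case: ifP => _; rewrite ?ltry // -EFinB ltry.
apply: le_measure; rewrite ?inE; [|exact: measurable_itv|exact: subIsetr].
by apply: measurableI; [apply: mpre; exact: mA|exact: measurable_itv].
Qed.

HB.instance Definition _ := Measure_isFinite.Build _ _ _ nu nu_fin.

End ImageLength.

Lemma lebesgue_measure_diam (A : set R) (L : R) : 0 <= L -> measurable A ->
  (forall x y, A x -> A y -> y - x <= L) -> (mu A <= L%:E)%E.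
Proof.
move=> L0 mA AL; have [->|/set0P[x0 Ax0]] := eqVneq A set0.
  by rewrite measure0 lee_fin.
have Alb : has_inf A.
  by split; [exists x0|exists (x0 - L) => x Ax; have := AL _ _ Ax Ax0; lra].
have sub : A `<=` `[inf A, inf A + L].
  move=> x Ax; rewrite /= in_itv /=; apply/andP; split.
    by apply: ge_inf => //; case: Alb.
  rewrite -lerBlDr; apply: lb_le_inf; first by exists x0.
  by move=> y Ay; have := AL _ _ Ay Ax; lra.
apply: (@le_trans _ _ (mu `[inf A, inf A + L])).
  by apply: le_measure; rewrite ?inE //; exact: measurable_itv.
rewrite lebesgue_measure_itv /=; case: ifP => _; last by rewrite lee_fin.
by rewrite -EFinB lee_fin; lra.
Qed.

(** Holds for the identity plus any nondecreasing function; the inverse is then 1-Lipschitz. *)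
Definition expanding phi := forall x y : R, x <= y -> y - x <= phi y - phi x.

(** The preimage of an interval has diameter at most its length, so a cover of a null set by short
    intervals also bounds its preimage. *)
Lemma expanding_dominates phi (c d : R) (mphi : measurable_fun [set: R] phi) :
  expanding phi -> image_length c d mphi `<< mu.
Proof.
move=> phiE; apply/null_content_dominatesP => A mA A0.
apply/eqP; rewrite eq_le measure_ge0 andbT; apply/lee_addgt0Pr => e e0.
rewrite add0e.
have mpre B : measurable B -> measurable (phi @^-1` B `&` `[c, d]).
  move=> mB; apply: measurableI; last exact: measurable_itv.
  by rewrite -[X in measurable X]setTI; exact: mphi.
have lA : ((wlength idfun)^* A)%mu = 0%E by exact: A0.
have [F [Fo AF] Fe] : exists2 F, open_itv_cover A F &
    (\sum_(0 <= k <oo) wlength idfun (F k) <= e%:E)%E.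
  have : ((wlength idfun)^* A)%mu \is a fin_num by rewrite lA.
  rewrite outer_measure_open_itv_cover.
  move=> /lb_ereal_inf_adherent-/(_ _ e0)[_/= [F]] AF <- Fe.
  exists F => //; apply: ltW.
  by move: Fe; rewrite -outer_measure_open_itv_cover lA add0e.
apply: le_trans Fe.
have mF k : measurable (F k).
  have [ab Fab] := Fo k.
  by rewrite Fab; exact: measurable_itv.
apply: (@le_trans _ _ (\sum_(0 <= k <oo) image_length c d mphi (F k))%E).
  by apply: measure_sigma_subadditive => //.
apply: lee_nneseries => // k _.
have [[p q] Fk] := Fo k; rewrite {}Fk /= wlength_itv /=.
have [pq|qp] := ltP p q; last first.
  rewrite set_itv_ge ?measure0 //=; first by case: ifP => //; rewrite lte_fin ltNge qp.
  by rewrite bnd_simp -leNgt.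
rewrite lte_fin pq -EFinB /image_length; apply: lebesgue_measure_diam.
- by rewrite subr_ge0 ltW.
- by apply: mpre; exact: measurable_itv.
- move=> x y [px _] [py _]; have [xy|yx] := leP x y; last first.
    by apply: le_trans (_ : 0 <= _); lra.
  have := phiE _ _ xy; move: px py; rewrite /= !in_itv /=; lra.
Qed.

End Monotone.

Section MonotoneDerivable.
Context {R : realType}.
Implicit Types (D : set R) (f phi F : R -> R).
Notation mu := (@lebesgue_measure R).

(** The difference quotient of phi at x is the inverse of that of F at phi x, for the increment
    [k h]. Positivity of the derivative of F is what makes [k h] tend to 0. *)
Lemma derivable_inverse phi F (c d x w : R) : c < x < d -> expanding phi ->
  {homo F : y z / y <= z} -> (forall z, c <= z <= d -> F (phi z) = z - c) ->
  is_derive (phi x) 1 F w -> 0 < w -> derivable phi x 1.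
Proof.
move=> /andP[cx xd] phiE Fnd Fphi dF w0.
have Fx : F (phi x) = x - c by apply: Fphi; lra.
pose q (k : R) := k^-1 *: (F (k + phi x) - F (phi x)).
have qw : q k @[k --> 0^'] --> w.
  have : h^-1 *: ((F \o shift (phi x)) (h *: 1) - F (phi x)) @[h --> 0^'] -->
      'D_1 F (phi x) := @ex_derive _ _ _ _ _ _ _ dF.
  rewrite derive_val; apply: cvg_trans; apply: near_eq_cvg; near=> k.
  by rewrite /q /= [_ *: 1]mulr1.
have near_q : \forall k \near 0^', 0 < q k.
  by apply: (cvgr_gt _ qw); exact: w0.
(* F is not locally constant on either side of phi x, which excludes a jump of phi at x. *)
have Fgt (del : R) : 0 < del -> F (phi x) < F (phi x + del) /\ F (phi x - del) < F (phi x).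
  move=> del0; have /nbhs_ballP[e /= e0 qe] := near_q.
  pose h := Num.min (e / 2) del.
  have h0 : 0 < h by rewrite lt_min del0 divr_gt0.
  have he : h < e by rewrite gt_min; apply/orP; left; lra.
  have hd : h <= del by rewrite ge_min lexx orbT.
  split.
    have := qe h; rewrite /ball /= sub0r normrN gtr0_norm // => /(_ he (lt0r_neq0 h0)).
    rewrite /q /GRing.scale /= pmulr_rgt0 ?invr_gt0 // subr_gt0 => /lt_le_trans; apply.
    by apply: Fnd; lra.
  have hn0 : - h != 0 by rewrite oppr_eq0 gt_eqF.
  have := qe (- h); rewrite /ball /= sub0r opprK gtr0_norm // => /(_ he hn0).
  rewrite /q /GRing.scale /= invrN mulNr -mulrN opprB pmulr_rgt0 ?invr_gt0 // subr_gt0.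
  by apply: le_lt_trans; apply: Fnd; lra.
pose k (h : R) := phi (h + x) - phi x.
have hF h : c <= h + x <= d -> F (k h + phi x) - F (phi x) = h.
  by move=> hcd; rewrite /k subrK Fphi // Fx; lra.
have near_cd : \forall h \near (0 : R)^', c <= h + x <= d.
  near=> h; have : `|h| < Num.min (x - c) (d - x).
    by near: h; apply: dnbhs0_lt; rewrite lt_min !subr_gt0 cx.
  by rewrite lt_min !ltr_norml; lra.
have kcvg : k h @[h --> 0^'] --> (0 : R)^'.
  have k0 : k h @[h --> 0^'] --> (0 : R).
    apply/cvgr0Pnorm_lt => del del0; have [F1 F2] := Fgt _ del0.
    near=> h.
    have hcd : c <= h + x <= d by near: h.
    have : `|h| < Num.min (F (phi x + del) - F (phi x)) (F (phi x) - F (phi x - del)).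
      by near: h; apply: dnbhs0_lt; rewrite lt_min !subr_gt0 F1.
    rewrite lt_min !ltr_norml => hd; have := hF _ hcd => hFk.
    apply/andP; split; rewrite ltNge; apply/negP => kd.
      have ? : F (k h + phi x) <= F (phi x - del) by apply: Fnd; lra.
    lra.
    have ? : F (phi x + del) <= F (k h + phi x) by apply: Fnd; lra.
    lra.
  have kn0 : \forall h \near (0 : R)^', k h != 0.
    near=> h; rewrite /k subr_eq0; have h0 : h != 0 by near: h; exact: nbhs_dnbhs_neq.
    have [hp|hn] := ltP 0 h.
      by have := phiE x (h + x); rewrite lerDr ltW // => /(_ isT) ?; apply/eqP; lra.
    have hn' : h < 0 by rewrite lt_neqAle h0.
    by have := phiE (h + x) x; rewrite gerDr hn => /(_ isT) ?; apply/eqP; lra.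
  by move=> P /k0 kP; apply: filterS2 kP kn0 => h; apply.
have qk : (q (k h))^-1 @[h --> 0^'] --> w^-1.
  by apply: cvgV; [rewrite gt_eqF|apply: (cvg_comp k q kcvg qw)].
apply/cvg_ex; exists w^-1; apply: cvg_trans qk; apply: near_eq_cvg.
near=> h.
have hcd : c <= h + x <= d by near: h.
by rewrite /q hF // /GRing.scale /= mulr1 invfM invrK mulrC.
Unshelve. all: by end_near. Qed.

End MonotoneDerivable.

Section MonotoneAe.
Context {R : realType}.
Implicit Types (D : set R) (f phi F : R -> R).
Notation mu := (@lebesgue_measure R).

(** The push-forward has a density g, and its distribution function F inverts phi and has derivative
    g off a null set N. At x the inverse rule fails only if phi x is in N or g vanishes at phi x;
    both sets are null for the push-forward, so their preimages in [c, d] are Lebesgue null. *)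
Lemma expanding_ae_derivable phi (c d : R) : expanding phi ->
  {ae mu, forall x, c < x < d -> derivable phi x 1}.
Proof.
move=> phiE.
have phind : {homo phi : x y / x <= y}.
  by move=> x y xy; have := phiE _ _ xy; lra.
have mphi : measurable_fun [set: R] phi.
  exact: nondecreasing_measurable.
pose nu : {finite_measure set (measurableTypeR R) -> \bar R} :=
  image_length c d mphi.
have numu : nu `<< mu by exact: expanding_dominates.
have [g [g0 gfin gint gE]] := @radon_nikodym_sigma_finite _ _ _ mu nu numu.
pose w (x : R) := fine (g x).
have wE : EFin \o w = g by apply/funext => x; rewrite /= fineK.
have mitv (y : R) : measurable (`]-oo, y] : set R) by exact: measurable_itv.
have wint : mu.-integrable setT (EFin \o w) by rewrite wE.
have wloc : locally_integrable setT w.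
  by apply: open_integrable_locally => //; exact: openT.
have winty y : mu.-integrable `]-oo, y] (EFin \o w).
  exact: integrableS (@subsetT _ _) wint.
have := FTC1Ny winty wloc.
set F := fun x : R => _; move=> [N [mN N0 subN]].
have FE y : (F y)%:E = nu `]-oo, y]%classic.
  have E : (\int[mu]_(t in `]-oo, y]) (w t)%:E = nu `]-oo, y]%classic)%E.
    by rewrite gE //; apply: eq_integral => t _; rewrite /w fineK.
  by rewrite /F /Rintegral E fineK // fin_num_measure.
have Fnd : {homo F : y z / y <= z}.
  move=> y z yz; rewrite -lee_fin !FE; apply: le_measure; rewrite ?inE //.
  by move=> t /=; rewrite !in_itv /= => /le_trans; apply.
have Fphi z : c <= z <= d -> F (phi z) = z - c.
  move=> /andP[cz zd]; apply/EFin_inj; rewrite FE.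
  have E : phi @^-1` `]-oo, phi z] `&` `[c, d] = `[c, z]%classic.
    apply/seteqP; split=> [t [/=]|t /=]; rewrite !in_itv /=.
      move=> tz /andP[ct _]; rewrite ct /= leNgt; apply/negP => zt.
      by have := phiE _ _ (ltW zt); lra.
    move=> /andP[ct tz]; split; first exact: phind.
    by rewrite ct (le_trans tz).
  have -> : nu `]-oo, phi z]%classic = mu `[c, z]%classic by rewrite -E.
  rewrite lebesgue_measure_itv /= lte_fin; case: ltP => [_|zc]; first by rewrite -EFinB.
  by congr EFin; lra.
pose Z := [set y | g y = 0%E].
have mZ : measurable Z.
  have mg : measurable_fun setT g by apply: measurable_int gint.
  by rewrite -[Z]setTI; exact: (mg measurableT [set 0%E]).
have nuNZ : nu (N `|` Z) = 0%E.
  apply/eqP; rewrite eq_le measure_ge0 andbT.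
  have nuN : nu N = 0%E by move/null_content_dominatesP : numu; apply.
  have nuZ : nu Z = 0%E.
    rewrite gE // (eq_integral (cst 0%E)) ?integral0 // => y; rewrite inE //.
  apply: (@le_trans _ _ (nu N + nu Z)%E); first exact: measureU2.
  by rewrite nuN nuZ adde0.
exists (phi @^-1` (N `|` Z) `&` `[c, d]); split; last 1 first.
- move=> x /= /not_implyP[/andP[cx xd] ndx]; split; last first.
    by rewrite /= in_itv /= !ltW.
  apply: contrapT => /= /not_orP[Nx Zx]; apply: ndx.
  have [dF Fw] : derivable F (phi x) 1 /\ derive1 F (phi x) = w (phi x).
    by apply: contrapT => h; apply: Nx; apply: subN.
  apply: (@derivable_inverse R phi F c d x (w (phi x)) _ phiE Fnd Fphi).
  - by rewrite cx.
  - by rewrite -Fw derive1E; exact/derivableP.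
  - rewrite lt_neqAle fine_ge0 // andbT eq_sym; apply/eqP => w0; apply: Zx.
    by rewrite /Z /= -[g _]fineK // -/(w _) w0.
- apply: measurableI; last exact: measurable_itv.
  rewrite -[X in measurable X]setTI; apply: (mphi measurableT).
  exact: measurableU.
- exact: nuNZ.
Qed.

(** On [c, d], clamping the argument and adding the identity gives an expanding function. Countably
    many intervals with rational endpoints, enumerated by [unpickle], then cover D. *)
Lemma nondecreasing_ae_derivable D f : open D -> is_interval D ->
  (forall x y, D x -> D y -> x <= y -> f x <= f y) ->
  {ae mu, forall x, D x -> derivable f x 1}.
Proof.
move=> Do Di fnd; have FF := ae_filter_ringOfSetsType mu.
have H (c d : R) : D c -> D d -> {ae mu, forall x, c < x < d -> derivable f x 1}.
  move=> Dc Dd; have [cd|dc] := leP c d; last first.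
    apply: aeW => x /andP[cx xd]; lra.
  pose cl x := Num.min d (Num.max c x).
  have clD x : D (cl x).
    by apply: (Di _ _ Dc Dd); rewrite /cl le_min cd le_max lexx ge_min lexx.
  have clnd x y : x <= y -> cl x <= cl y.
    move=> xy; rewrite /cl le_min ge_min lexx /= ge_min; apply/orP; right.
    by rewrite ge_max !le_max lexx xy orbT.
  pose phi x := x + f (cl x).
  have phiE : expanding phi.
    by move=> x y xy; have := fnd _ _ (clD x) (clD y) (clnd _ _ xy); rewrite /phi; lra.
  apply: filterS (expanding_ae_derivable c d phiE) => x dphi xcd.
  have dphix := dphi xcd.
  have dd : derivable (fun y : R => phi y - y) x 1.
    by apply: derivableB; [exact: dphix|exact: derivable_id].
  apply: near_eq_derivable dd; have /andP[cx xd] := xcd.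
  near=> y; have cy : c < y by near: y; exact: lt_nbhsr.
  have yd : y < d by near: y; exact: lt_nbhsl.
  have -> : phi y = y + f y.
    by rewrite /phi /cl (max_idPr (ltW cy)) (min_idPr (ltW yd)).
  by rewrite addrC addKr.
pose P n x := match unpickle n : option (rat * rat) with
  | Some pq => D (ratr pq.1) -> D (ratr pq.2) -> ratr pq.1 < x < ratr pq.2 ->
      derivable f x 1
  | None => True end.
have : {ae mu, forall x, forall n, P n x}.
  apply: ae_foralln => n; rewrite /P; case: unpickle => [pq|]; last exact: aeW.
  have [Dp|nDp] := pselect (D (ratr pq.1)); last by apply: aeW.
  have [Dq|nDq] := pselect (D (ratr pq.2)); last by apply: aeW.
  by apply: filterS (H _ _ Dp Dq) => x h _ _.
apply: filterS => x Px Dx; have [e e0 De] := open_segment Do Dx.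
have [|p] := @rat_in_itvoo R (x - e) x; first by lra.
rewrite in_itv /= => /andP[ep px].
have [|q] := @rat_in_itvoo R x (x + e); first by lra.
rewrite in_itv /= => /andP[xq qe].
have := Px (pickle (p, q)); rewrite /P pickleK /=; apply; last by rewrite px.
- by apply: De; lra.
- by apply: De; lra.
Unshelve. all: by end_near. Qed.

End MonotoneAe.

(** * Convex functions to second order *)

Section Chords.
Context {R : realType}.
Implicit Types (D : set R) (f g h : R -> R).

(** [h] selects a subgradient of the convex function g at each point. *)
Definition chord_bounds D g h := forall x y, D x -> D y -> x < y ->
  h x * (y - x) <= g y - g x <= h y * (y - x).

(** Take for h x the infimum of the slopes of chords from x to the right; the three-slope inequality
    gives both bounds. *)
Lemma ktone2_chord_bounds D g : open D -> is_interval D -> ktone D 2 g ->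
  exists h, chord_bounds D g h.
Proof.
move=> Do Di gt.
have slope (x y z : R) : D x -> D z -> x < y -> y < z ->
    (g y - g x) / (y - x) <= (g z - g y) / (z - y).
  move=> Dx Dz xy yz; have xz := lt_trans xy yz.
  have zx0 : 0 < z - x by rewrite subr_gt0.
  have zx1 : z - x != 0 by rewrite gt_eqF.
  have := @ktone2_le _ D g ((z - y) / (z - x)) x z Di gt.
  have -> : 1 - (z - y) / (z - x) = (y - x) / (z - x) by field.
  have -> : (z - y) / (z - x) * x + (y - x) / (z - x) * z = y by field.
  move=> /(_ _ _ Dx Dz) H.
  have {}H : g y * (z - x) <= (z - y) * g x + (y - x) * g z.
    rewrite -ler_pdivlMr // mulrDl mulrAC [X in _ + X]mulrAC.
    by apply: H; rewrite ?divr_ge0 ?subr_ge0 ?ler_pdivrMr // ?ltW //; lra.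
  rewrite ler_pdivrMr ?subr_gt0 // mulrAC ler_pdivlMr ?subr_gt0 //; lra.
pose S x := [set (g y - g x) / (y - x) | y in [set y | D y /\ x < y]].
exists (fun x => inf (S x)) => x y Dx Dy xy.
have lbS (u z : R) : D u -> D z -> u < z -> lbound (S z) ((g z - g u) / (z - u)).
  by move=> Du Dz uz _ [v [Dv zv] <-]; exact: slope.
have hasinf z : D z -> has_inf (S z).
  move=> Dz; have [e e0 De] := open_segment Do Dz; split.
    by exists ((g (z + e) - g z) / (z + e - z)), (z + e) => //; split; [apply: De|]; lra.
  by exists ((g z - g (z - e)) / (z - (z - e))); apply: lbS => //; [apply: De|]; lra.
have yx : 0 < y - x by rewrite subr_gt0.
apply/andP; split.
  rewrite -ler_pdivlMr //.
  by apply: ge_inf; [exact: (hasinf x Dx).2|exists y].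
rewrite -ler_pdivrMr //.
by apply: lb_le_inf; [exact: (hasinf y Dy).1|exact: lbS].
Qed.

Lemma chord_bounds_le D g h x y : chord_bounds D g h -> D x -> D y -> x <= y ->
  h x <= h y.
Proof.
move=> gh Dx Dy; rewrite le_eqVlt => /orP[/eqP -> //|xy].
have /andP[h1 h2] := gh _ _ Dx Dy xy.
by rewrite -(@ler_pM2r _ (y - x)) ?subr_gt0 // (le_trans h1).
Qed.

(** Since h lies between h(0) + (c - eps) u and h(0) + (c + eps) u, comparing right derivatives
    keeps g between the two parabolas with these slopes. *)
Lemma chord_bounds_peano_right g h (r c : R) : 0 < r ->
  chord_bounds [set u | - r < u < r] g h ->
  (forall u, - r < u < r -> {for u, continuous g}) ->
  (forall eps : R, 0 < eps -> \forall u \near (0 : R),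
     `|h u - (h 0 + c * u)| <= eps * `|u|) ->
  forall eps : R, 0 < eps -> \forall y \near (0 : R)^'+,
    `|g y - (g 0 + h 0 * y + c / 2 * y ^+ 2)| <= eps * y ^+ 2.
Proof.
move=> r0 gh gc hc eps eps0.
have /nbhs_ballP[d /= d0 Hd] := hc _ eps0.
have hd u : 0 <= u < d -> h 0 + (c - eps) * u <= h u <= h 0 + (c + eps) * u.
  move=> /andP[u0 ud]; have := Hd u; rewrite /ball /= sub0r normrN ger0_norm //.
  by move=> /(_ ud); rewrite ler_norml => /andP[? ?]; apply/andP; split; lra.
near=> y; have y0 : 0 < y by near: y; exact: nbhs_right_gt.
have yd : y < Num.min d r by near: y; apply: nbhs_right_lt; rewrite lt_min d0.
move: yd; rewrite lt_min => /andP[yd yr].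
(* The step t is so small that the second order term a t^2 of the parabola is at most e t. *)
have quad_cvg (e a : R) s : 0 <= s -> s < y -> 0 < e -> \forall t \near (0 : R)^'+,
    [/\ 0 < t, s + t < d, s + t < r & `|a| * t <= e].
  move=> s0 sy e0; near=> t; have t0 : 0 < t by near: t; exact: nbhs_right_gt.
  have h1 : t < d - s by near: t; apply: nbhs_right_lt; lra.
  have h2 : t < r - s by near: t; apply: nbhs_right_lt; lra.
  have a0 : 0 < 1 + `|a| by rewrite ltr_pwDl.
  have : t <= e / (1 + `|a|).
    by near: t; apply: nbhs_right_le; rewrite divr_gt0.
  rewrite ler_pdivlMr // => h3.
  split; [exact: t0|lra|lra|].
  by rewrite mulrC; apply: le_trans h3; rewrite ler_pM2l // lerDr.
have polc (a b : R) s : {for s, continuous (fun s : R => a * s + b * s ^+ 2)}.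
  apply: cvgD; first by apply: cvgMl_tmp; exact: cvg_id.
  by apply: cvgMl_tmp; rewrite !expr2; apply: cvgM; exact: cvg_id.
have gcont s : 0 <= s -> s <= y -> {for s, continuous g} by move=> ? ?; apply: gc; lra.
have lower : (c - eps) / 2 * y ^+ 2 <= g y - g 0 - h 0 * y.
  pose phi s := g s + (- h 0 * s + (- ((c - eps) / 2)) * s ^+ 2).
  suff : phi 0 <= phi y by rewrite /phi; lra.
  apply: right_derivative_le => [|s s0 sy|s s0 sy e e0]; first exact: ltW.
    by apply: cvgD; [exact: gcont|exact: polc].
  apply: filterS (quad_cvg _ ((c - eps) / 2) s s0 sy e0) => t [t0 sd sr te].
  have /andP[+ _] : h s * (s + t - s) <= g (s + t) - g s <= h (s + t) * (s + t - s).
    by apply: gh => /=; lra.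
  have -> : s + t - s = t by lra.
  have /andP[+ _] : h 0 + (c - eps) * s <= h s <= h 0 + (c + eps) * s by apply: hd; lra.
  move=> h1 h2; have h3 := ler_norm ((c - eps) / 2); rewrite /phi; nra.
have upper : g y - g 0 - h 0 * y <= (c + eps) / 2 * y ^+ 2.
  pose phi s := - g s + (h 0 * s + (c + eps) / 2 * s ^+ 2).
  suff : phi 0 <= phi y by rewrite /phi; lra.
  apply: right_derivative_le => [|s s0 sy|s s0 sy e e0]; first exact: ltW.
    by apply: cvgD; [apply: cvgN; exact: gcont|exact: polc].
  apply: filterS (quad_cvg _ ((c + eps) / 2) s s0 sy e0) => t [t0 sd sr te].
  have /andP[_ +] : h s * (s + t - s) <= g (s + t) - g s <= h (s + t) * (s + t - s).
    by apply: gh => /=; lra.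
  have -> : s + t - s = t by lra.
  have /andP[_ +] : h 0 + (c - eps) * (s + t) <= h (s + t) <= h 0 + (c + eps) * (s + t).
    by apply: hd; lra.
  move=> h1 h2; have h3 := ler_norm ((c + eps) / 2); rewrite /phi; nra.
have y2 : 0 <= y ^+ 2 by rewrite sqr_ge0.
rewrite ler_norml; nra.
Unshelve. all: by end_near. Qed.

End Chords.

Section ChordDerivative.
Context {R : realType}.
Implicit Types (D : set R) (f g h : R -> R).

Lemma derivable_quotient_cvg f (x : R) : derivable f x 1 ->
  (f y - f x) / (y - x) @[y --> x^'] --> derive1 f x.
Proof.
move=> df; apply/cvgrPdist_le => eps eps0.
have : h^-1 *: ((f \o shift x) (h *: 1) - f x) @[h --> 0^'] --> 'D_1 f x := df.
move=> /cvgrPdist_le/(_ eps eps0)/nbhs_ballP[r /= r0 Hr].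
apply/nbhs_ballP; exists r => // y; rewrite /ball /= distrC => xy yx.
have := Hr (y - x); rewrite /ball /= sub0r normrN => /(_ xy).
by rewrite subr_eq0 => /(_ yx); rewrite derive1E [_ *: 1]mulr1 subrK mulrC.
Qed.

Lemma cvg_quotient_derivable f (x l : R) :
  (f y - f x) / (y - x) @[y --> x^'] --> l -> is_derive x 1 f l.
Proof.
move=> fl.
have H : h^-1 *: ((f \o shift x) (h *: 1) - f x) @[h --> 0^'] --> l.
  apply/cvgrPdist_le => eps eps0.
  move: fl => /cvgrPdist_le/(_ eps eps0)/nbhs_ballP[r /= r0 Hr].
  apply/nbhs_ballP; exists r => // h; rewrite /ball /= sub0r normrN => hr h0.
  have := Hr (h + x); rewrite /ball /= opprD addrCA subrr addr0 normrN.
  move=> /(_ hr); rewrite addrK -subr_eq0 addrK [_ *: 1]mulr1 mulrC; exact.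
by split; [apply/cvg_ex; exists l|exact: (cvg_lim _ H)].
Qed.

Lemma derivable_peano f (x : R) : derivable f x 1 -> forall eps : R, 0 < eps ->
  \forall u \near (0 : R), `|f (u + x) - (f x + derive1 f x * u)| <= eps * `|u|.
Proof.
move=> /derivable_quotient_cvg/cvgrPdist_le df eps eps0.
have /nbhs_ballP[r /= r0 Hr] := df eps eps0.
apply/nbhs_ballP; exists r => // u; rewrite /ball /= sub0r normrN => ur.
have [->|u0] := eqVneq u 0; first by rewrite add0r mulr0 addr0 subrr normr0 mulr0.
have := Hr (u + x); rewrite /ball /= opprD addrCA subrr addr0 normrN.
move=> /(_ ur); rewrite -subr_eq0 addrK => /(_ u0).
rewrite -(ler_pM2r (_ : 0 < `|u|)) ?normr_gt0 // -normrM mulrBl divfK //.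
by rewrite distrC opprD addrA.
Qed.

Lemma chord_bounds_peano D g h (x : R) : open D -> chord_bounds D g h ->
  (forall z, D z -> {for z, continuous g}) -> D x -> derivable h x 1 ->
  forall eps : R, 0 < eps -> \forall y \near (0 : R),
    `|g (y + x) - (g x + h x * y + derive1 h x / 2 * y ^+ 2)| <= eps * y ^+ 2.
Proof.
move=> Do gh gc Dx dh eps eps0; set c := derive1 h x.
have [r r0 Dr] := open_segment Do Dx.
have hp := derivable_peano dh.
have [r1 r10 H1] : exists2 r1 : R, 0 < r1 & forall y, 0 < y < r1 ->
    `|g (y + x) - (g x + h x * y + c / 2 * y ^+ 2)| <= eps * y ^+ 2.
  have := @chord_bounds_peano_right _ (fun u => g (u + x)) (fun u => h (u + x)) r c r0.
  rewrite add0r => H; apply: near_at_right; apply: (H _ _ _ eps eps0).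
  - move=> u v ur vr uv; have := gh (u + x) (v + x).
    by rewrite opprD addrACA subrr addr0; apply; [apply: Dr|apply: Dr|]; move: ur vr => /=; lra.
  - move=> u ur; apply: (@continuous_comp _ _ _ (fun u => u + x) g).
      by apply: cvgD; [exact: cvg_id|exact: cvg_cst].
    by apply: gc; apply: Dr; lra.
  - exact: hp.
(* The left side follows by reflection: g(x - u) satisfies the chord bounds with -h(x - u). *)
have [r2 r20 H2] : exists2 r2 : R, 0 < r2 & forall y, 0 < y < r2 ->
    `|g (x - y) - (g x - h x * y + c / 2 * y ^+ 2)| <= eps * y ^+ 2.
  have := @chord_bounds_peano_right _ (fun u => g (x - u)) (fun u => - h (x - u)) r c r0.
  rewrite /= subr0 => H; apply: near_at_right.
  suff : \forall h0 \near (0 : R)^'+,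
      `|g (x - h0) - (g x + - h x * h0 + c / 2 * h0 ^+ 2)| <= eps * h0 ^+ 2.
    by apply: filterS => y; rewrite mulNr.
  apply: (H _ _ _ eps eps0).
  - move=> u v ur vr uv.
    have /andP[] : h (x - v) * (x - u - (x - v)) <= g (x - u) - g (x - v) <=
        h (x - u) * (x - u - (x - v)).
      by apply: gh; [apply: Dr|apply: Dr|]; move: ur vr => /=; lra.
    have -> : x - u - (x - v) = v - u by lra.
    by move=> ? ?; apply/andP; split; lra.
  - move=> u ur; apply: (@continuous_comp _ _ _ (fun u => x - u) g).
      by apply: cvgB; [exact: cvg_cst|exact: cvg_id].
    by apply: gc; apply: Dr; lra.
  - move=> e e0; have /nbhs_ballP[d /= d0 Hd] := hp e e0.
    apply/nbhs_ballP; exists d => // u; rewrite /ball /= sub0r normrN => ud.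
    have := Hd (- u); rewrite /ball /= sub0r opprK => /(_ ud) Hu.
    have -> : - h (x - u) - (- h x + c * u) = - (h (- u + x) - (h x + c * - u)).
      by rewrite [- u + x]addrC; ring.
    by rewrite normrN -[X in _ <= e * X]normrN.
apply/nbhs_ballP; exists (Num.min r1 r2) => [|y] /=; first by rewrite lt_min r10.
rewrite /ball /= sub0r normrN lt_min => /andP[y1 y2].
have [y0|y0|->] := ltgtP y 0.
- have := H2 (- y); rewrite opprK sqrrN mulrN opprK [x + y]addrC; apply.
  by move: y2; rewrite ltr0_norm //; lra.
- by apply: H1; move: y1; rewrite gtr0_norm //; lra.
- by rewrite expr0n /= !mulr0 !addr0 add0r subrr normr0.
Qed.

Lemma chord_bounds_derive D g h (x : R) : open D -> chord_bounds D g h -> D x ->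
  derivable g x 1 -> derive1 g x = h x.
Proof.
move=> Do gh Dx dg; have [r r0 Dr] := open_segment Do Dx.
have H := derivable_quotient_cvg dg.
have Hr : (g y - g x) / (y - x) @[y --> x^'+] --> derive1 g x.
  by apply: cvg_trans H; apply: cvg_app; apply: within_subset => y /= xy; rewrite gt_eqF.
have Hl : (g y - g x) / (y - x) @[y --> x^'-] --> derive1 g x.
  by apply: cvg_trans H; apply: cvg_app; apply: within_subset => y /= xy; rewrite lt_eqF.
apply/eqP; rewrite eq_le; apply/andP; split.
  apply: (cvgr_to_le Hl); near=> y.
  have yx : y < x by near: y; exact: nbhs_left_lt.
  have yr : x - r < y by near: y; apply: nbhs_left_gt; lra.
  have /andP[_ +] : h y * (x - y) <= g x - g y <= h x * (x - y).
    by apply: gh => //; apply: Dr; lra.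
  by rewrite -ler_pdivrMr ?subr_gt0 // -[X in X / _]opprB -[X in _ / X]opprB invrN mulrNN.
apply: (cvgr_to_ge Hr); near=> y.
have yx : x < y by near: y; exact: nbhs_right_gt.
have yr : y < x + r by near: y; apply: nbhs_right_lt; lra.
have /andP[+ _] : h x * (y - x) <= g y - g x <= h y * (y - x).
  by apply: gh => //; apply: Dr; lra.
by rewrite -ler_pdivlMr // subr_gt0.
Unshelve. all: by end_near. Qed.

Lemma chord_bounds_derivable D g h (x : R) : open D -> chord_bounds D g h ->
  (forall z, D z -> {for z, continuous g}) -> D x -> derivable h x 1 ->
  derivable g x 1.
Proof.
move=> Do gh gc Dx dh.
suff : is_derive x 1 g (h x) by move=> dg; exact: ex_derive.
apply: cvg_quotient_derivable; apply/cvgrPdist_le => eps eps0.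
have /nbhs_ballP[r /= r0 Hr] := chord_bounds_peano Do gh gc Dx dh ltr01.
pose c := derive1 h x / 2; have c0 : 0 < 1 + `|c| by rewrite ltr_pwDl.
apply/nbhs_ballP; exists (Num.min r (eps / (1 + `|c|))) => [|y] /=.
  by rewrite lt_min r0 divr_gt0.
rewrite /ball /= distrC lt_min ltr_pdivlMr // => /andP[yr ye] yx.
have := Hr (y - x); rewrite /ball /= sub0r normrN subrK => /(_ yr) H.
have yx0 : y - x != 0 by rewrite subr_eq0.
have yx1 : 0 < `|y - x| by rewrite normr_gt0.
rewrite distrC -(ler_pM2r yx1) -normrM mulrBl divfK //.
move: H; rewrite mul1r -/c.
set E := g y - _ => H.
have -> : g y - g x - h x * (y - x) = E + c * (y - x) ^+ 2 by rewrite /E; ring.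
apply: le_trans (ler_normD _ _) _; rewrite normrM normrX.
have {}H : `|E| <= `|y - x| ^+ 2 by rewrite real_normK ?num_real.
have : `|y - x| * (1 + `|c|) * `|y - x| <= eps * `|y - x|.
  by rewrite ler_pM2r // ltW.
by move: H; move: `|E| `|y - x| `|c| => e t a; rewrite expr2; lra.
Qed.

End ChordDerivative.

(** * Hankel matrices of derivatives *)

Section Hankel.
Context {R : realType}.
Implicit Types (D E : set R) (f g G : R -> R).
Local Open Scope complex_scope.
Notation mu := (@lebesgue_measure R).

(** Turns the convolution square into a form indexed by i + j, from which the Hankel entries can be
    read. *)
Lemma sum_conv n (mu : nat -> R) q : (forall a, (n < a)%N -> mu a = 0) ->
  \sum_(0 <= i < q.+1) mu i * mu (q - i)%N =
  \sum_(i < n.+1) \sum_(j < n.+1) mu i * mu j * (q == (i + j)%N)%:R.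
Proof.
move=> mu0.
have inner (i : nat) : \sum_(j < n.+1) mu i * mu j * (q == (i + j)%N)%:R =
    if (i <= q)%N then mu i * mu (q - i)%N else 0.
  have [iq|qi] := leqP i q; last first.
    by rewrite big1 // => j _; rewrite ltn_eqF ?mulr0 // (leq_trans qi) ?leq_addr.
  have [qn|nq] := ltnP (q - i) n.+1.
    rewrite (bigD1 (Ordinal qn)) //=.
    rewrite subnKC // eqxx mulr1 big1 ?addr0 // => j jq.
    rewrite (_ : q == i + j = false)%N ?mulr0 //; apply: contraNF jq => /eqP qij.
    by apply/eqP/val_inj; rewrite /= qij addKn.
  rewrite [mu (q - i)%N]mu0 // mulr0 big1 // => j _.
  rewrite (_ : q == i + j = false)%N ?mulr0 //; apply/eqP => qij.
  by move: nq; rewrite qij addKn leqNgt ltn_ord.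
under [RHS]eq_bigr do rewrite inner.
rewrite -(big_mkord xpredT (fun i => if (i <= q)%N then mu i * mu (q - i)%N else 0)).
have [qn|nq] := leqP q n.
  rewrite [RHS](big_cat_nat (n := q.+1)) //=.
  have -> : \sum_(q.+1 <= i < n.+1)
      (if (i <= q)%N then mu i * mu (q - i)%N else 0) = 0.
    by rewrite big_nat big1 // => i /andP[qi _]; rewrite leqNgt qi.
  by rewrite addr0; apply: eq_big_nat => i /andP[_ iq]; rewrite -ltnS iq.
rewrite (big_cat_nat (n := n.+1)) //=; last by rewrite ltnW.
have -> : \sum_(n.+1 <= i < q.+1) mu i * mu (q - i)%N = 0.
  by rewrite big_nat big1 // => i /andP[ni _]; rewrite mu0 ?mul0r.
rewrite addr0; apply: eq_big_nat => i /andP[_ iin].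
by rewrite (leq_trans _ (ltnW nq)).
Qed.

Lemma wtone_hankel_psd k n D f (x : R) (c : nat -> R) : open D ->
  wtone k.+1 n.+1 D f -> D x ->
  peano f x (\poly_(j < (2 * n + k.+1).+1) (c j / j`!%:R)) (2 * n + k.+1) ->
  psdmx (\matrix_(i < n.+1, j < n.+1)
    (c (i + j + k.+1)%N / ((i + j + k.+1)`!)%:R)%:C).
Proof.
move=> Do ft Dx; set p := \poly_(j < _) _ => fp.
apply: psdmx_real => [i j|w]; first by rewrite [(i + j)%N]addnC.
have fx : wtone k.+1 n.+1 [set y | D (y + x)] (fun y => f (y + x)).
  exact: wtone_shift.
have nD : nbhs (0 : R) [set y | D (y + x)].
  have : (fun y : R => y + x) y @[y --> (0 : R)] --> x.
    rewrite -[X in _ --> X]add0r; apply: cvgD; [exact: cvg_id|exact: cvg_cst].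
  by apply; apply: open_nbhs_nbhs.
pose nu a : R := if insub a is Some i then w i else 0.
have nu0 a : (n < a)%N -> nu a = 0 by move=> na; rewrite /nu insubF // ltnS leqNgt na.
have nuE (i : 'I_n.+1) : nu i = w i by rewrite /nu valK.
have := wtone_hankel fx nD nu0 fp; congr (0 <= _).
under eq_bigr do rewrite (sum_conv _ nu0) mulr_sumr.
rewrite exchange_big /=; apply: eq_bigr => i _.
under eq_bigr do rewrite mulr_sumr.
rewrite exchange_big /=; apply: eq_bigr => j _.
under eq_bigr do rewrite mulrCA.
rewrite -mulr_sumr sum_coef_delta !nuE coef_poly addnC ifT //.
by have := ltn_ord i; have := ltn_ord j; lia.
Qed.

Lemma within_open D (x : R) : open D -> D x -> within D x^' = x^'.
Proof.
move=> Do Dx; apply/funext => P; apply/propext; split.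
  have nD : nbhs x D by apply: open_nbhs_nbhs.
  move=> H; have {}H : nbhs x (fun y => y != x -> D y -> P y) by exact: H.
  apply: filterS2 nD H => y Dy H yx; exact: H yx Dy.
move=> H; have {}H : nbhs x (fun y => y != x -> P y) by exact: H.
by apply: filterS H => y H yx _; exact: H yx.
Qed.

Lemma limit_point_open D (x : R) : open D -> D x -> limit_point D x.
Proof.
move=> Do Dx U /nbhs_ballP[d /= d0 dU]; have [r r0 Dr] := open_segment Do Dx.
pose e := Num.min r (d / 2); have e0 : 0 < e by rewrite lt_min r0 divr_gt0.
have er : e <= r by rewrite ge_min lexx.
have ed : e <= d / 2 by rewrite ge_min lexx orbT.
exists (x + e); split.
- by apply/eqP; lra.
- by apply: Dr; lra.
- by apply: dU; rewrite /ball /= opprD addNKr normrN gtr0_norm //; lra.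
Qed.

(** Otherwise an interval of positive length next to x would be null. *)
Lemma limit_point_ae D E (x : R) : open D -> D x ->
  {ae mu, forall y, D y -> E y} -> limit_point E x.
Proof.
move=> Do Dx [N [mN N0 EN]] U /nbhs_ballP[d /= d0 dU].
have [r r0 Dr] := open_segment Do Dx.
pose e := Num.min r d; have e0 : 0 < e by rewrite lt_min r0.
have er : e <= r by rewrite ge_min lexx.
have ed : e <= d by rewrite ge_min lexx orbT.
apply: contrapT => noE.
have sub : `]x, x + e[ `<=` N.
  move=> y /=; rewrite in_itv /= => /andP[xy ye]; apply: EN => /= DE.
  apply: noE; exists y; split.
  - by rewrite gt_eqF.
  - by apply: DE; apply: Dr; lra.
  - by apply: dU; rewrite /ball /= ltr_norml; lra.
have : (mu `]x, (x + e)%R[%classic <= mu N)%E.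
  by apply: le_measure; rewrite ?inE //; exact: measurable_itv.
rewrite N0 lebesgue_measure_itv /= lte_fin ltrDl e0 -EFinB lee_fin.
by rewrite leNgt => /negP; apply; lra.
Qed.

(** One step of [pderiv] with the domain and the values as free variables, so that a pair known only
    up to equality on its domain can be replaced. *)
Definition partial_derivative E g : set R * (R -> R) :=
  let q (x y : R) : R := (g y - g x) / (y - x) in
  ([set x | [/\ E x, limit_point E x & cvg (q x @ within E x^')]],
   fun x => lim (q x @ within E x^')).

Lemma partial_derivativeP E g G (x l : R) : (forall y, E y -> g y = G y) ->
  E x -> limit_point E x -> (G y - G x) / (y - x) @[y --> within E x^'] --> l ->
  (partial_derivative E g).1 x /\ (partial_derivative E g).2 x = l.
Proof.
move=> gG Ex lE Gl.
have FF : ProperFilter (within E x^').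
  apply: Build_ProperFilter_ex => P H.
  have {}H : nbhs x (fun y => y != x -> E y -> P y) by exact: H.
  by have [y [yx Ey Py]] := lE _ H; exists y; exact: Py.
have gl : (g y - g x) / (y - x) @[y --> within E x^'] --> l.
  apply: cvg_trans Gl; apply: near_eq_cvg; near=> y.
  rewrite !gG //; near: y.
  by apply: withinT.
split; last exact: (cvg_lim _ gl).
by split=> //; apply/cvg_ex; exists l.
Unshelve. all: by end_near. Qed.

Lemma partial_derivative_open D g G (x : R) : open D ->
  (forall y, D y -> g y = G y) ->
  (partial_derivative D g).1 x <-> D x /\ derivable G x 1.
Proof.
move=> Do gG; split=> [[Dx _ cq]|[Dx dG]].
  split; first exact: Dx.
  have [l ql] := proj1 (cvg_ex _) cq.
  suff dl : is_derive x 1 G l by exact: (@ex_derive _ _ _ _ _ _ _ dl).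
  apply: cvg_quotient_derivable; rewrite -(within_open Do Dx).
  apply: cvg_trans ql; apply: near_eq_cvg; near=> y.
  by rewrite !gG //; near: y; exact: withinT.
have := @partial_derivativeP D g G x (derive1 G x) gG Dx (limit_point_open Do Dx).
by rewrite (within_open Do Dx) => /(_ (derivable_quotient_cvg dG))[].
Unshelve. all: by end_near. Qed.

Lemma partial_derivative_val D g G (x : R) : open D ->
  (forall y, D y -> g y = G y) -> D x -> derivable G x 1 ->
  (partial_derivative D g).2 x = derive1 G x.
Proof.
move=> Do gG Dx dG.
have := @partial_derivativeP D g G x (derive1 G x) gG Dx (limit_point_open Do Dx).
by rewrite (within_open Do Dx) => /(_ (derivable_quotient_cvg dG))[].
Qed.

Lemma pderivS D f m : pderiv D f m.+1 =
  partial_derivative (pderiv D f m).1 (pderiv D f m).2.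
Proof. by []. Qed.

Lemma pderiv_Cn D f M : open D ->
  (forall j x, (j < M)%N -> D x -> derivable (derive1n j f) x 1) ->
  forall i, (i <= M)%N -> (pderiv D f i).1 = D /\
    forall x, D x -> (pderiv D f i).2 x = derive1n i f x.
Proof.
move=> Do df; elim=> [//|i IH] iM; have [] := IH (ltnW iM).
rewrite pderivS; move: (pderiv D f i).1 (pderiv D f i).2 => E g -> {E} gE; split.
  apply/funext => x; apply/propext; rewrite (partial_derivative_open _ Do gE).
  by split=> [[]|Dx]; [|split=> //; exact: df].
by move=> x Dx; apply: partial_derivative_val => //; exact: df.
Qed.

Lemma pderiv_next D f M : open D ->
  (forall j x, (j < M)%N -> D x -> derivable (derive1n j f) x 1) ->
  forall x, ((pderiv D f M.+1).1 x <-> D x /\ derivable (derive1n M f) x 1) /\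
    (D x -> derivable (derive1n M f) x 1 ->
     (pderiv D f M.+1).2 x = derive1n M.+1 f x).
Proof.
move=> Do df x; have [] := pderiv_Cn Do df (leqnn M).
rewrite pderivS; move: (pderiv D f M).1 (pderiv D f M).2 => E g -> {E} gE.
split; first exact: partial_derivative_open.
by move=> Dx dx; apply: partial_derivative_val.
Qed.

End Hankel.

(** * Taylor expansions and Hankel matrices almost everywhere *)

Section AlmostEverywhere.
Context {R : realType}.
Implicit Types (D E : set R) (f g G : R -> R).
Notation mu := (@lebesgue_measure R).

(* A derivative of order M is convex, so its right derivative is monotone and
   therefore differentiable almost everywhere. *)
Lemma ktone_ae_peano D f M : open D -> is_interval D -> ktone D M.+2 f ->
  {ae mu, forall x, D x ->
    (forall j, (j <= M.+2)%N -> (pderiv D f j).1 x) /\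
    peano f x (\poly_(j < M.+3) ((pderiv D f j).2 x / j`!%:R)) M.+2}.
Proof.
move=> Do Di ft; have fC := ktone_Cn Do Di ft.
have df j x : (j < M)%N -> D x -> derivable (derive1n j f) x 1.
  by move=> jM Dx; exact: fC.1.
have gt : ktone D 2 (derive1n M f).
  have ft2 : ktone D (M + 2) f by rewrite addn2.
  exact: (@ktone_derive1n _ D 0 M f Do Di ft2).
have gc z : D z -> {for z, continuous (derive1n M f)}.
  by move=> Dz; exact: fC.2.
have [h gh] := ktone2_chord_bounds Do Di gt.
have := nondecreasing_ae_derivable Do Di
  (fun x y Dx Dy xy => chord_bounds_le gh Dx Dy xy).
have FF := ae_filter_ringOfSetsType mu.
move=> aeh; move: (aeh); apply: filterS => x hx Dx; have dh := hx Dx.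
have E0 i (iM : (i <= M)%N) := pderiv_Cn Do df iM.
have E1 y := proj1 (pderiv_next Do df y).
have dg y : D y -> derivable h y 1 -> derivable (derive1n M f) y 1.
  by move=> Dy dhy; exact: (chord_bounds_derivable Do gh gc Dy dhy).
(* Wherever the derivative of order M + 1 exists it equals h, so its quotients along its own domain
   are those of h; that domain accumulates at x because it has full measure. *)
have E1D y : (pderiv D f M.+1).1 y -> (pderiv D f M.+1).2 y = h y.
  move=> /E1[Dy dy]; rewrite (proj2 (pderiv_next Do df y)) //.
  exact: chord_bounds_derive Do gh Dy dy.
have E1x : (pderiv D f M.+1).1 x := proj2 (E1 x) (conj Dx (dg x Dx dh)).
have E1l : limit_point (pderiv D f M.+1).1 x.
  apply: (limit_point_ae Do Dx); move: aeh; apply: filterS => y hy Dy.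
  exact: (proj2 (E1 y) (conj Dy (dg y Dy (hy Dy)))).
have hq : (h y - h x) / (y - x) @[y --> within (pderiv D f M.+1).1 x^'] -->
    derive1 h x.
  exact: cvg_trans (cvg_app _ (cvg_within _)) (derivable_quotient_cvg dh).
have [E2x E2v] := partial_derivativeP E1D E1x E1l hq.
split.
  move=> j; rewrite leq_eqVlt => /orP[/eqP ->|]; first exact: E2x.
  rewrite ltnS leq_eqVlt => /orP[/eqP ->|]; first exact: E1x.
  by rewrite ltnS => jM; rewrite (E0 _ jM).1.
pose c j := (pderiv D f j).2 x.
have cE i : (i <= M)%N -> c i = derive1n i f x by move=> iM; exact: (E0 _ iM).2.
have nD : nbhs x D by apply: open_nbhs_nbhs.
(* M primitives reduce the claim to the second order expansion of the M-th derivative. *)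
rewrite -[X in peano _ _ _ X]addn2; apply: peano_iter.
- by move=> i iM; apply: filterS nD => z Dz; exact: df.
- move=> i iM; rewrite horner_coef0 taylor_coef; last by rewrite addn0 ltnW // ltnW // ltnW.
  by rewrite addn0 divr1 -/(c i) cE // ltnW.
have pE : (\poly_(j < M.+3) (c j / j`!%:R))^`(M) =
    \poly_(i < 3) (c (M + i)%N / i`!%:R).
  apply/polyP => i; rewrite coef_poly; case: ltnP => [i3|i3].
    by rewrite taylor_coef //; lia.
  by rewrite coef_derivn coef_poly ifF ?mul0rn //; apply/negbTE; rewrite -leqNgt; lia.
rewrite -/c pE => eps eps0.
apply: filterS (chord_bounds_peano Do gh gc Dx dh eps0) => y.
rewrite horner_poly !big_ord_recl big_ord0 /= !addn0 addn1 addn2 cE //.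
rewrite (_ : c M.+1 = h x); last exact: E1D.
rewrite (_ : c M.+2 = derive1 h x); last exact: E2v.
rewrite real_normK ?num_real // expr0 expr1 mulr1 !divr1 addr0 addrA; apply.
Qed.

(** The case of size 1 and order 1, where 2n + k - 4 is negative and f is merely nondecreasing. *)
Lemma ktone1_ae_peano D f : open D -> is_interval D -> ktone D 1 f ->
  {ae mu, forall x, D x ->
    (forall j, (j <= 1)%N -> (pderiv D f j).1 x) /\
    peano f x (\poly_(j < 2) ((pderiv D f j).2 x / j`!%:R)) 1}.
Proof.
move=> Do Di ft.
have := nondecreasing_ae_derivable Do Di
  (fun x y Dx Dy xy => ktone1_le ft Dx Dy xy).
have FF := ae_filter_ringOfSetsType mu.
apply: filterS => x df Dx; have dfx := df Dx.
have df0 j y : (j < 0)%N -> D y -> derivable (derive1n j f) y 1.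
  by move=> j0; exfalso; rewrite ltn0 in j0.
have [E1 E2] := pderiv_next Do df0 x.
split.
  by move=> [|[|//]] _; [exact: Dx|exact: (proj2 E1 (conj Dx dfx))].
move=> eps eps0; apply: filterS (derivable_peano dfx eps0) => y.
rewrite horner_poly !big_ord_recl big_ord0 [(pderiv _ _ _).2 _]/=.
rewrite (E2 Dx dfx) /bump /= expr0 expr1 mulr1 !divr1 addr0; apply.
Qed.

Lemma wtone_ae_hankel k n D f : open D -> is_interval D ->
  wtone k.+1 n.+1 D f ->
  {ae mu, forall x, D x ->
    (forall i j : 'I_n.+1, (pderiv D f (i + j + k.+1)).1 x) /\
    psdmx (\matrix_(i < n.+1, j < n.+1)
      ((pderiv D f (i + j + k.+1)).2 x / ((i + j + k.+1)`!)%:R)%:C%C)}.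
Proof.
move=> Do Di ft; have FF := ae_filter_ringOfSetsType mu.
have tone := matrix_tone_ktone Do Di ft (leqnn n).
have : {ae mu, forall x, D x ->
    (forall j, (j <= 2 * n + k.+1)%N -> (pderiv D f j).1 x) /\
    peano f x (\poly_(j < (2 * n + k.+1).+1) ((pderiv D f j).2 x / j`!%:R))
      (2 * n + k.+1)}.
  move: tone; rewrite [(k.+1 + _)%N]addnC.
  have [->|m1] := eqVneq (2 * n + k.+1)%N 1%N; first exact: ktone1_ae_peano.
  have -> : (2 * n + k.+1)%N = (2 * n + k.+1 - 2).+2 by lia.
  exact: ktone_ae_peano.
apply: filterS => x H Dx; have [E fp] := H Dx; split.
  by move=> i j; apply: E; have := ltn_ord i; have := ltn_ord j; lia.
exact: (@wtone_hankel_psd _ k n D f x (fun j => (pderiv D f j).2 x)).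
Qed.

End AlmostEverywhere.

(** * The interval (a, b) and the conclusion *)

Section Endpoints.
Context {R : realType}.

Lemma open_eitv (a b : \bar R) : open (eitv a b).
Proof.
have -> : eitv a b = [set x : R | (a < x%:E)%E] `&` [set x : R | (x%:E < b)%E] by [].
apply: openI.
  case: a => [r| |].
  - rewrite (_ : [set _ | _] = [set x : R | r < x]); first exact: open_gt.
    by apply/funext => x; rewrite /= lte_fin.
  - rewrite (_ : [set _ | _] = set0); first exact: open0.
    by apply/funext => x; apply/propext; split=> //=; rewrite ltNge leey.
  - rewrite (_ : [set _ | _] = setT); first exact: openT.
    by apply/funext => x; apply/propext; split=> //= _; exact: ltNyr.
case: b => [r| |].
- rewrite (_ : [set _ | _] = [set x : R | x < r]); first exact: open_lt.
  by apply/funext => x; rewrite /= lte_fin.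
- rewrite (_ : [set _ | _] = setT); first exact: openT.
  by apply/funext => x; apply/propext; split=> //= _; exact: ltry.
- rewrite (_ : [set _ | _] = set0); first exact: open0.
  by apply/funext => x; apply/propext; split=> //=; rewrite ltNge leNye.
Qed.

Lemma is_interval_eitv (a b : \bar R) : is_interval (eitv a b).
Proof.
move=> x y [ax _] [_ yb] z /andP[xz zy]; split.
  by apply: lt_le_trans ax _; rewrite lee_fin.
by apply: le_lt_trans yb; rewrite lee_fin.
Qed.

Lemma ktone_derive1n_convex (D : set R) f i : open D -> is_interval D ->
  ktone D i.+2 f -> convex_function D (derive1n i f : R^o -> R^o).
Proof.
move=> Do Di; rewrite -addn2 => ft.
by apply: (ktone2_convex Di); exact: (@ktone_derive1n _ D 0 i f Do Di ft).
Qed.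

End Endpoints.

Local Open Scope complex_scope.

Theorem theorem2p1 (R : realType) (k n : nat) (a b : \bar R) (f : R -> R)
    (hk : (1 <= k)%N) (hn : (1 <= n)%N) (hab : (a < b)%E)
    (hf : matrix_tone k n a b f) :
  [/\ (* (a) *)
      (2 <= k)%N || (2 <= n)%N -> Cn_on (eitv a b) (2 * n + k - 4) f,
      (* (b) *)
      (k = 1%N -> (2 <= n)%N ->
        forall l, (2 * l + 1 <= 2 * n - 3)%N ->
          convex_function (eitv a b) (derive1n (2 * l + 1) f : R^o -> R^o)) /\
      ((2 <= k)%N ->
        forall l, (k - 2 + 2 * l <= 2 * n + k - 4)%N ->
          convex_function (eitv a b) (derive1n (k - 2 + 2 * l) f : R^o -> R^o)),
      (* (c) *)
      forall hn2 : (2 <= n)%N,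
        exists2 g : 'rV[R]_k.+1 -> R, divdiff_extension a b f g &
        forall x : 'I_n -> R, (forall i, eitv a b (x i)) ->
          let x1 := x (Ordinal (ltnW hn2)) in
          psdmx (\matrix_(i < n, j < n)
            (g (\row_(l < k.+1) nth x1 [:: x i; x j] l))%:C)
    & (* (d) *)
      {ae @lebesgue_measure R, forall x, eitv a b x ->
        (forall i j : 'I_n, (pderiv (eitv a b) f (i + j + k)).1 x) /\
        psdmx (\matrix_(i < n, j < n)
          ((pderiv (eitv a b) f (i + j + k)).2 x / ((i + j + k)`!)%:R)%:C)}].
Proof.
case: k n hk hn hf => [//|k'] [//|n'] _ _ hf'.
set D := eitv a b; have Do : open D := @open_eitv R a b.
have Di : is_interval D := @is_interval_eitv R a b.
have ft := matrix_tone_wtone hf'.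
have tone l (ln : (l <= n')%N) := matrix_tone_ktone Do Di ft ln.
split.
- move=> kn; apply: ktone_Cn => //.
  (* The assumption [kn] gives 2n + k >= 4, so the natural subtraction does not truncate; l = n - 1
     yields the top tone order 2n + k - 2. *)
  have -> : (2 * n'.+1 + k'.+1 - 4).+2 = (k'.+1 + 2 * n')%N.
    by move: kn; move=> /orP[]; lia.
  exact: tone.
- split.
    move=> k1 n2 l ln; apply: ktone_derive1n_convex => //.
    (* Convexity of the derivative of order i comes from tone of order i + 2, here 1 + 2 (l + 1). *)
    have -> : (2 * l + 1).+2 = (k'.+1 + 2 * l.+1)%N by lia.
    by apply: tone; lia.
  move=> k2 l ln; apply: ktone_derive1n_convex => //.
  have -> : (k'.+1 - 2 + 2 * l).+2 = (k'.+1 + 2 * l)%N by lia.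
  by apply: tone; lia.
- case: n' hf' ft tone => [//|n''] hf' ft tone hn2.
  exists (fun y : 'rV[R]_k'.+2 => ddext k'.+1 f (fun l => y ord0 (inord l))).
    exact: ddext_extension Do Di ft.
  move=> x xD x1; have -> : x1 = x ord0 by congr (x _); exact: val_inj.
  exact: divdiff_extension_psd Do Di ft xD.
- exact: wtone_ae_hankel Do Di ft.
Qed.
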